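(* Let $W$ be a finite-dimensional $\mathbb{Z}/2\mathbb{Z}$-graded vector space over $\mathbb{Q}$ with a symmetric nondegenerate odd bilinear form, let $V:=\Pi W$, and let $h\in\mathcal{MC}(\mathfrak{h}_{\geq 2}[V])$ be a cyclic $A_\infty$-structure on $W$. Write $\Lambda:=\Lambda_{\gamma,\nu}[V]$ with its filtration $F_p=F_p[\Lambda]$. Let $n\ge 0$ and let $x_n=h_0+h_1+\cdots+h_n\in\mathcal{MC}(\Lambda/F_{n+1})$, where $h_i\in\Lambda$ is homogeneous of order $i$ and $h_0=h$. Let $o_{n+1}\in\Lambda$ be the element homogeneous of order $n+1$ determined by $$d(x_n)+\tfrac12[x_n,x_n]=o_{n+1}\mod F_{n+2}.$$ Then $o_{n+1}$ is a cocycle for the differential $\mathrm{ad}\,h=[h,-]$ on $\Lambda$. Moreover, $x_n$ is extendable to an element $x_{n+1}=x_n+h_{n+1}\in\mathcal{MC}(\Lambda/F_{n+2})$, with $h_{n+1}\in\Lambda$ homogeneous of order $n+1$, if and only if the class of $o_{n+1}$ in $\mathcal{H}^{n+1}(A)$ vanishes.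
   Context: Conventions. All spaces are over $\mathbb{Q}$, $\mathbb{Z}/2\mathbb{Z}$-graded; $\Pi$ is parity reversion; $|a|$ is parity. A differential graded Lie algebra (dgla) has an odd bracket, meaning that $\Pi\mathfrak g$ is an ordinary dgla: explicitly $[a,b]=(-1)^{|a||b|}[b,a]$, $[[a,b],c]+(-1)^{|b||c|}[[a,c],b]+(-1)^{|a|(|b|+|c|)}[[b,c],a]=0$, $d$ odd, $d^2=0$, $d[a,b]=-[da,b]-(-1)^{|a|}[a,db]$. $\mathcal{MC}(\mathfrak g)=\{x\in\mathfrak g_0: dx+\frac12[x,x]=0\}$. The Lie bialgebra $\mathfrak h[V]$. The form on $W$ makes $V=\Pi W$ a space with a nondegenerate skew-symmetric odd bilinear form $\langle-,-\rangle$. The dual odd form $\langle-,-\rangle^{-1}$ on $V^*$ is: for a basis $x_i$ (even), $\xi_i$ (odd) of $V$ with $\langle x_i,\xi_j\rangle=\delta_{ij}$, $\langle x_i^*,\xi_j^*\rangle^{-1}=\langle\xi_j^*,x_i^*\rangle^{-1}=\delta_{ij}$, other values zero. Put $\mathfrak h=\mathfrak h[V]:=\prod_{n\ge0}[(V^* )^{\otimes n}]_{\mathbb Z/n\mathbb Z}$ (cyclic words, Koszul signs), and $\mathfrak h_{\ge i}$ the part of words of length $\ge i$. Bracket: $$\{a_1\cdots a_n,b_1\cdots b_m\}=\sum_{i,j}\pm\langle a_i,b_j\rangle^{-1}\,a_{i+1}\cdots a_na_1\cdots a_{i-1}\,b_{j+1}\cdots b_mb_1\cdots b_{j-1},$$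 $\pm$ being the Koszul sign of the permutation of letters taking $a_1\cdots a_nb_1\cdots b_m$ to $a_ib_ja_{i+1}\cdots a_{i-1}b_{j+1}\cdots b_{j-1}$. Cobracket: $$\Delta(a_1\cdots a_n)=\tfrac12\sum_{i<j}(-1)^p\langle a_i,a_j\rangle^{-1}[1+(1\,2)]\cdot[(a_{i+1}\cdots a_{j-1})\otimes(a_{j+1}\cdots a_na_1\cdots a_{i-1})],$$ $p=|a_i|(|a_1|+\dots+|a_i|)+|a_j|(|a_1|+\dots+|a_j|)+(|a_1|+\dots+|a_{i-1}|)(|a_{i+1}|+\dots+|a_{j-1}|+|a_{j+1}|+\dots+|a_n|)$. These make $\mathfrak h$ an involutive Lie bialgebra, and $\mathfrak h_{\ge2}$ is a Lie subalgebra. The dgla $\Lambda_{\gamma,\nu}[V]$. On $\widehat S(\mathfrak h)=\prod_n(\mathfrak h^{\hat\otimes n})_{S_n}$ let $\delta(g_1\cdots g_n)=\sum_{i<j}\pm\{g_i,g_j\}g_1\cdots\hat g_i\cdots\hat g_j\cdots g_n$ (Koszul sign for moving $g_i,g_j$ to the front), extend $\Delta$ as a derivation, and extend the bracket by the Leibniz rule: $[x,y]=\delta(xy)-\delta(x)y-(-1)^{|x|}x\delta(y)$. Then $\mathfrak l:=\widehat S(\mathfrak h)\hat\otimes\mathbb Q[[\gamma]]$ ($\gamma$ an even parameter) with $d:=\gamma\delta+\Delta$ is a dgla. Since $\mathfrak h=\mathfrak h_{\ge1}\times\mathbb Q$, writing $\nu$ for the empty word gives $\mathfrak l=\widehat S(\mathfrak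 h_{\ge1})\hat\otimes\mathbb Q[[\gamma,\nu]]$. The summand $\mathbb Q[[\gamma,\nu]]$ is a dg ideal; the quotient is identified with $\mathfrak l'=\widehat S^{\ge1}(\mathfrak h_{\ge1})\hat\otimes\mathbb Q[[\gamma,\nu]]$. Finally $\Lambda_{\gamma,\nu}[V]\subset\mathfrak l'$ is the sub-dgla of elements whose component on a single cyclic word of length 1 with no factor of $\gamma$ or $\nu$ is zero. Filtration. A tensor $\gamma^g\nu^m h_1\cdots h_k$ ($h_i\in\mathfrak h_{\ge1}$) has order $2g+m+k-1$; $F_p[\Lambda_{\gamma,\nu}]$ consists of all tensors of order $\ge p$. Each $F_p$ is a dg ideal, $[F_p,F_q]\subset F_{p+q}$, $d(F_p)\subset F_{p+1}$, and $\Lambda_{\gamma,\nu}/F_1=\mathfrak h_{\ge2}$ (with zero differential); $\mathfrak h_{\ge2}$ is also embedded in $\Lambda_{\gamma,\nu}$ as the order-zero part, which is a Lie subalgebra. Cyclic $A_\infty$-structure and $\mathcal H^\bullet(A)$. A cyclic $A_\infty$-structure on $W$ is $h\in\mathcal{MC}(\mathfrak h_{\ge2}[V])$, i.e. $h$ even with $\{h,h\}=0$; the corresponding cyclic $A_\infty$-algebra is $A=(W,\langle-,-\rangle,h)$. Then $\mathrm{ad}\,h=[h,-]$ is a differential on $\Lambda_{\gamma,\nu}$ preserving order. $\mathcal H^\bullet(A)$ is the cohomology of $(\Lambda_{\gamma,\nu},\mathrm{ad}\,h)$, and $\mathcal H^{n}(A)$ is its part of order $n$. *)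

(* Defs.v *)
From HB Require Import structures.
From mathcomp Require Import all_boot all_order all_algebra.
From mathcomp Require Import ring_quotient sesquilinear.
From mathcomp Require Import boolp classical_sets functions.

Set Implicit Arguments.
Unset Strict Implicit.
Unset Printing Implicit Defensive.

Import GRing.Theory.
Local Open Scope ring_scope.
Local Open Scope quotient_scope.

(* [Wg false] and [Wg true] are the even and the odd part of W. *)
Record odd_symmetric_space (W : vectType rat) (Wg : bool -> {vspace W})
    (form : {biscalar W}) : Prop := OddSymmetricSpace {
  oss_span : (Wg false + Wg true)%VS = fullv;
  oss_direct : (Wg false :&: Wg true)%VS = 0%VS;
  oss_odd : forall p a b, a \in Wg p -> b \in Wg p -> form a b = 0;
  oss_sym : forall p q a b, a \in Wg p -> b \in Wg q ->
    form a b = (-1) ^+ (p && q) * form b a;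
  oss_nondeg : forall a, (forall b, form a b = 0) -> a = 0 }.

Record homogeneous_basis (W : vectType rat) (Wg : bool -> {vspace W}) (r : nat)
    (e : r.-tuple W) (par : 'I_r -> bool) : Prop := HomogeneousBasis {
  hb_basis : basis_of fullv e;
  hb_par : forall i, tnth e i \in Wg (par i) }.

(* Parities of the basis (Pi e_i) of V = Pi W, hence of its dual basis. *)
Definition Vpar r (par : 'I_r -> bool) : 'I_r -> bool := fun i => ~~ par i.

(* Gram matrix of the skew-symmetric odd form on V in the basis (Pi e_i):
   <Pi a, Pi b> = (-1)^|a| <a, b>. *)
Definition Vgram (W : vectType rat) (form : {biscalar W}) r (e : r.-tuple W)
    (par : 'I_r -> bool) : 'M[rat]_r :=
  \matrix_(i, j) ((-1) ^+ par i * form (tnth e i) (tnth e j)).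

(* The form <-,->^-1 on V^* in the dual basis of a homogeneous basis (v_i) with
   parities vpar and Gram matrix G. The matrix (G^-1)^T transforms as a bilinear
   form on V^*, and the sign depends only on the parities, so this is independent
   of the homogeneous basis; inv_form_darboux evaluates it on x_i, xi_i. *)
Definition inv_form r (vpar : 'I_r -> bool) (G : 'M[rat]_r) : 'I_r -> 'I_r -> rat :=
  fun i j => (-1) ^+ vpar i * invmx G j i.

Lemma inv_form_darboux r (i j : 'I_(r + r)) :
  inv_form (fun k : 'I_(r + r) => (r <= k)%N)
    (block_mx 0 1%:M (- 1%:M) 0) i j =
  (block_mx 0 1%:M 1%:M 0 : 'M[rat]_(r + r)) i j.
Proof.
have mulE : (block_mx 0 1%:M (- 1%:M) 0 : 'M[rat]_(r + r)) *m
    block_mx 0 (- 1%:M) 1%:M 0 = 1%:M.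
  rewrite mulmx_block !mulmx0 !mul0mx !mulmx1 ?mul1mx !addr0 !add0r.
  by rewrite mulNmx mulmxN opprK mul1mx -scalar_mx_block.
have [uG _] := mulmx1_unit mulE.
rewrite /inv_form.
have -> : invmx (block_mx 0 1%:M (- 1%:M) 0 : 'M[rat]_(r + r)) =
    block_mx 0 (- 1%:M) 1%:M 0.
  by rewrite -[LHS]mulmx1 -mulE mulmxA mulVmx // mul1mx.
rewrite -[i]splitK -[j]splitK.
case: (fintype.split i) => a; case: (fintype.split j) => b /=.
- by rewrite !block_mxEul !mxE mulr0.
- by rewrite block_mxEdl block_mxEur !mxE leqNgt ltn_ord expr0 mul1r eq_sym.
- rewrite block_mxEur block_mxEdl !mxE leq_addr expr1 mulN1r opprK eq_sym.
  by [].
- by rewrite !block_mxEdr !mxE mulr0.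
Qed.

(* The list s gives, in their new order, the original positions of objects whose
   parities are p; the result is true iff the Koszul sign of the rearrangement
   is -1, i.e. iff the number of inverted pairs of odd objects is odd. *)
Fixpoint koszul (p : nat -> bool) (s : seq nat) : bool :=
  if s is x :: s' then
    (p x && odd (count (fun y => (y < x)%N && p y) s')) (+) koszul p s'
  else false.

Section LieBialgebra.

(* A finite homogeneous basis I of V^*, with parities lp and odd form c. *)
Variables (I : finType) (lp : I -> bool) (c : I -> I -> rat).

Notation word := (seq I).

Definition wpar (w : word) : bool := odd (count lp w).

(* prod_n (V^* )^{(x) n}, by coefficients in the basis of words. *)
Definition tseries := (word -> rat)%type.
HB.instance Definition _ := GRing.Lmodule.copy tseries (word -> rat^o).

Definition rot_sign (w : word) : rat :=
  (-1) ^+ koszul (nth false (map lp w)) (rot 1 (iota 0 (size w))).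

(* The span of the elements v - s.v, for s the generator of Z/n in each length n;
   it is the same as the span over all of Z/n. *)
Definition cyc_null_prop (f : tseries) : Prop :=
  exists u : tseries, forall w, f w = u w - rot_sign w * u (rot 1 w).
Definition cyc_null : {pred tseries} := fun f => `[< cyc_null_prop f >].

Lemma cyc_null_submod : submod_closed cyc_null.
Proof.
split; first by apply/asboolP; exists 0 => w /=; rewrite mulr0 subr0.
move=> a f f' /asboolP[u uE] /asboolP[u' u'E]; apply/asboolP.
exists (a *: u + u') => w.
have -> : (a *: f + f') w = a * f w + f' w by [].
rewrite uE u'E mulrBr mulrCA addrACA -opprD -mulrDr.
by [].
Qed.

HB.instance Definition _ := GRing.isSubmodClosed.Build rat tseries cyc_null
  cyc_null_submod.

(* The space h[V]. *)
Definition cyc := Quotient.quot cyc_null.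
HB.instance Definition _ := GRing.Zmodule.on cyc.

Definition cyc_supported (P : pred word) (x : cyc) : Prop :=
  exists2 f : tseries, x = \pi_cyc f & forall w, ~~ P w -> f w = 0.

Definition cyc_even (x : cyc) := cyc_supported (fun w => ~~ wpar w) x.
Definition cyc_ge (i : nat) (x : cyc) := cyc_supported (fun w => (i <= size w)%N) x.

(* Coefficient of w in {a, b}, for words a and b. *)
Definition brw (a b w : word) : rat :=
  \sum_(i < size a) \sum_(j < size b)
    (-1) ^+ koszul (nth false (map lp (a ++ b)))
      ([:: nat_of_ord i; size a + j]%N
         ++ iota i.+1 (size a - i.+1)%N ++ iota 0 i
         ++ iota (size a + j.+1)%N (size b - j.+1)%N ++ iota (size a) j)
    * c (tnth (in_tuple a) i) (tnth (in_tuple b) j)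
    * (w == drop i.+1 a ++ take i a ++ drop j.+1 b ++ take j b)%:R.

(* {a, b} has size a + size b - 2 letters. *)
Definition tbr (f f' : tseries) : tseries := fun w =>
  \sum_(k < (size w).+3) \sum_(a : k.-tuple I) \sum_(b : ((size w).+2 - k)%N.-tuple I)
    f a * f' b * brw a b w.

(* tbr is compatible with cyc_null, so the choice of representatives is
   irrelevant. *)
Definition cyc_br (x y : cyc) : cyc := \pi_cyc (tbr (repr x) (repr y)).

(* Maurer-Cartan elements of h_{>= 2}: cyclic A-infinity structures. *)
Definition MC_cyc (h : cyc) : Prop :=
  [/\ cyc_ge 2 h, cyc_even h & cyc_br h h = 0].

(* Coefficient of u (x) v in Delta a, for a word a. *)
Definition cobw (a u v : word) : rat :=
  2^-1 * \sum_(i < size a) \sum_(j < size a | (i < j)%N)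
    let ai := tnth (in_tuple a) i in let aj := tnth (in_tuple a) j in
    let w1 := drop i.+1 (take j a) in let w2 := drop j.+1 a ++ take i a in
    let p := (lp ai * count lp (take i.+1 a) + lp aj * count lp (take j.+1 a)
      + count lp (take i a) * (count lp w1 + count lp (drop j.+1 a)))%N in
    (-1) ^+ p * c ai aj
    * (((u == w1) && (v == w2))%:R
       + (-1) ^+ (wpar w1 && wpar w2) * ((u == w2) && (v == w1))%:R).

(* The monomial gamma^g h_1 ... h_k is (g, [:: h_1; ...; h_k]). The factors may
   be the empty word, which is the parameter nu. *)
Definition mon := (nat * seq word)%type.

Definition mpar (m : mon) : bool := odd (count lp (flatten m.2)).

(* For a monomial gamma^g nu^m h_1 ... h_k, size m.2 is m + k, so this is
   2g + m + k - 1 as soon as there is at least one word. *)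
Definition mord (m : mon) : nat := (2 * m.1 + size m.2).-1%N.

Definition series := (mon -> rat)%type.
HB.instance Definition _ := GRing.Lmodule.copy series (mon -> rat^o).

Definition swap_words (p : nat) (ws : seq word) : seq word :=
  take p ws ++ [:: nth [::] ws p.+1; nth [::] ws p] ++ drop p.+2 ws.

Definition rot_word (p : nat) (ws : seq word) : seq word :=
  take p ws ++ rot 1 (nth [::] ws p) :: drop p.+1 ws.

(* The kernel of the projection to l': up to monomials in gamma and nu alone, f is
   a sum of elements v - s.v, where s is an adjacent transposition of the factors
   or a rotation of one factor. *)
Definition lie_null_prop (f : series) : Prop :=
  exists u v : nat -> series, forall m : mon, has (fun w => w != [::]) m.2 ->
    f m =
      \sum_(p < (size m.2).-1)
        (u p m - (-1) ^+ (wpar (nth [::] m.2 p) && wpar (nth [::] m.2 p.+1))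
                 * u p (m.1, swap_words p m.2))
    + \sum_(p < size m.2)
        (v p m - rot_sign (nth [::] m.2 p) * v p (m.1, rot_word p m.2)).
Definition lie_null : {pred series} := fun f => `[< lie_null_prop f >].

Lemma lie_null_submod : submod_closed lie_null.
Proof.
split.
  apply/asboolP; exists (fun=> 0), (fun=> 0) => m _ /=.
  by rewrite !big1 ?addr0 // => p _; rewrite mulr0 subr0.
move=> a f f' /asboolP[u [v uvE]] /asboolP[u' [v' uvE']]; apply/asboolP.
exists (fun p => a *: u p + u' p), (fun p => a *: v p + v' p) => m mP.
have linE (x y x' y' t : rat) :
    a * (x - t * y) + (x' - t * y') = a * x + x' - t * (a * y + y').
  by rewrite mulrBr mulrDr opprD addrACA mulrCA.
have -> : (a *: f + f') m = a * f m + f' m by [].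
rewrite (uvE _ mP) (uvE' _ mP) mulrDr addrACA !mulr_sumr -!big_split /=.
by congr (_ + _); apply: eq_bigr => p _; apply: linE.
Qed.

HB.instance Definition _ := GRing.isSubmodClosed.Build rat series lie_null
  lie_null_submod.

(* l' = l / Q[[gamma, nu]]. *)
Definition lie := Quotient.quot lie_null.
HB.instance Definition _ := GRing.Zmodule.on lie.

Definition lie_scale (a : rat) (x : lie) : lie := \pi_lie (a *: repr x).

Lemma pi_lie_eq (f f' : series) : (\pi_lie f = \pi_lie f') <-> f - f' \in lie_null.
Proof. by rewrite Quotient.idealrBE; split=> /eqP. Qed.

Lemma pi_lie_scale a (f : series) : lie_scale a (\pi_lie f) = \pi_lie (a *: f).
Proof.
apply/pi_lie_eq; rewrite -scalerBr rpredZ //.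
by apply/pi_lie_eq; rewrite reprK.
Qed.

Lemma pi_lie_surj (x : lie) : exists f : series, x = \pi_lie f.
Proof. by exists (repr x); rewrite reprK. Qed.

Lemma pi_lieD (f g : series) : \pi_lie (f + g) = \pi_lie f + \pi_lie g.
Proof. exact: (raddfD \pi_(Quotient.quot lie_null)). Qed.

Fact lie_scaleA a b x : lie_scale a (lie_scale b x) = lie_scale (a * b) x.
Proof. by have [f ->] := pi_lie_surj x; rewrite !pi_lie_scale scalerA. Qed.
Fact lie_scale1 : left_id 1 lie_scale.
Proof. by move=> x; have [f ->] := pi_lie_surj x; rewrite pi_lie_scale scale1r. Qed.
Fact lie_scaleDr : right_distributive lie_scale +%R.
Proof.
move=> a x y; have [f ->] := pi_lie_surj x; have [g ->] := pi_lie_surj y.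
by rewrite -pi_lieD !pi_lie_scale scalerDr pi_lieD.
Qed.
Fact lie_scaleDl x : {morph lie_scale^~ x : a b / a + b}.
Proof.
move=> a b; have [f ->] := pi_lie_surj x.
by rewrite !pi_lie_scale scalerDl pi_lieD.
Qed.
HB.instance Definition _ := GRing.Zmodule_isLmodule.Build rat lie
  lie_scaleA lie_scale1 lie_scaleDr lie_scaleDl.

Definition supported (P : pred mon) (x : lie) : Prop :=
  exists2 f : series, x = \pi_lie f & forall m, ~~ P m -> f m = 0.

Definition lie_even (x : lie) := supported (fun m => ~~ mpar m) x.

(* The sum of F over the sequences of k words having l letters in total. *)
Definition sum_words (k l : nat) (F : seq word -> rat) : rat :=
  \sum_(s : k.-tuple 'I_l.+1 | sumn (map val s) == l) \sum_(t : l.-tuple I)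
    F (reshape (map val s) t).

(* Coefficient of us in delta ws. *)
Definition delta_coef (ws us : seq word) : rat :=
  \sum_(i < size ws) \sum_(j < size ws | (i < j)%N)
    let others := [seq q : nat <- iota 0 (size ws) | (q != i) && (q != j)] in
    (-1) ^+ koszul (nth false (map wpar ws)) [:: nat_of_ord i, nat_of_ord j & others]
    * (if us is u :: us' then
         brw (nth [::] ws i) (nth [::] ws j) u
         * (us' == [seq nth [::] ws q | q <- others])%:R
       else 0).

(* Coefficient of us in Delta ws, for Delta extended as an odd derivation. *)
Definition Delta_coef (ws us : seq word) : rat :=
  \sum_(r < size ws)
    (-1) ^+ odd (count lp (flatten (take r ws)))
    * cobw (nth [::] ws r) (nth [::] us r) (nth [::] us r.+1)
    * ((size us == (size ws).+1) && (take r us == take r ws)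
       && (drop r.+2 us == drop r.+1 ws))%:R.

(* delta and Delta remove two letters; delta removes and Delta adds one factor. *)
Definition sdelta (f : series) : series := fun m =>
  sum_words (size m.2).+1 (size (flatten m.2)).+2
    (fun ws => f (m.1, ws) * delta_coef ws m.2).

Definition sDelta (f : series) : series := fun m =>
  sum_words (size m.2).-1 (size (flatten m.2)).+2
    (fun ws => f (m.1, ws) * Delta_coef ws m.2).

Definition sgamma (f : series) : series := fun m =>
  if m.1 is g.+1 then f (g, m.2) else 0.

Definition sd (f : series) : series := sgamma (sdelta f) + sDelta f.

Definition smul (f f' : series) : series := fun m =>
  \sum_(g < m.1.+1) \sum_(k < (size m.2).+1)
    f (nat_of_ord g, take k m.2) * f' ((m.1 - g)%N, drop k m.2).

(* x |-> (-1)^|x| x *)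
Definition ssign (f : series) : series := fun m => (-1) ^+ mpar m * f m.

Definition sbr (f f' : series) : series :=
  sdelta (smul f f') - smul (sdelta f) f' - smul (ssign f) (sdelta f').

(* sd and sbr are compatible with lie_null, so the choice of representatives is
   irrelevant. *)
Definition lie_d (x : lie) : lie := \pi_lie (sd (repr x)).
Definition lie_br (x y : lie) : lie := \pi_lie (sbr (repr x) (repr y)).

Definition curv (x : lie) : lie := lie_d x + 2^-1 *: lie_br x x.

Definition Lam (x : lie) : Prop :=
  supported (fun m => ~~ ((m.1 == 0)%N && (map size m.2 == [:: 1%N]))) x.

Definition Lam_hom (p : nat) (x : lie) : Prop :=
  Lam x /\ supported (fun m => mord m == p) x.

Definition Fil (p : nat) (x : lie) : Prop :=
  Lam x /\ supported (fun m => (p <= mord m)%N) x.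

(* The class of x in Lambda / F_p is a Maurer-Cartan element. *)
Definition MC_mod (p : nat) (x : lie) : Prop :=
  [/\ Lam x, exists2 y, Fil p y & lie_even (x - y) & Fil p (curv x)].

(* The embedding of h_{>= 2} as the order-zero part. *)
Definition emb (x : cyc) : lie :=
  \pi_lie (fun m : mon => if m is (0, [:: w])%N then repr x w else 0).

Definition cocycle (h : cyc) (z : lie) : Prop := lie_br (emb h) z = 0.

(* The class of z in H^n(A): the coset of z modulo the coboundaries of order n. *)
Definition coh_class (h : cyc) (n : nat) (z : lie) : set lie :=
  [set z' | exists2 y, Lam_hom n y & z' = z + lie_br (emb h) y]%classic.

End LieBialgebra.

Arguments cyc {I} lp.
Arguments lie {I} lp.

(* Main.v *)
(* The curvature F(x) = d x + 1/2 [x, x] of an even x satisfies the Bianchi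
   identity d F(x) + [x, F(x)] = 0. As d raises the order by one, its component
   of order n+1 at x = x_n is [h, o_{n+1}] = 0. If h' has order n+1, then
   F(x_n + h') = o_{n+1} + [h, h'] modulo F_{n+2}, so an extension is an even
   primitive of - o_{n+1}; as o_{n+1} is odd, any primitive can be replaced by its
   even part.

   The Bianchi identity, and the independence of d and [,] of representatives, are
   read off a matrix model. A letter becomes an N x N matrix of edges, a cyclic word
   the trace of the product of its matrices, and gamma^g h_1 ... h_k is paired with
   a family Psi_q of supersymmetric functions of lists of edges by
   (-1)^g Psi_{2g+k} (tr h_1 ... tr h_k). Under this pairing d becomes minus the
   odd Laplacian that contracts two edges, and the bracket its failure to be a
   derivation; for these the identities follow, as for any BV operator, from
   lap o lap = 0. Conversely an element is zero if all its pairings vanish: lists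
   of edges with distinct sources determine their closed paths, hence the cyclic
   words, and the growth in N determines the power of nu. *)

Require Import Defs.
From mathcomp Require Import all_boot all_order all_algebra ring lra zify.
From mathcomp Require Import ring_quotient sesquilinear.
From mathcomp Require Import boolp classical_sets functions.

Set Implicit Arguments.
Unset Strict Implicit.
Unset Printing Implicit Defensive.

Import Order.TTheory GRing.Theory Num.Theory.
Local Open Scope ring_scope.

(** Coinvariants carry a Koszul sign for every swap and rotation, so identities between words would
    require representatives and a comparison of signs at each step. Functions of lists of edges obey
    a single sign rule, [supersym], and every operator is transposed to them. Series are infinite
    products, so a test has bounded support and a pairing is a sum over a finite box; the margins
    between bounds leave room for the letters, words and factors gamma that an operator moves. Tests
    vanish on the empty list of edges because monomials in gamma and nu alone are divided out. The
    index 2g + k rises by one under both gamma delta and Delta, so a single contraction accounts for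
    both; the bracket lowers it by one and is therefore treated first after multiplication by gamma.
    Order is index minus one and parity is that of the list of edges, so the gradings are read off
    the tests as well. *)

Notation sg b := ((-1) ^+ nat_of_bool b : rat).

Definition linear_fun (T : Type) (L : (T -> rat) -> rat) :=
  forall a F G, L (fun t => a * F t + G t) = a * L F + L G.

Section LinearFun.

Variables (T : Type) (L : (T -> rat) -> rat).
Hypothesis linL : linear_fun L.

Lemma linear_fun0 : L (fun=> 0) = 0.
Proof. by have := linL (-1) (fun=> 0) (fun=> 0); rewrite mulr0 addr0 mulN1r addNr. Qed.

Lemma linear_funZ a F : L (fun t => a * F t) = a * L F.
Proof.
rewrite -[RHS]addr0 -linear_fun0 -linL; congr L.
by apply/funext => t; rewrite addr0.
Qed.

Lemma linear_fun2 a b F G : L (fun t => a * F t + b * G t) = a * L F + b * L G.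
Proof. by rewrite linL linear_funZ. Qed.

Lemma linear_funD F G : L (fun t => F t + G t) = L F + L G.
Proof.
rewrite -[L F]mul1r -linL; congr L.
by apply/funext => t; rewrite mul1r.
Qed.

Lemma linear_funN F : L (fun t => - F t) = - L F.
Proof.
rewrite -mulN1r -linear_funZ; congr L.
by apply/funext => t; rewrite mulN1r.
Qed.

Lemma linear_funB F G : L (fun t => F t - G t) = L F - L G.
Proof. by rewrite linear_funD linear_funN. Qed.

Lemma linear_fun_sum (J : Type) (r : seq J) (F : J -> T -> rat) :
  L (fun t => \sum_(j <- r) F j t) = \sum_(j <- r) L (F j).
Proof.
elim: r => [|j r IH].
  rewrite big_nil -[RHS]linear_fun0; congr L.
  by apply/funext => t; rewrite big_nil.
rewrite big_cons -IH -linear_funD; congr L.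
by apply/funext => t; rewrite big_cons.
Qed.

End LinearFun.

(** * Contractions of lists of edges *)

Section Laplacian.

Variables (E : Type) (ep : E -> bool) (g : E -> E -> rat).
Hypothesis g_sym : forall x y, g x y = g y x.
Hypothesis g_odd : forall x y, ep x = ep y -> g x y = 0.

Implicit Types (x y z e : E) (u v w m : seq E) (psi : seq E -> rat).

Definition wp u := odd (count ep u).

Lemma wp_cat u v : wp (u ++ v) = wp u (+) wp v.
Proof. by rewrite /wp count_cat oddD. Qed.

Lemma wp_cons x u : wp (x :: u) = ep x (+) wp u.
Proof. by rewrite /wp /= oddD oddb. Qed.

(* [ins e psi u] sums [psi] over the contractions of [e] with a letter of [u],
   [lap psi u] over the contractions of two letters of [u], and [cross u psi m] below
   over those of a letter of [u] with a letter of [m]; [lap] is odd. *)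
Fixpoint ins e psi u : rat :=
  if u is y :: u' then
    g e y * psi u' + sg (ep y && ~~ ep e) * ins e (fun m => psi (y :: m)) u'
  else 0.

Fixpoint lap psi u : rat :=
  if u is x :: u' then
    ins x psi u' + sg (ep x) * lap (fun m => psi (x :: m)) u'
  else 0.

(** An odd form pairs only letters of opposite parities. As an elimination principle this restricts
    a check of signs to the case where it is needed. *)
Lemma g_cases x y (P : rat -> Prop) :
  P 0 -> (ep y = ~~ ep x -> P (g x y)) -> P (g x y).
Proof.
move=> P0 P1; case: (eqVneq (ep x) (ep y)) => [/g_odd -> //|ne].
by apply: P1; case: (ep x) (ep y) ne => [] [].
Qed.

(** Contractions are finite combinations of values of the function, so they commute with a linear
    functional acting on a parameter. With [linear_lap] this interchanges contractions in separate
    blocks of letters. *)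
Lemma linear_ins T (L : (T -> rat) -> rat) e (F : T -> seq E -> rat) u :
  linear_fun L -> L (fun t => ins e (F t) u) = ins e (fun m => L (fun t => F t m)) u.
Proof.
move=> linL; elim: u F => [|y u IH] F /=; first exact: linear_fun0.
by rewrite linear_fun2 // IH.
Qed.

Lemma linear_lap T (L : (T -> rat) -> rat) (F : T -> seq E -> rat) u :
  linear_fun L -> L (fun t => lap (F t) u) = lap (fun m => L (fun t => F t m)) u.
Proof.
move=> linL; elim: u F => [|y u IH] F /=; first exact: linear_fun0.
by rewrite linear_funD // linear_funZ // linear_ins // IH.
Qed.

Lemma ins_linear e u : linear_fun (fun psi => ins e psi u).
Proof.
move=> a F G; elim: u F G => [|y u IH] F G /=; first by rewrite mulr0 addr0.
by rewrite IH; ring.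
Qed.

Lemma lap_linear u : linear_fun (fun psi => lap psi u).
Proof.
move=> a F G; elim: u F G => [|y u IH] F G /=; first by rewrite mulr0 addr0.
by rewrite IH ins_linear; ring.
Qed.

Lemma ins2 e a b F G u :
  ins e (fun m => a * F m + b * G m) u = a * ins e F u + b * ins e G u.
Proof. exact: (linear_fun2 (@ins_linear e u)). Qed.

Lemma insZ e a F u : ins e (fun m => a * F m) u = a * ins e F u.
Proof. exact: (linear_funZ (@ins_linear e u)). Qed.

Lemma insD e F G u : ins e (fun m => F m + G m) u = ins e F u + ins e G u.
Proof. exact: (linear_funD (@ins_linear e u)). Qed.

Lemma lap2 a b F G u :
  lap (fun m => a * F m + b * G m) u = a * lap F u + b * lap G u.
Proof. exact: (linear_fun2 (@lap_linear u)). Qed.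

Lemma lapZ a F u : lap (fun m => a * F m) u = a * lap F u.
Proof. exact: (linear_funZ (@lap_linear u)). Qed.

Lemma lapD F G u : lap (fun m => F m + G m) u = lap F u + lap G u.
Proof. exact: (linear_funD (@lap_linear u)). Qed.

Ltac sgs := repeat match goal with
    | |- context [ep ?x] => case: (ep x) end; rewrite /= ?expr0 ?expr1; try ring.

(** [ins e] removes a letter of parity |e| + 1, the form being odd; operators of these parities
    supercommute. *)
Lemma ins_ins x y psi u :
  ins x (ins y psi) u = sg (~~ ep x && ~~ ep y) * ins y (ins x psi) u.
Proof.
elim: u psi => [|z u IH] psi /=; first by rewrite mulr0.
rewrite !ins2 IH.
elim/g_cases: (g x z) => [|zx]; elim/g_cases: (g y z) => [|zy].
- sgs.
- rewrite zy; sgs.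
- rewrite zx; sgs.
- have yx : ep y = ep x by apply: negb_inj; rewrite -zx -zy.
  rewrite yx zx; sgs.
Qed.

(** The same rule for [lap], which is odd, and [ins x], of parity |x| + 1. *)
Lemma lap_ins x psi u : lap (ins x psi) u = - sg (ep x) * ins x (lap psi) u.
Proof.
elim: u psi => [|z u IH] psi /=; first by rewrite mulr0.
rewrite lap2 insD insZ IH ins_ins.
by elim/g_cases: (g x z) => [|zx]; rewrite ?zx; sgs.
Qed.

(** Splitting off the head [z] leaves its contraction once before and once after a contraction in
    the tail; these cancel by [lap_ins]. *)
Lemma lap_lap psi u : lap (lap psi) u = 0.
Proof.
elim: u psi => [|z u IH] psi //=.
rewrite lapD lapZ IH lap_ins; sgs.
Qed.

Definition supersym psi := forall u v x y,
  psi (u ++ x :: y :: v) = sg (ep x && ep y) * psi (u ++ y :: x :: v).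

Lemma supersym_cons z psi : supersym psi -> supersym (fun m => psi (z :: m)).
Proof. by move=> s u v x y; apply: (s (z :: u)). Qed.

Lemma supersym_catl u psi : supersym psi -> supersym (fun m => psi (u ++ m)).
Proof. by move=> s a v x y; rewrite !catA; apply: s. Qed.

Lemma supersym_catr u psi : supersym psi -> supersym (fun m => psi (m ++ u)).
Proof. by move=> s a v x y; rewrite -!catA; apply: s. Qed.

Lemma ins_supersym e psi : supersym psi -> supersym (ins e psi).
Proof.
move=> s u v x y; elim: u psi s => [|z u IH] psi s /=; last first.
  rewrite s (IH _ (supersym_cons z s)); ring.
have -> : (fun m => psi [:: x, y & m]) =
    (fun m => sg (ep x && ep y) * psi [:: y, x & m]).
  by apply/funext => m; apply: (s [::]).
rewrite insZ.
elim/g_cases: (g e x) => [|ex]; elim/g_cases: (g e y) => [|ey];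
  rewrite ?ex ?ey; sgs.
Qed.

(** Symmetry of [g] serves the contraction of the two swapped letters with each other: their
    parities are opposite, so the swap itself costs no sign there. *)
Lemma lap_supersym psi : supersym psi -> supersym (lap psi).
Proof.
move=> s u v x y; elim: u psi s => [|z u IH] psi s /=; last first.
  rewrite (ins_supersym z s) (IH _ (supersym_cons z s)); ring.
have -> : (fun m => psi [:: x, y & m]) =
    (fun m => sg (ep x && ep y) * psi [:: y, x & m]).
  by apply/funext => m; apply: (s [::]).
rewrite lapZ (g_sym y x); elim/g_cases: (g x y) => [|xy]; rewrite ?xy; sgs.
Qed.

Lemma supersym_swap1 psi u x v w : supersym psi ->
  psi (u ++ x :: v ++ w) = sg (ep x && wp v) * psi (u ++ v ++ x :: w).
Proof.
move=> s; elim: v u => [|y v IH] u /=; first by rewrite andbF mul1r.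
rewrite s wp_cons -[y :: x :: _]cat1s catA (IH (u ++ [:: y])) -!catA /=.
by case: (wp v); sgs.
Qed.

Lemma supersym_swap psi u v1 v2 w : supersym psi ->
  psi (u ++ v1 ++ v2 ++ w) = sg (wp v1 && wp v2) * psi (u ++ v2 ++ v1 ++ w).
Proof.
move=> s; elim: v1 u => [|x v1 IH] u /=; first by rewrite mul1r.
rewrite -[x :: _]cat1s catA IH -!catA /= (supersym_swap1 _ _ _ _ s) wp_cons.
by case: (wp v1); case: (wp v2); sgs.
Qed.

Lemma supersym_catC psi u v : supersym psi ->
  psi (u ++ v) = sg (wp u && wp v) * psi (v ++ u).
Proof. by move=> s; have := supersym_swap [::] u v [::] s; rewrite !cats0. Qed.

Lemma ins_cat e psi u v :
  ins e psi (u ++ v) = ins e (fun m => psi (m ++ v)) u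
    + sg (wp u && ~~ ep e) * ins e (fun m => psi (u ++ m)) v.
Proof.
elim: u psi => [|y u IH] psi /=; first by rewrite add0r mul1r.
by rewrite IH wp_cons; case: (wp u); sgs.
Qed.

Fixpoint cross u psi m : rat :=
  if u is e :: u' then
    sg (wp u' && ~~ ep e) * ins e (fun v => psi (u' ++ v)) m
    + sg (ep e) * cross u' (fun v => psi (e :: v)) m
  else 0.

Lemma lap_cat psi u v :
  lap psi (u ++ v) = lap (fun m => psi (m ++ v)) u + cross u psi v
    + sg (wp u) * lap (fun m => psi (u ++ m)) v.
Proof.
elim: u psi => [|e u IH] psi /=; first by rewrite !add0r mul1r.
by rewrite ins_cat IH wp_cons; case: (wp u); sgs.
Qed.

Lemma cross_linear u m : linear_fun (fun psi => cross u psi m).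
Proof.
move=> a F G; elim: u F G => [|y u IH] F G /=; first by rewrite mulr0 addr0.
by rewrite IH ins_linear; ring.
Qed.

Lemma cross_nil u psi : cross u psi [::] = 0.
Proof. by elim: u psi => //= e u IH psi; rewrite IH !mulr0 addr0. Qed.

(** The letter contracted lies in [v] or in [w]; [cross u] has parity |u| + 1, which gives the sign
    for passing [v]. *)
Lemma cross_cat u psi v w : supersym psi ->
  cross u psi (v ++ w) = cross u (fun m => psi (m ++ w)) v
    + sg (wp v && ~~ wp u) * cross u (fun m => psi (v ++ m)) w.
Proof.
move=> s; elim: u psi s => [|e u IH] psi s /=; first by rewrite mulr0 addr0.
rewrite (IH _ (supersym_cons e s)) ins_cat /=.
have -> : (fun m => psi (e :: v ++ m)) =
    (fun m => sg (ep e && wp v) * psi (v ++ e :: m)).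
  by apply/funext => m; rewrite (supersym_swap1 [::] e v m s).
have -> : (fun m => psi (u ++ v ++ m)) =
    (fun m => sg (wp u && wp v) * psi (v ++ u ++ m)).
  by apply/funext => m; rewrite (supersym_swap [::] u v m s).
have -> : (fun m => psi ((u ++ m) ++ w)) = (fun m => psi (u ++ m ++ w)).
  by apply/funext => m; rewrite catA.
rewrite insZ (linear_funZ (@cross_linear u w)) wp_cons.
by case: (wp v); case: (wp u); sgs.
Qed.

Lemma cross_supersym u psi : supersym psi -> supersym (cross u psi).
Proof.
move=> s a b x y; elim: u psi s => [|e u IH] psi s /=; first by rewrite mulr0.
rewrite (IH _ (supersym_cons e s)).
by rewrite (ins_supersym e (supersym_catl u s)); ring.
Qed.

Lemma crossE u psi m : cross u psi m =
  lap psi (u ++ m) - lap (fun a => psi (a ++ m)) u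
  - sg (wp u) * lap (fun a => psi (u ++ a)) m.
Proof. by rewrite lap_cat; ring. Qed.

(** In [crossE] each term depends on [u] through a supersymmetric function or through its
    contraction, which is supersymmetric again. *)
Lemma cross_supersyml psi m : supersym psi ->
  supersym (fun u => cross u psi m).
Proof.
move=> s u v x y; rewrite !crossE -!catA !cat_cons.
rewrite (lap_supersym s) (lap_supersym (supersym_catr m s)).
have -> : (fun a => psi ((u ++ [:: x, y & v]) ++ a)) =
    (fun a => sg (ep x && ep y) * psi ((u ++ [:: y, x & v]) ++ a)).
  by apply/funext => a; rewrite -!catA; apply: s.
have -> : wp (u ++ [:: x, y & v]) = wp (u ++ [:: y, x & v]).
  by rewrite !wp_cat !wp_cons; congr (_ (+) _); rewrite addbCA.
by rewrite lapZ; ring.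
Qed.

(** Since contracted letters have opposite parities, a contraction sees the function only at words
    of one parity. In this and the next two lemmas, signs that depend on the argument thus become
    constants. *)
Lemma eq_ins_wp e psi psi' u :
  (forall m, wp m = wp u (+) ~~ ep e -> psi m = psi' m) ->
  ins e psi u = ins e psi' u.
Proof.
elim: u psi psi' => [|y u IH] psi psi' //= H; congr (_ + _).
  elim/g_cases: (g e y) => [|ey]; first by rewrite !mul0r.
  by rewrite H // wp_cons ey; case: (ep e); case: (wp u).
congr (_ * _); apply: IH => m mu; apply: H; rewrite !wp_cons mu.
by rewrite addbA.
Qed.

Lemma eq_lap_wp psi psi' u :
  (forall m, wp m = ~~ wp u -> psi m = psi' m) -> lap psi u = lap psi' u.
Proof.
elim: u psi psi' => [|y u IH] psi psi' //= H; congr (_ + _).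
  apply: eq_ins_wp => m mu; apply: H; rewrite mu wp_cons.
  by case: (ep y); case: (wp u).
congr (_ * _); apply: IH => m mu; apply: H.
by rewrite !wp_cons mu; case: (ep y); case: (wp u).
Qed.

Lemma eq_cross_wp u psi psi' v :
  (forall m, wp m = ~~ (wp u (+) wp v) -> psi m = psi' m) ->
  cross u psi v = cross u psi' v.
Proof.
elim: u psi psi' => [|y u IH] psi psi' //= H; congr (_ * _ + _ * _).
  apply: eq_ins_wp => m mu; apply: H; rewrite wp_cat mu !wp_cons.
  by case: (ep y); case: (wp u); case: (wp v).
apply: IH => m mu; apply: H.
by rewrite !wp_cons mu; case: (ep y); case: (wp u); case: (wp v).
Qed.

(** In the last term of [crossE], moving [u] past the odd words left by a contraction of [v]
    produces (-1)^|u|, which cancels the coefficient of that term. *)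
Lemma crossC u v psi : supersym psi -> ~~ wp v ->
  cross u psi v = cross v psi u.
Proof.
move=> s /negbTE v0; rewrite !crossE v0 (supersym_catC _ _ (lap_supersym s)) v0.
have -> : (fun a => psi (u ++ a)) =
    (fun a => sg (wp u && wp a) * psi (a ++ u)).
  by apply/funext => a; apply: supersym_catC.
have -> : lap (fun a => sg (wp u && wp a) * psi (a ++ u)) v =
    lap (fun a => sg (wp u) * psi (a ++ u)) v.
  by apply: eq_lap_wp => m; rewrite v0 => ->; rewrite andbT.
have -> : (fun a => psi (a ++ v)) = (fun a => psi (v ++ a)).
  by apply/funext => a; rewrite (supersym_catC _ _ s) v0 andbF mul1r.
rewrite lapZ andbF; case: (wp u); rewrite ?expr0 ?expr1; ring.
Qed.

(** * Second-order identities for contractions of even words *)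

Section EvenWords.

(* Words act on functions by [psi |-> psi (u ++ -)]; [lap_comm] and [lap_comm2] are
   the single and double commutators of [lap] with these operators. Since [lap] has
   order two, the double commutator is an operator of order zero (lap_comm2_cat). *)
Definition lap_comm u psi m : rat :=
  lap psi (u ++ m) - lap (fun a => psi (u ++ a)) m.

Definition lap_comm2 u v psi m : rat :=
  lap_comm u psi (v ++ m) - lap_comm u (fun a => psi (v ++ a)) m.

Lemma lap_commE u psi m : ~~ wp u ->
  lap_comm u psi m = lap (fun a => psi (a ++ m)) u + cross u psi m.
Proof. by move=> /negbTE u0; rewrite /lap_comm lap_cat u0; ring. Qed.

Lemma lap_comm_supersym u psi : supersym psi -> supersym (lap_comm u psi).
Proof.
move=> s a b x y; rewrite /lap_comm (supersym_catl u (lap_supersym s)).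
by rewrite (lap_supersym (supersym_catl u s)); ring.
Qed.

Lemma lap_comm2E u v psi m : supersym psi -> ~~ wp u -> ~~ wp v ->
  lap_comm2 u v psi m = cross u (fun a => psi (a ++ m)) v.
Proof.
move=> s u0 v0; rewrite /lap_comm2 !lap_commE // cross_cat //.
rewrite (negbTE v0) mul1r.
have -> : (fun a => psi (v ++ a ++ m)) = (fun a => psi (a ++ v ++ m)).
  apply/funext => a; have := supersym_swap [::] v a m s => /= ->.
  by rewrite (negbTE v0) mul1r.
ring.
Qed.

Lemma lap_comm2_cat u v w psi m :
    supersym psi -> ~~ wp u -> ~~ wp v -> ~~ wp w ->
  lap_comm2 u v psi (w ++ m) = lap_comm2 u v (fun a => psi (w ++ a)) m.
Proof.
move=> s u0 v0 w0; rewrite !lap_comm2E //; last exact: supersym_catl.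
congr cross; apply/funext => a.
by rewrite (supersym_swap [::] a w m s) (negbTE w0) andbF mul1r.
Qed.

Lemma lap_lap_comm u psi m :
  lap (lap_comm u psi) m + lap_comm u (lap psi) m = 0.
Proof.
rewrite {1}/lap_comm (linear_funB (@lap_linear m)) lap_lap /lap_comm lap_lap.
ring.
Qed.

Lemma lap_comm_linear u m : linear_fun (fun psi => lap_comm u psi m).
Proof. by move=> a F G; rewrite /lap_comm !lap_linear; ring. Qed.

Lemma lap_comm_catl u v psi : (fun m => lap_comm u psi (v ++ m)) =
  (fun m => lap_comm2 u v psi m + lap_comm u (fun a => psi (v ++ a)) m).
Proof. by apply/funext => m; rewrite /lap_comm2; ring. Qed.

(** This is the double commutator of the identity [lap_lap] with the operators of [u] and [v]. *)
Lemma lap_comm_sym u v psi m :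
  lap_comm v (lap_comm u psi) m + lap_comm u (lap_comm v psi) m
  + lap (lap_comm2 u v psi) m + lap_comm2 u v (lap psi) m = 0.
Proof.
have H1 := lap_lap_comm u psi (v ++ m).
have H2 := lap_lap_comm u (fun a => psi (v ++ a)) m.
rewrite {1}/lap_comm (lap_comm_catl u v psi) lapD.
have -> : lap_comm u (lap_comm v psi) m = lap_comm u (fun a => lap psi (v ++ a)) m
    - lap_comm u (lap (fun a => psi (v ++ a))) m.
  by rewrite -(linear_funB (@lap_comm_linear u m)).
rewrite {3}/lap_comm2.
by move: H1 H2 => /eqP; rewrite addr_eq0 => /eqP -> /eqP; rewrite addr_eq0 => /eqP ->; ring.
Qed.

Lemma lap_comm_nil u psi : lap_comm u psi [::] = lap psi u.
Proof. by rewrite /lap_comm cats0 subr0. Qed.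

Lemma cross_lap_nil u v psi : supersym psi -> ~~ wp u -> ~~ wp v ->
  lap_comm2 u v psi [::] = cross u psi v.
Proof.
move=> s u0 v0; rewrite lap_comm2E //; congr cross.
by apply/funext => a; rewrite cats0.
Qed.

Lemma lap_supersym_odd (u : seq E) psi m : supersym psi -> ~~ wp u -> wp m ->
  lap (fun a => psi (a ++ m)) u = - lap (fun a => psi (m ++ a)) u.
Proof.
move=> s u0 m1.
rewrite -(linear_funN (@lap_linear u)); apply: eq_lap_wp => a aE.
by rewrite (supersym_catC _ _ s) aE m1 u0 expr1 mulN1r.
Qed.

(** Evaluate [lap_comm_sym] on the empty word. There [lap_comm] is [cross] plus the contraction
    inside one word, and the contractions inside both [u] and [v] occur in both orders with opposite
    signs. The result says that [lap] is a derivation of the bracket given by [cross]. *)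
Lemma cross_lap u v psi : supersym psi -> ~~ wp u -> ~~ wp v ->
  cross u (lap psi) v + lap (cross u psi) v + lap (cross v psi) u = 0.
Proof.
move=> s u0 v0; have sl := lap_supersym s.
have lapcross a b : ~~ wp a -> ~~ wp b ->
    lap (cross a psi) b = lap (lap_comm a psi) b
      - lap (fun m => lap (fun k => psi (k ++ m)) a) b.
  move=> a0 b0; rewrite -(linear_funB (@lap_linear b)); congr lap.
  by apply/funext => m; rewrite lap_commE //; ring.
rewrite !lapcross // -cross_lap_nil //.
have /eqP := lap_comm_sym u v psi [::]; rewrite !lap_comm_nil addr0.
rewrite addrC addr_eq0 => /eqP ->.
have -> : lap (fun m => lap (fun k => psi (k ++ m)) u) v =
    - lap (fun m => lap (fun k => psi (k ++ m)) v) u.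
  rewrite -(linear_funN (@lap_linear u)).
  rewrite (linear_lap (fun m k => psi (k ++ m)) u (@lap_linear v)).
  by apply: eq_lap_wp => k kE; rewrite (lap_supersym_odd s v0) ?kE // opprK.
ring.
Qed.

(** Both terms on the left contain a contraction inside [u] combined with one between [v] and [w];
    these are odd, occur in opposite orders and cancel, leaving the nested contraction. *)
Lemma cross_cross_comm u v w psi :
    supersym psi -> ~~ wp u -> ~~ wp v -> ~~ wp w ->
  lap_comm2 v w (lap_comm u psi) [::] + lap_comm u (lap_comm2 v w psi) [::]
  = cross v (cross u psi) w.
Proof.
move=> s u0 v0 w0.
rewrite cross_lap_nil //; last exact: lap_comm_supersym.
rewrite lap_comm_nil.
have -> : lap_comm u psi = (fun m => lap (fun a => psi (a ++ m)) u + cross u psi m).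
  by apply/funext => m; rewrite lap_commE.
rewrite (linear_funD (@cross_linear v w)).
have -> : lap_comm2 v w psi = (fun m => cross v (fun a => psi (a ++ m)) w).
  by apply/funext => m; rewrite lap_comm2E.
rewrite -(linear_lap (fun a m => psi (a ++ m)) u (@cross_linear v w)).
have -> : cross v (fun m => lap (fun a => psi (a ++ m)) u) w =
    - cross v (fun m => lap (fun a => psi (m ++ a)) u) w.
  rewrite -(linear_funN (@cross_linear v w)); apply: eq_cross_wp => m mp.
  by rewrite lap_supersym_odd // mp (negbTE v0) (negbTE w0).
ring.
Qed.

(** One more commutator, with [w], of [lap_comm_sym]: the instance at the word [w] minus the
    instance for the function shifted by [w]. By [lap_comm2_cat] no term contracts all three words
    at once, so only nested brackets remain. *)
Lemma cross_jacobi u v w psi :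
    supersym psi -> ~~ wp u -> ~~ wp v -> ~~ wp w ->
  cross v (cross u psi) w + cross u (cross v psi) w + cross u (cross w psi) v = 0.
Proof.
move=> s u0 v0 w0; rewrite -!cross_cross_comm //.
have H1 := lap_comm_sym u v psi w.
have H2 := lap_comm_sym u v (fun a => psi (w ++ a)) [::].
have E2 a b chi : lap_comm2 a b chi [::] =
    lap_comm a chi b - lap_comm a (fun k => chi (b ++ k)) [::].
  by rewrite /lap_comm2 cats0.
have Ecat a : (fun k => lap_comm a psi (w ++ k)) = (fun k =>
    lap_comm2 a w psi k + lap_comm a (fun k => psi (w ++ k)) k).
  exact: lap_comm_catl.
have -> : lap_comm w (lap_comm2 u v psi) [::] = lap (lap_comm2 u v psi) w.
  exact: lap_comm_nil.
have -> : lap_comm2 u v (lap_comm w psi) [::] =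
    lap_comm2 u v (lap psi) w - lap_comm2 u v (lap (fun a => psi (w ++ a))) [::].
  rewrite -[w in lap_comm2 u v (lap psi) w]cats0 lap_comm2_cat //;
    last exact: lap_supersym.
  rewrite -(linear_funB (L := fun chi => lap_comm2 u v chi [::])) //.
  move=> a F G; rewrite /lap_comm2 lap_comm_linear.
  by rewrite (lap_comm_linear u [::] a (F \o cat v) (G \o cat v)) /=; ring.
rewrite (E2 v w) (E2 u w) !Ecat.
rewrite (linear_funD (@lap_comm_linear v [::])) (linear_funD (@lap_comm_linear u [::])).
by move: H1 H2; rewrite /= => H1 H2; lra.
Qed.

End EvenWords.

End Laplacian.

Lemma sum_scale (J : eqType) (L : seq J) a (F G : J -> rat) :
    (forall j, j \in L -> F j = a * G j) ->
  \sum_(j <- L) F j = a * \sum_(j <- L) G j.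
Proof. by move=> H; rewrite mulr_sumr; apply: eq_big_seq. Qed.

(** * Sums over the positions of a list *)

Section Splits.

Variable T : Type.
Implicit Types s : seq T.

(** A position is stored with the prefix and suffix around it, so that sums over positions recurse
    on the list; [splits_ord] converts sums over indices. *)
Fixpoint splits s : seq (seq T * T * seq T) :=
  if s is a :: s' then
    ([::], a, s') :: [seq (a :: x.1.1, x.1.2, x.2) | x <- splits s']
  else [::].

Variables (R : nmodType).

Lemma splits_cons (F : seq T -> T -> seq T -> R) a s :
  \sum_(x <- splits (a :: s)) F x.1.1 x.1.2 x.2 =
  F [::] a s + \sum_(x <- splits s) F (a :: x.1.1) x.1.2 x.2.
Proof. by rewrite /= big_cons big_map. Qed.

Lemma eq_splits (F G : seq T * T * seq T -> R) s :
    (forall u a v, s = u ++ a :: v -> F (u, a, v) = G (u, a, v)) ->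
  \sum_(x <- splits s) F x = \sum_(x <- splits s) G x.
Proof.
elim: s F G => [|a s IH] F G H; first by rewrite !big_nil.
rewrite /= !big_cons !big_map (H [::]) //; congr (_ + _).
by apply: IH => u b v sE; apply: H; rewrite sE.
Qed.

Lemma splits_catE (F : seq T -> T -> seq T -> R) s s' :
  \sum_(x <- splits (s ++ s')) F x.1.1 x.1.2 x.2 =
  \sum_(x <- splits s) F x.1.1 x.1.2 (x.2 ++ s')
  + \sum_(x <- splits s') F (s ++ x.1.1) x.1.2 x.2.
Proof.
elim: s F => [|a s IH] F; first by rewrite big_nil add0r.
rewrite cat_cons (splits_cons F) (splits_cons (fun u y v => F u y (v ++ s'))).
by rewrite (IH (fun u => F (a :: u))) addrA.
Qed.

Lemma splits_ord (F : seq T -> T -> seq T -> R) x0 s :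
  \sum_(i < size s) F (take i s) (nth x0 s i) (drop i.+1 s) =
  \sum_(x <- splits s) F x.1.1 x.1.2 x.2.
Proof.
elim: s F => [|a s IH] F; first by rewrite big_ord0 big_nil.
rewrite splits_cons big_ord_recl /= drop0; congr (_ + _).
rewrite -(IH (fun u => F (a :: u))); apply: eq_bigr => i _.
by [].
Qed.

End Splits.

Lemma splitsP (T : eqType) (s : seq T) x : x \in splits s -> s = x.1.1 ++ x.1.2 :: x.2.
Proof.
elim: s x => //= a s IH x; rewrite inE => /orP[/eqP -> //|].
by case/mapP => y /IH -> ->.
Qed.

(** * Traces *)

Section Traces.

Variables (I : finType) (lp : I -> bool) (c : I -> I -> rat).
Hypothesis c_sym : forall x y, c x y = c y x.
Hypothesis c_odd : forall x y, lp x = lp y -> c x y = 0.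
Variable N : nat.

Notation word := (seq I).
(* A matrix entry of a letter: the letter, its row and its column. *)
Definition edge := (I * nat * nat)%type.

Definition epar (e : edge) := lp e.1.1.
Definition eform (e e' : edge) : rat :=
  c e.1.1 e'.1.1 * ((e.1.2 == e'.2) && (e.2 == e'.1.2))%:R.

Lemma eform_sym e e' : eform e e' = eform e' e.
Proof.
by rewrite /eform c_sym andbC (eq_sym e.2) (eq_sym e.1.2).
Qed.

Lemma eform_odd e e' : epar e = epar e' -> eform e e' = 0.
Proof. by move=> /c_odd; rewrite /eform => ->; rewrite mul0r. Qed.

Local Notation wpe := (wp epar).
Local Notation lape := (lap epar eform).
Local Notation inse := (ins epar eform).
Local Notation crosse := (cross epar eform).
Local Notation supersyme := (supersym epar).

Local Notation wpl := (wpar lp).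

Lemma wpl_cat u v : wpl (u ++ v) = wpl u (+) wpl v.
Proof. by rewrite /wpar count_cat oddD. Qed.

Lemma wpl_cons x u : wpl (x :: u) = lp x (+) wpl u.
Proof. by rewrite /wpar /= oddD oddb. Qed.

(** The monomials in the (s, t) entry of the product of the generic N x N matrices of the letters;
    [loops] gives those of its trace and [traces] those of a product of traces. The empty word has
    the identity matrix and trace N, which is how nu becomes visible. *)
Fixpoint paths (w : word) (s t : nat) : seq (seq edge) :=
  if w is a :: w' then
    [seq (a, s, r) :: u | r <- iota 0 N, u <- paths w' r t]
  else if s == t then [:: [::]] else [::].

Definition loops w := [seq u | s <- iota 0 N, u <- paths w s s].

Fixpoint traces (ws : seq word) : seq (seq edge) :=
  if ws is w :: ws' then [seq u ++ m | u <- loops w, m <- traces ws']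
  else [:: [::]].

Definition labels (u : seq edge) : word := [seq e.1.1 | e <- u].

Lemma wp_labels u : wpe u = wpl (labels u).
Proof. by rewrite /wp /wpar /labels count_map; congr odd; apply: eq_count. Qed.

Lemma paths_labels w s t u : u \in paths w s t -> labels u = w.
Proof.
elim: w s u => [|a w IH] s u /=; first by case: eqP => // _; rewrite inE => /eqP ->.
by case/allpairsPdep => r [v [_ /IH <- ->]].
Qed.

Lemma loops_labels w u : u \in loops w -> labels u = w.
Proof. by case/allpairsPdep => s [v [_ /paths_labels <- ->]]. Qed.

Lemma traces_labels ws u : u \in traces ws -> labels u = flatten ws.
Proof.
elim: ws u => [|w ws IH] u /=; first by rewrite inE => /eqP ->.
case/allpairsP => -[v m] /= [/loops_labels <- /IH <- ->].
by rewrite /labels map_cat.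
Qed.

Lemma paths_wp w s t u : u \in paths w s t -> wpe u = wpl w.
Proof. by move=> /paths_labels <-; rewrite wp_labels. Qed.

Lemma loops_wp w u : u \in loops w -> wpe u = wpl w.
Proof. by move=> /loops_labels <-; rewrite wp_labels. Qed.

Lemma traces_wp ws u : u \in traces ws -> wpe u = wpl (flatten ws).
Proof. by move=> /traces_labels <-; rewrite wp_labels. Qed.

Section Sums.

Variable R : nmodType.

Lemma sum_paths_cons a w s t (F : seq edge -> R) :
  \sum_(u <- paths (a :: w) s t) F u =
  \sum_(r <- iota 0 N) \sum_(u <- paths w r t) F ((a, s, r) :: u).
Proof. exact: big_allpairs_dep. Qed.

Lemma sum_loops w (F : seq edge -> R) :
  \sum_(u <- loops w) F u = \sum_(s <- iota 0 N) \sum_(u <- paths w s s) F u.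
Proof. exact: big_allpairs_dep. Qed.

Lemma sum_traces_cons w ws (F : seq edge -> R) :
  \sum_(m <- traces (w :: ws)) F m =
  \sum_(u <- loops w) \sum_(m <- traces ws) F (u ++ m).
Proof. exact: big_allpairs_dep. Qed.

Lemma sum_node s (F : nat -> R) : (s < N)%N ->
  \sum_(r <- iota 0 N) (if s == r then F r else 0) = F s.
Proof.
move=> sN; rewrite (bigD1_seq s) ?iota_uniq ?mem_iota //= eqxx big1 ?addr0 //.
by move=> r; rewrite eq_sym => /negbTE ->.
Qed.

Lemma sum_path_nil s t (F : seq edge -> R) :
  \sum_(u <- paths [::] s t) F u = if s == t then F [::] else 0.
Proof. by rewrite /=; case: eqP => _; rewrite ?big_seq1 ?big_nil. Qed.

Lemma sum_path_nil_l s (F : nat -> seq edge -> R) : (s < N)%N ->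
  \sum_(r <- iota 0 N) \sum_(u <- paths [::] s r) F r u = F s [::].
Proof.
by move=> sN; under eq_bigr do rewrite sum_path_nil; rewrite sum_node.
Qed.

Lemma sum_paths_cat w1 w2 s t (F : seq edge -> R) : (s < N)%N ->
  \sum_(u <- paths (w1 ++ w2) s t) F u =
  \sum_(r <- iota 0 N) \sum_(u1 <- paths w1 s r)
    \sum_(u2 <- paths w2 r t) F (u1 ++ u2).
Proof.
elim: w1 s F => [|a w1 IH] s F sN.
  by under [RHS]eq_bigr do rewrite sum_path_nil; rewrite sum_node.
rewrite cat_cons sum_paths_cons.
under [RHS]eq_bigr do rewrite sum_paths_cons.
rewrite [RHS]exchange_big /=; apply: eq_big_seq => r; rewrite mem_iota => rN.
exact: (IH r (fun u => F ((a, s, r) :: u))).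
Qed.

Lemma sum_loops_cat w1 w2 (F : seq edge -> R) :
  \sum_(u <- loops (w1 ++ w2)) F u =
  \sum_(s <- iota 0 N) \sum_(r <- iota 0 N) \sum_(u1 <- paths w1 s r)
    \sum_(u2 <- paths w2 r s) F (u1 ++ u2).
Proof.
rewrite sum_loops; apply: eq_big_seq => s; rewrite mem_iota => sN.
exact: sum_paths_cat.
Qed.

Lemma sum_traces_cat ws1 ws2 (F : seq edge -> R) :
  \sum_(m <- traces (ws1 ++ ws2)) F m =
  \sum_(m1 <- traces ws1) \sum_(m2 <- traces ws2) F (m1 ++ m2).
Proof.
elim: ws1 F => [|w ws1 IH] F; first by rewrite big_seq1.
rewrite cat_cons !sum_traces_cons; apply: eq_bigr => u _.
rewrite (IH (fun m => F (u ++ m))); apply: eq_bigr => m _.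
by apply: eq_bigr => m' _; rewrite catA.
Qed.

End Sums.

(** [eform] matches the row of each edge with the column of the other, so removing the contracted
    edge cuts the path from s to t into one from s to t0 and one from s0 to t. *)
Lemma sum_paths_ins w s t a s0 t0 psi : (s0 < N)%N -> (t0 < N)%N ->
  \sum_(u <- paths w s t) inse (a, s0, t0) psi u =
  \sum_(x <- splits w) sg (wpl x.1.1 && ~~ lp a) * c a x.1.2 *
    \sum_(u1 <- paths x.1.1 s t0) \sum_(u2 <- paths x.2 s0 t) psi (u1 ++ u2).
Proof.
move=> s0N t0N; elim: w s psi => [|b w IH] s psi.
  by rewrite big_nil sum_path_nil; case: eqP.
rewrite sum_paths_cons (splits_cons (fun x1 y x2 =>
  sg (wpl x1 && ~~ lp a) * c a y *
  \sum_(u1 <- paths x1 s t0) \sum_(u2 <- paths x2 s0 t) psi (u1 ++ u2))).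
rewrite /= mul1r.
under eq_bigr do rewrite big_split /=.
rewrite big_split /=; congr (_ + _).
  rewrite sum_path_nil /eform /=.
  transitivity (\sum_(r <- iota 0 N) if s0 == r then
      (if s == t0 then c a b * \sum_(u2 <- paths w r t) psi u2 else 0) else 0).
    apply: eq_bigr => r _; rewrite -mulr_sumr (eq_sym t0).
    by case: (s0 == r); case: (s == t0); rewrite /= ?mulr0 ?mul0r ?mulr1.
  by rewrite sum_node //; case: eqP => _; rewrite ?mulr0.
under eq_bigr do rewrite -mulr_sumr IH mulr_sumr.
rewrite exchange_big /=; apply: eq_bigr => x _.
rewrite sum_paths_cons mulr_sumr; apply: eq_bigr => r _.
rewrite mulrA; congr (_ * _); rewrite wpl_cons /epar /=.
by case: (lp a); case: (lp b); case: (wpl _); rewrite /= ?expr0 ?expr1; ring.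
Qed.

Lemma sum_loops_catC w1 w2 psi : supersyme psi ->
  \sum_(u <- loops (w1 ++ w2)) psi u =
  sg (wpl w1 && wpl w2) * \sum_(u <- loops (w2 ++ w1)) psi u.
Proof.
move=> s; rewrite !sum_loops_cat exchange_big /= mulr_sumr.
apply: eq_bigr => r _; rewrite mulr_sumr.
apply: eq_bigr => t _; rewrite exchange_big mulr_sumr /=.
apply: eq_big_seq => u2 /paths_wp u2E; rewrite mulr_sumr.
apply: eq_big_seq => u1 /paths_wp u1E.
by rewrite (supersym_catC _ _ s) u1E u2E.
Qed.

(** Removing the contracted edge opens the closed path; supersymmetry allows the rest to be read
    from [s0] on. *)
Lemma sum_loops_ins w a s0 t0 psi : supersyme psi -> (s0 < N)%N -> (t0 < N)%N ->
  \sum_(u <- loops w) inse (a, s0, t0) psi u =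
  \sum_(x <- splits w) sg (wpl x.1.1 && ~~ lp a) * sg (wpl x.1.1 && wpl x.2) *
    c a x.1.2 * \sum_(u <- paths (x.2 ++ x.1.1) s0 t0) psi u.
Proof.
move=> s s0N t0N; rewrite sum_loops.
under eq_bigr do rewrite sum_paths_ins //.
rewrite exchange_big /=; apply: eq_bigr => x _; rewrite -mulr_sumr.
rewrite -!mulrA; congr (_ * _); rewrite mulrCA; congr (_ * _).
rewrite sum_paths_cat // mulr_sumr; apply: eq_bigr => r _.
rewrite exchange_big mulr_sumr /=; apply: eq_big_seq => u2 /paths_wp u2E.
rewrite mulr_sumr; apply: eq_big_seq => u1 /paths_wp u1E.
by rewrite (supersym_catC _ _ s) u1E u2E.
Qed.

Lemma sum_paths_cross w s t psi m : (s < N)%N ->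
  \sum_(u <- paths w s t) crosse u psi m =
  \sum_(x <- splits w) sg (wpl x.1.1) * sg (wpl x.2 && ~~ lp x.1.2) *
    \sum_(r <- iota 0 N) \sum_(r' <- iota 0 N)
    \sum_(u1 <- paths x.1.1 s r) \sum_(u2 <- paths x.2 r' t)
    inse (x.1.2, r, r') (fun v => psi (u1 ++ u2 ++ v)) m.
Proof.
elim: w s psi => [|b w IH] s psi sN.
  by rewrite big_nil sum_path_nil; case: eqP.
rewrite sum_paths_cons (splits_cons (fun x1 y x2 =>
  sg (wpl x1) * sg (wpl x2 && ~~ lp y) *
    \sum_(r <- iota 0 N) \sum_(r' <- iota 0 N)
    \sum_(u1 <- paths x1 s r) \sum_(u2 <- paths x2 r' t)
    inse (y, r, r') (fun v => psi (u1 ++ u2 ++ v)) m)).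
rewrite mul1r.
transitivity (\sum_(r <- iota 0 N) \sum_(u <- paths w r t)
    (sg (wpl w && ~~ lp b) * inse (b, s, r) (fun v => psi (u ++ v)) m
     + sg (lp b) * crosse u (fun v => psi ((b, s, r) :: v)) m)).
  by apply: eq_bigr => r _; apply: eq_big_seq => u /= /paths_wp ->.
under eq_bigr do rewrite big_split /=.
rewrite big_split /=; congr (_ + _).
  under eq_bigr do rewrite -mulr_sumr.
  rewrite -mulr_sumr [X in _ = _ * X]exchange_big; congr (_ * _).
  apply: eq_bigr => r _.
  exact/esym/(sum_path_nil_l (fun r0 u1 => \sum_(u2 <- paths w r t)
    inse (b, r0, r) (fun v => psi (u1 ++ u2 ++ v)) m)).
transitivity (\sum_(r <- iota 0 N) \sum_(x <- splits w)
  sg (lp b) * (sg (wpl x.1.1) * sg (wpl x.2 && ~~ lp x.1.2) *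
    \sum_(r1 <- iota 0 N) \sum_(r' <- iota 0 N)
    \sum_(u1 <- paths x.1.1 r r1) \sum_(u2 <- paths x.2 r' t)
    inse (x.1.2, r1, r') (fun v => psi ((b, s, r) :: u1 ++ u2 ++ v)) m)).
  apply: eq_big_seq => r; rewrite mem_iota => rN.
  by rewrite -[LHS]mulr_sumr IH // mulr_sumr.
rewrite exchange_big; apply: eq_bigr => x _ /=.
have -> : sg (wpl (b :: x.1.1)) = sg (lp b) * sg (wpl x.1.1).
  by rewrite wpl_cons signr_addb.
rewrite -mulr_sumr -mulr_sumr !mulrA; congr (_ * _).
rewrite exchange_big; apply: eq_bigr => r1 _.
rewrite exchange_big; apply: eq_bigr => r' _.
by rewrite sum_paths_cons.
Qed.

Lemma sum_loops_cross w psi m : supersyme psi ->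
  \sum_(u <- loops w) crosse u psi m =
  \sum_(x <- splits w) sg (wpl x.1.1) * sg (wpl x.2 && ~~ lp x.1.2) *
    sg (wpl x.1.1 && wpl x.2) *
    \sum_(r <- iota 0 N) \sum_(r' <- iota 0 N)
    \sum_(u <- paths (x.2 ++ x.1.1) r' r)
    inse (x.1.2, r, r') (fun v => psi (u ++ v)) m.
Proof.
move=> sp; rewrite sum_loops.
transitivity (\sum_(s <- iota 0 N) \sum_(x <- splits w)
  sg (wpl x.1.1) * sg (wpl x.2 && ~~ lp x.1.2) *
    \sum_(r <- iota 0 N) \sum_(r' <- iota 0 N)
    \sum_(u1 <- paths x.1.1 s r) \sum_(u2 <- paths x.2 r' s)
    inse (x.1.2, r, r') (fun v => psi (u1 ++ u2 ++ v)) m).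
  by apply: eq_big_seq => s; rewrite mem_iota => sN; rewrite sum_paths_cross.
rewrite exchange_big; apply: eq_bigr => x _ /=.
rewrite -mulr_sumr -!mulrA; congr (_ * (_ * _)).
rewrite exchange_big mulr_sumr; apply: eq_bigr => r _ /=.
rewrite exchange_big mulr_sumr; apply: eq_big_seq => r' /=.
rewrite mem_iota => r'N; rewrite sum_paths_cat // mulr_sumr.
apply: eq_bigr => s _; rewrite exchange_big mulr_sumr.
apply: eq_big_seq => u2 /paths_wp u2E; rewrite mulr_sumr.
apply: eq_big_seq => u1 /paths_wp u1E.
rewrite -insZ; congr ins; apply/funext => v.
by rewrite (supersym_swap [::] u1 u2 v sp) u1E u2E -catA.
Qed.

(* Up to signs and symmetrization, [brF a b] and [coF a] extend functions linearly
   and evaluate them at {a, b} and at Delta a (see brwE and cobwE); so do [deltaF]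
   and [DeltaF] below for delta and Delta. *)
Definition brF (a b : word) (F : word -> rat) : rat :=
  \sum_(x <- splits a) \sum_(y <- splits b)
    sg (wpl x.1.1) * sg (wpl x.2 && ~~ lp x.1.2) * sg (wpl x.1.1 && wpl x.2) *
    (sg (wpl y.1.1 && ~~ lp x.1.2) * sg (wpl y.1.1 && wpl y.2)) *
    c x.1.2 y.1.2 * F (x.2 ++ x.1.1 ++ y.2 ++ y.1.1).

Definition coF (a : word) (F : word -> word -> rat) : rat :=
  \sum_(x <- splits a) \sum_(y <- splits x.2)
    sg (wpl x.1.1) * sg (wpl y.1.1 && ~~ lp x.1.2) *
    sg (wpl x.1.1 && (wpl y.1.1 (+) wpl y.2)) *
    c x.1.2 y.1.2 * F y.1.1 (y.2 ++ x.1.1).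

(** Contracting an edge of one closed path with an edge of another joins the two into one: the
    matrix form of the bracket. *)
Lemma sum_loops_cross2 w w' psi : supersyme psi ->
  \sum_(u <- loops w) \sum_(v <- loops w') crosse u psi v =
  brF w w' (fun x => \sum_(m <- loops x) psi m).
Proof.
move=> sp; rewrite exchange_big /=.
under eq_bigr do rewrite sum_loops_cross //.
rewrite exchange_big; apply: eq_bigr => x _ /=.
rewrite -mulr_sumr.
transitivity (sg (wpl x.1.1) * sg (wpl x.2 && ~~ lp x.1.2) *
    sg (wpl x.1.1 && wpl x.2) * \sum_(y <- splits w')
    sg (wpl y.1.1 && ~~ lp x.1.2) * sg (wpl y.1.1 && wpl y.2) *
    c x.1.2 y.1.2 * \sum_(m <- loops (x.2 ++ x.1.1 ++ y.2 ++ y.1.1)) psi m);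
  last by rewrite mulr_sumr; apply: eq_bigr => y _; rewrite !mulrA.
congr (_ * _).
transitivity (\sum_(r <- iota 0 N) \sum_(r' <- iota 0 N)
    \sum_(u <- paths (x.2 ++ x.1.1) r' r) \sum_(y <- splits w')
    sg (wpl y.1.1 && ~~ lp x.1.2) * sg (wpl y.1.1 && wpl y.2) * c x.1.2 y.1.2 *
    \sum_(v <- paths (y.2 ++ y.1.1) r r') psi (u ++ v)).
  rewrite exchange_big; apply: eq_big_seq => r; rewrite mem_iota => rN.
  rewrite exchange_big; apply: eq_big_seq => r'; rewrite mem_iota => r'N.
  rewrite exchange_big; apply: eq_bigr => u _.
  by rewrite sum_loops_ins //; apply: supersym_catl.
under eq_bigr => r _ do under eq_bigr => r' _ do rewrite exchange_big /=.
under eq_bigr => r _ do rewrite exchange_big /=.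
rewrite exchange_big; apply: eq_bigr => y _ /=.
rewrite catA sum_loops_cat exchange_big mulr_sumr; apply: eq_bigr => r' _ /=.
rewrite mulr_sumr; apply: eq_bigr => r _.
by rewrite mulr_sumr; apply: eq_bigr => u _.
Qed.

Lemma sum_paths_lap w s t psi : (s < N)%N ->
  \sum_(u <- paths w s t) lape psi u =
  \sum_(x <- splits w) sg (wpl x.1.1) *
    \sum_(r <- iota 0 N) \sum_(r' <- iota 0 N)
    \sum_(u1 <- paths x.1.1 s r) \sum_(u2 <- paths x.2 r' t)
    inse (x.1.2, r, r') (fun v => psi (u1 ++ v)) u2.
Proof.
elim: w s psi => [|b w IH] s psi sN.
  by rewrite big_nil sum_path_nil; case: eqP.
rewrite sum_paths_cons (splits_cons (fun x1 y x2 => sg (wpl x1) *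
    \sum_(r <- iota 0 N) \sum_(r' <- iota 0 N)
    \sum_(u1 <- paths x1 s r) \sum_(u2 <- paths x2 r' t)
    inse (y, r, r') (fun v => psi (u1 ++ v)) u2)).
rewrite mul1r /=.
under eq_bigr do rewrite big_split /=.
rewrite big_split /=; congr (_ + _).
  rewrite [RHS]exchange_big; apply: eq_bigr => r _.
  exact/esym/(sum_path_nil_l (fun r0 u1 => \sum_(u2 <- paths w r t)
    inse (b, r0, r) (fun v => psi (u1 ++ v)) u2)).
transitivity (\sum_(r <- iota 0 N) \sum_(x <- splits w)
  sg (lp b) * (sg (wpl x.1.1) *
    \sum_(r1 <- iota 0 N) \sum_(r' <- iota 0 N)
    \sum_(u1 <- paths x.1.1 r r1) \sum_(u2 <- paths x.2 r' t)
    inse (x.1.2, r1, r') (fun v => psi ((b, s, r) :: u1 ++ v)) u2)).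
  apply: eq_big_seq => r; rewrite mem_iota => rN.
  by rewrite -[LHS]mulr_sumr IH // mulr_sumr.
rewrite exchange_big; apply: eq_bigr => x _ /=.
have -> : sg (wpl (b :: x.1.1)) = sg (lp b) * sg (wpl x.1.1).
  by rewrite wpl_cons signr_addb.
rewrite -mulr_sumr -mulr_sumr !mulrA; congr (_ * _).
rewrite exchange_big; apply: eq_bigr => r1 _.
rewrite exchange_big; apply: eq_bigr => r' _.
by rewrite sum_paths_cons.
Qed.

(** Contracting two edges of one closed path splits it in two: the matrix form of the cobracket. *)
Lemma sum_loops_lap w psi : supersyme psi ->
  \sum_(u <- loops w) lape psi u =
  coF w (fun x y => \sum_(m <- loops x) \sum_(m' <- loops y) psi (m ++ m')).
Proof.
move=> sp; rewrite sum_loops.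
transitivity (\sum_(s <- iota 0 N) \sum_(x <- splits w) sg (wpl x.1.1) *
    \sum_(r <- iota 0 N) \sum_(r' <- iota 0 N)
    \sum_(u1 <- paths x.1.1 s r) \sum_(u2 <- paths x.2 r' s)
    inse (x.1.2, r, r') (fun v => psi (u1 ++ v)) u2).
  by apply: eq_big_seq => s; rewrite mem_iota => sN; rewrite sum_paths_lap.
rewrite exchange_big; apply: eq_bigr => x _ /=.
transitivity (\sum_(s <- iota 0 N) sg (wpl x.1.1) *
    \sum_(r <- iota 0 N) \sum_(r' <- iota 0 N)
    \sum_(u1 <- paths x.1.1 s r) \sum_(y <- splits x.2)
    sg (wpl y.1.1 && ~~ lp x.1.2) * c x.1.2 y.1.2 *
    \sum_(v1 <- paths y.1.1 r' r') \sum_(v2 <- paths y.2 r s)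
    psi (u1 ++ v1 ++ v2)).
  apply: eq_bigr => s _; congr (_ * _).
  apply: eq_big_seq => r; rewrite mem_iota => rN.
  apply: eq_big_seq => r'; rewrite mem_iota => r'N.
  by apply: eq_bigr => u1 _; rewrite sum_paths_ins.
rewrite -[LHS]mulr_sumr.
have exch J1 J2 J3 J4 J5 (l1 : seq J1) (l2 : seq J2) (l3 : seq J3)
    (l4 : J1 -> J2 -> J3 -> seq J4) (l5 : seq J5) (F : J1 -> J2 -> J3 -> J4 -> J5 -> rat) :
  \sum_(s <- l1) \sum_(r <- l2) \sum_(r' <- l3) \sum_(u <- l4 s r r') \sum_(y <- l5)
    F s r r' u y =
  \sum_(y <- l5) \sum_(s <- l1) \sum_(r <- l2) \sum_(r' <- l3) \sum_(u <- l4 s r r')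
    F s r r' u y.
  rewrite [RHS]exchange_big; apply: eq_bigr => s _.
  rewrite [RHS]exchange_big; apply: eq_bigr => r _.
  rewrite [RHS]exchange_big; apply: eq_bigr => r' _.
  by rewrite [RHS]exchange_big.
rewrite exch mulr_sumr; apply: eq_bigr => y _ /=.
transitivity (sg (wpl x.1.1) * sg (wpl y.1.1 && ~~ lp x.1.2) * c x.1.2 y.1.2 *
  (sg (wpl x.1.1 && (wpl y.1.1 (+) wpl y.2)) * \sum_(m <- loops y.1.1)
   \sum_(m' <- loops (y.2 ++ x.1.1)) psi (m ++ m'))); last by ring.
rewrite -!mulrA; congr (_ * _).
transitivity (sg (wpl y.1.1 && ~~ lp x.1.2) * c x.1.2 y.1.2 *
  \sum_(s <- iota 0 N) \sum_(r <- iota 0 N) \sum_(r' <- iota 0 N)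
    \sum_(u1 <- paths x.1.1 s r) \sum_(v1 <- paths y.1.1 r' r')
    \sum_(v2 <- paths y.2 r s) psi (u1 ++ v1 ++ v2)).
  by do 4 (apply: sum_scale => ? _).
rewrite -mulrA; congr (_ * (_ * _)).
transitivity (sg (wpl x.1.1 && (wpl y.1.1 (+) wpl y.2)) *
  \sum_(s <- iota 0 N) \sum_(r <- iota 0 N) \sum_(r' <- iota 0 N)
    \sum_(u1 <- paths x.1.1 s r) \sum_(v1 <- paths y.1.1 r' r')
    \sum_(v2 <- paths y.2 r s) psi (v1 ++ v2 ++ u1)).
  do 3 (apply: sum_scale => ? _).
  apply: sum_scale => u1 /paths_wp u1E; apply: sum_scale => v1 /paths_wp v1E.
  apply: sum_scale => v2 /paths_wp v2E.
  by rewrite (supersym_catC _ _ sp) wp_cat u1E v1E v2E catA.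
congr (_ * _); rewrite sum_loops exchange_big /=.
under [RHS]eq_bigr => r' _ do under eq_bigr => v1 _ do rewrite sum_loops_cat.
under [RHS]eq_bigr do rewrite exchange_big /=.
rewrite [RHS]exchange_big; apply: eq_bigr => r _ /=.
under [RHS]eq_bigr do rewrite exchange_big /=.
rewrite [RHS]exchange_big; apply: eq_bigr => s _ /=.
apply: eq_bigr => r' _; rewrite exchange_big; apply: eq_bigr => v1 _ /=.
by rewrite exchange_big.
Qed.

Definition trace (psi : seq edge -> rat) ws := \sum_(m <- traces ws) psi m.

Lemma trace_cat psi ws ws' : trace psi (ws ++ ws') =
  \sum_(m <- traces ws) trace (fun m' => psi (m ++ m')) ws'.
Proof. exact: sum_traces_cat. Qed.

Lemma trace_cons psi w ws : trace psi (w :: ws) =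
  \sum_(u <- loops w) trace (fun m => psi (u ++ m)) ws.
Proof. exact: sum_traces_cons. Qed.

Definition wpls (ws : seq word) := wpl (flatten ws).

Lemma wpls_cat ws ws' : wpls (ws ++ ws') = wpls ws (+) wpls ws'.
Proof. by rewrite /wpls flatten_cat wpl_cat. Qed.

Lemma wpls_cons w ws : wpls (w :: ws) = wpl w (+) wpls ws.
Proof. by rewrite /wpls /= wpl_cat. Qed.

(** The signs here and in [trace_rot] are those of the relations in [lie_null], which is why traces
    of supersymmetric functions descend to the quotient. *)
Lemma trace_catC psi A B C D : supersyme psi ->
  trace psi (A ++ B ++ C ++ D) =
  sg (wpls B && wpls C) * trace psi (A ++ C ++ B ++ D).
Proof.
move=> sp; rewrite !trace_cat mulr_sumr; apply: eq_bigr => a _.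
rewrite !trace_cat.
under eq_bigr do rewrite trace_cat.
under [in RHS]eq_bigr do rewrite trace_cat.
rewrite exchange_big /= mulr_sumr; apply: eq_big_seq => k /traces_wp kE.
rewrite mulr_sumr; apply: eq_big_seq => b /traces_wp bE.
rewrite /trace mulr_sumr; apply: eq_bigr => d _.
by rewrite (supersym_swap a b k d sp) bE kE.
Qed.

Lemma trace_rot psi A u v B : supersyme psi ->
  trace psi (A ++ (u ++ v) :: B) =
  sg (wpl u && wpl v) * trace psi (A ++ (v ++ u) :: B).
Proof.
move=> sp; rewrite !trace_cat mulr_sumr; apply: eq_bigr => a _.
rewrite !trace_cons exchange_big /= [X in _ * X]exchange_big mulr_sumr.
apply: eq_bigr => b _ /=.
rewrite (@sum_loops_catC u v (fun k => psi (a ++ k ++ b))) //.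
exact: (supersym_catr b (supersym_catl a sp)).
Qed.

(** The two contracted letters have opposite parities, which fixes the parity of the words at which
    the function is evaluated. *)
Lemma eq_brF a b F G : (forall p, wpl p = ~~ (wpl a (+) wpl b) -> F p = G p) ->
  brF a b F = brF a b G.
Proof.
move=> FG; apply: eq_big_seq => x /splitsP aE; apply: eq_big_seq => y /splitsP bE.
have [/c_odd -> |xy] := eqVneq (lp x.1.2) (lp y.1.2); first by rewrite !mulr0 !mul0r.
rewrite FG // aE bE !(wpl_cat, wpl_cons); move: xy.
by case: (lp _); case: (lp _) => //= _; case: (wpl _); case: (wpl _);
  case: (wpl _); case: (wpl _).
Qed.

Lemma brF_linear a b : linear_fun (brF a b).
Proof.
move=> t F G; rewrite /brF mulr_sumr -big_split /=; apply: eq_bigr => x _.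
by rewrite mulr_sumr -big_split /=; apply: eq_bigr => y _; ring.
Qed.

Lemma sum_traces_cross u psi ws : supersyme psi ->
  \sum_(m <- traces ws) crosse u psi m =
  \sum_(y <- splits ws) sg (wpls y.1.1 && ~~ wpe u) *
    \sum_(m1 <- traces y.1.1) \sum_(m2 <- traces y.2)
    \sum_(v <- loops y.1.2) crosse u (fun a => psi (m1 ++ a ++ m2)) v.
Proof.
elim: ws psi => [|w ws IH] psi sp; first by rewrite big_seq1 big_nil cross_nil.
rewrite sum_traces_cons (splits_cons (fun y1 y y2 => sg (wpls y1 && ~~ wpe u) *
    \sum_(m1 <- traces y1) \sum_(m2 <- traces y2)
    \sum_(v <- loops y) crosse u (fun a => psi (m1 ++ a ++ m2)) v)).
under eq_bigr => v _ do under eq_bigr => m _ do rewrite cross_cat //.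
under eq_bigr do rewrite big_split /=.
rewrite big_split /=; congr (_ + _).
  by rewrite mul1r big_seq1 exchange_big.
transitivity (\sum_(v <- loops w) \sum_(y <- splits ws) sg (wpl w && ~~ wpe u) *
   (sg (wpls y.1.1 && ~~ wpe u) *
    \sum_(m1 <- traces y.1.1) \sum_(m2 <- traces y.2)
    \sum_(k <- loops y.1.2) crosse u (fun a => psi ((v ++ m1) ++ a ++ m2)) k)).
  apply: eq_big_seq => v /loops_wp vE.
  rewrite -[LHS]mulr_sumr vE IH; last exact: supersym_catl.
  rewrite mulr_sumr; apply: eq_bigr => y _; congr (_ * (_ * _)).
  apply: eq_bigr => m1 _; apply: eq_bigr => m2 _; apply: eq_bigr => k _.
  by congr cross; apply/funext => a; rewrite catA.
rewrite exchange_big; apply: eq_bigr => y _ /=.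
rewrite -mulr_sumr -mulr_sumr sum_traces_cons mulrA; congr (_ * _).
by rewrite wpls_cons; case: (wpl _); case: (wpls _); case: (wpe u).
Qed.

Definition DeltaF (ws : seq word) (F : seq word -> rat) : rat :=
  \sum_(x <- splits ws) sg (wpls x.1.1) *
    coF x.1.2 (fun p q => F (x.1.1 ++ p :: q :: x.2)).

Definition deltaF (ws : seq word) (F : seq word -> rat) : rat :=
  \sum_(x <- splits ws) \sum_(y <- splits x.2)
    sg (wpl x.1.2 && wpls x.1.1) * sg (wpl y.1.2 && (wpls x.1.1 (+) wpls y.1.1)) *
    brF x.1.2 y.1.2 (fun p => F (p :: x.1.1 ++ y.1.1 ++ y.2)).

(** Two contracted edges lie either in the same trace, which splits, or in different traces, which
    fuse. The first kind gives Delta, the second delta. *)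
Lemma trace_lap psi ws : supersyme psi ->
  trace (lape psi) ws = DeltaF ws (trace psi) + deltaF ws (trace psi).
Proof.
elim: ws psi => [|w ws IH] psi sp.
  by rewrite /DeltaF /deltaF /trace !big_nil big_seq1 addr0.
have scat u : supersyme (fun m => psi (u ++ m)) by apply: supersym_catl.
have -> : trace (lape psi) (w :: ws) =
    \sum_(u <- loops w) \sum_(m <- traces ws) lape (fun k => psi (k ++ m)) u
    + \sum_(u <- loops w) \sum_(m <- traces ws) crosse u psi m
    + sg (wpl w) * \sum_(u <- loops w)
        (DeltaF ws (trace (fun k => psi (u ++ k)))
         + deltaF ws (trace (fun k => psi (u ++ k)))).
  rewrite mulr_sumr -!big_split /= trace_cons; apply: eq_big_seq => u /loops_wp uE.
  rewrite -IH // -uE /trace mulr_sumr -!big_split /=; apply: eq_bigr => m _.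
  by rewrite lap_cat.
have -> : DeltaF (w :: ws) (trace psi) =
    coF w (fun p q => trace psi (p :: q :: ws))
    + sg (wpl w) * \sum_(u <- loops w) DeltaF ws (trace (fun k => psi (u ++ k))).
  rewrite /DeltaF (splits_cons (fun x1 x x2 => sg (wpls x1) *
    coF x (fun p q => trace psi (x1 ++ p :: q :: x2)))) mul1r; congr (_ + _).
  rewrite exchange_big mulr_sumr; apply: eq_bigr => x _ /=.
  rewrite -mulr_sumr wpls_cons signr_addb -!mulrA; congr (_ * (_ * _)).
  rewrite exchange_big; apply: eq_bigr => y _ /=.
  rewrite exchange_big; apply: eq_bigr => z _ /=.
  by rewrite -mulr_sumr; congr (_ * _); rewrite trace_cons.
have -> : deltaF (w :: ws) (trace psi) =
    \sum_(y <- splits ws) sg (wpl y.1.2 && wpls y.1.1) *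
      brF w y.1.2 (fun p => trace psi (p :: y.1.1 ++ y.2))
    + sg (wpl w) * \sum_(u <- loops w) deltaF ws (trace (fun k => psi (u ++ k))).
  rewrite /deltaF (splits_cons (fun x1 x x2 => \sum_(y <- splits x2)
    sg (wpl x && wpls x1) * sg (wpl y.1.2 && (wpls x1 (+) wpls y.1.1)) *
    brF x y.1.2 (fun p => trace psi (p :: x1 ++ y.1.1 ++ y.2)))).
  congr (_ + _); first by apply: eq_bigr => y _; rewrite andbF mul1r.
  rewrite exchange_big mulr_sumr; apply: eq_bigr => x _ /=.
  rewrite exchange_big mulr_sumr; apply: eq_bigr => y _ /=.
  rewrite -mulr_sumr -(linear_fun_sum (@brF_linear _ _)).
  (* [deltaF] puts the fused word in front, hence before the split-off [w]; exchanging the two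
     supplies the part of the sign of [deltaF] that comes from [w]. *)
  have -> : brF x.1.2 y.1.2 (fun p => trace psi (p :: w :: x.1.1 ++ y.1.1 ++ y.2)) =
      brF x.1.2 y.1.2 (fun p => sg (~~ (wpl x.1.2 (+) wpl y.1.2) && wpl w) *
        \sum_(u <- loops w) trace (fun k => psi (u ++ k)) (p :: x.1.1 ++ y.1.1 ++ y.2)).
    apply: eq_brF => p pE; rewrite -trace_cons.
    have := @trace_catC psi [::] [:: p] [:: w] (x.1.1 ++ y.1.1 ++ y.2) sp.
    by rewrite /= => ->; rewrite /wpls /= !cats0 pE.
  rewrite (linear_funZ (@brF_linear _ _)) wpls_cons.
  set b := brF _ _ _.
  by case: (wpl w); case: (wpl _); case: (wpl _); case: (wpls _); case: (wpls _);
    rewrite /= ?expr0 ?expr1; ring.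
rewrite big_split /= mulrDr.
have -> : \sum_(u <- loops w) \sum_(m <- traces ws) lape (fun k => psi (k ++ m)) u =
    coF w (fun p q => trace psi (p :: q :: ws)).
  rewrite exchange_big /=.
  transitivity (\sum_(m <- traces ws) coF w (fun x y =>
      \sum_(k <- loops x) \sum_(k' <- loops y) psi ((k ++ k') ++ m))).
    apply: eq_bigr => m _; rewrite sum_loops_lap //; exact: supersym_catr.
  rewrite exchange_big; apply: eq_bigr => x _ /=.
  rewrite exchange_big; apply: eq_bigr => y _ /=.
  rewrite -mulr_sumr trace_cons; congr (_ * _).
  rewrite exchange_big; apply: eq_bigr => k _ /=.
  rewrite trace_cons exchange_big; apply: eq_bigr => k' _ /=.
  by apply: eq_bigr => m _; rewrite catA.
have -> : \sum_(u <- loops w) \sum_(m <- traces ws) crosse u psi m =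
    \sum_(y <- splits ws) sg (wpl y.1.2 && wpls y.1.1) *
      brF w y.1.2 (fun p => trace psi (p :: y.1.1 ++ y.2)).
  transitivity (\sum_(u <- loops w) \sum_(y <- splits ws)
    sg (wpls y.1.1 && ~~ wpl w) *
    \sum_(m1 <- traces y.1.1) \sum_(m2 <- traces y.2)
    \sum_(v <- loops y.1.2) crosse u (fun a => psi (m1 ++ a ++ m2)) v).
    by apply: eq_big_seq => u /loops_wp uE; rewrite sum_traces_cross // uE.
  rewrite exchange_big; apply: eq_bigr => y _ /=; rewrite -mulr_sumr.
  have -> : \sum_(u <- loops w) \sum_(m1 <- traces y.1.1) \sum_(m2 <- traces y.2)
      \sum_(v <- loops y.1.2) crosse u (fun a => psi (m1 ++ a ++ m2)) v =
    brF w y.1.2 (fun p => trace psi (y.1.1 ++ p :: y.2)).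
    rewrite exchange_big.
    transitivity (\sum_(m1 <- traces y.1.1) \sum_(m2 <- traces y.2)
        brF w y.1.2 (fun p => \sum_(a <- loops p) psi (m1 ++ a ++ m2))).
      apply: eq_bigr => m1 _; rewrite exchange_big; apply: eq_bigr => m2 _.
      rewrite sum_loops_cross2 //.
      exact: (supersym_catr m2 (supersym_catl m1 sp)).
    under eq_bigr do rewrite -(linear_fun_sum (@brF_linear _ _)).
    rewrite -(linear_fun_sum (@brF_linear _ _)); congr brF; apply/funext => p.
    rewrite trace_cat; apply: eq_bigr => m1 _.
    by rewrite trace_cons exchange_big.
  have -> : brF w y.1.2 (fun p => trace psi (y.1.1 ++ p :: y.2)) =
      brF w y.1.2 (fun p => sg (wpls y.1.1 && ~~ (wpl w (+) wpl y.1.2)) *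
        trace psi (p :: y.1.1 ++ y.2)).
    apply: eq_brF => p pE.
    have := @trace_catC psi [::] y.1.1 [:: p] y.2 sp.
    by rewrite /= => ->; rewrite {2}/wpls /= cats0 pE.
  rewrite (linear_funZ (@brF_linear _ _)).
  set b := brF _ _ _.
  by case: (wpl w); case: (wpl _); case: (wpls _);
    rewrite /= ?expr0 ?expr1; ring.
ring.
Qed.

End Traces.

(** * Coefficients of delta and Delta *)

Section Koszul.

Variable p : nat -> bool.

Lemma koszul_cat_gt s1 s2 : {in s1 & s2, forall x y, (y < x)%N} ->
  koszul p (s1 ++ s2) =
  koszul p s1 (+) koszul p s2 (+) (odd (count p s1) && odd (count p s2)).
Proof.
elim: s1 => [|x s1 IH] H; first by rewrite /= addbF.
rewrite /= IH; last by move=> y z ys; apply: H; rewrite inE ys orbT.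
rewrite count_cat !oddD.
have -> : count (fun y => (y < x)%N && p y) s2 = count p s2.
  by apply: eq_in_count => y ys2; rewrite H // mem_head.
rewrite oddb.
by case: (p x); case: (odd _); case: (odd _); case: (odd _); case: (koszul _ _);
  case: (koszul _ _).
Qed.

Lemma koszul_cat_le s1 s2 : {in s1 & s2, forall x y, (x <= y)%N} ->
  koszul p (s1 ++ s2) = koszul p s1 (+) koszul p s2.
Proof.
elim: s1 => [|x s1 IH] H //=.
rewrite IH; last by move=> y z ys; apply: H; rewrite inE ys orbT.
rewrite count_cat.
have -> : count (fun y => (y < x)%N && p y) s2 = 0%N.
  apply/eqP; rewrite -leqn0 leqNgt -has_count; apply/hasP => -[y ys2].
  by rewrite ltnNge H ?mem_head.
by rewrite addn0 addbA.
Qed.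

Lemma koszul_sorted s : sorted ltn s -> koszul p s = false.
Proof.
elim: s => //= x s IH xs; rewrite (IH (path_sorted xs)).
have -> : count (fun y => (y < x)%N && p y) s = 0%N; last by rewrite andbF.
apply/eqP; rewrite -leqn0 leqNgt -has_count; apply/hasP => -[y ys /andP[yx _]].
have := order_path_min ltn_trans xs => /allP /(_ _ ys) /=; lia.
Qed.

Lemma koszul_iota m n : koszul p (iota m n) = false.
Proof. by apply: koszul_sorted; exact: iota_ltn_sorted. Qed.

Lemma count_lt_iota i m n : (m + n <= i)%N ->
  count (fun y => (y < i)%N && p y) (iota m n) = count p (iota m n).
Proof.
by move=> mn; apply: eq_in_count => y; rewrite mem_iota => yi; have -> : (y < i)%N by lia.
Qed.

Lemma count_ge_iota i m n : (i <= m)%N ->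
  count (fun y => (y < i)%N && p y) (iota m n) = 0%N.
Proof.
move=> im; apply/eqP; rewrite -leqn0 leqNgt -has_count; apply/hasP => -[y].
by rewrite mem_iota => yi /andP[? _]; lia.
Qed.

End Koszul.

Lemma count_nth_iota (T : Type) (f : T -> bool) (s : seq T) m n :
  (m + n <= size s)%N ->
  count (nth false (map f s)) (iota m n) = count f (take n (drop m s)).
Proof.
move=> mn; transitivity (count id (map (nth false (map f s)) (iota m n))).
  by rewrite count_map.
rewrite map_nth_iota ?size_map; last by lia.
by rewrite -map_drop -map_take count_map.
Qed.

Lemma iota_split i j n : (i < j < n)%N ->
  [seq q <- iota 0 n | (q != i) && (q != j)] =
  iota 0 i ++ iota i.+1 (j - i.+1) ++ iota j.+1 (n - j.+1).
Proof.
move=> ij.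
have -> : iota 0 n = iota 0 i ++ i :: iota i.+1 (j - i.+1) ++ j :: iota j.+1 (n - j.+1).
  have {1}-> : n = (i + (j - i.+1 + (n - j.+1).+1).+1)%N by lia.
  rewrite iotaD /= iotaD /= add0n.
  by have -> : (i.+1 + (j - i.+1) = j)%N by lia.
rewrite filter_cat /= filter_cat /= !eqxx /= andbF.
have H m k : (forall y, (m <= y < m + k)%N -> (y != i) && (y != j)) ->
    [seq q <- iota m k | (q != i) && (q != j)] = iota m k.
  by move=> D; apply/all_filterP/allP => y; rewrite mem_iota; apply: D.
by rewrite !H // => y yi; apply/andP; split; apply/eqP; lia.
Qed.

Section SplitsOrd.

Variables (T : Type) (R : nmodType).

Lemma big_ord_gt n i (F : nat -> R) :
  \sum_(j < n | (i < j)%N) F j = \sum_(j < n - i.+1) F (i.+1 + j)%N.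
Proof.
have [ni|ni] := leqP n i.+1.
  rewrite big1 => [|j ij]; last by have := ltn_ord j; lia.
  by rewrite big1 // => -[j /=]; lia.
rewrite -(big_mkord (fun j => i < j)%N F) -(big_mkord xpredT (fun j => F (i.+1 + j)%N)).
rewrite (@big_cat_nat _ _ _ i.+1) //=; last by lia.
rewrite big_nat_cond big1 ?add0r; last by move=> j; lia.
rewrite -[X in index_iota X n]add0n big_addn.
rewrite big_nat_cond [RHS]big_nat_cond; apply: eq_big => j; first by lia.
by rewrite addnC.
Qed.

Lemma splits_ord2 (F : seq T -> T -> seq T -> T -> seq T -> R) x0 s :
  \sum_(i < size s) \sum_(j < size s | (i < j)%N)
    F (take i s) (nth x0 s i) (take (j - i.+1) (drop i.+1 s)) (nth x0 s j)
      (drop j.+1 s) =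
  \sum_(x <- splits s) \sum_(y <- splits x.2) F x.1.1 x.1.2 y.1.1 y.1.2 y.2.
Proof.
rewrite -(splits_ord (fun u a v =>
  \sum_(y <- splits v) F u a y.1.1 y.1.2 y.2) x0); apply: eq_bigr => i _.
rewrite -(splits_ord (F (take i s) (nth x0 s i)) x0).
rewrite (big_ord_gt _ _ (fun j => F (take i s) (nth x0 s i)
  (take (j - i.+1) (drop i.+1 s)) (nth x0 s j) (drop j.+1 s))) size_drop.
apply: eq_bigr => j _.
rewrite addKn nth_drop drop_drop.
by have -> : (j.+1 + i.+1 = (i.+1 + j).+1)%N by lia.
Qed.

End SplitsOrd.

Section Coefficients.

Variables (I : finType) (lp : I -> bool) (c : I -> I -> rat).
Hypothesis c_odd : forall x y, lp x = lp y -> c x y = 0.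

Notation word := (seq I).
Local Notation wpl := (wpar lp).

(** The rearrangement consists of four moves: [a] past x1, [b] past x1 x2 y1, then x2 past x1 and y2
    past y1. *)
Lemma brw_sign (x1 x2 y1 y2 : word) a b : let s := (x1 ++ a :: x2) ++ y1 ++ b :: y2 in
  koszul (nth false (map lp s))
    ([:: size x1; size (x1 ++ a :: x2) + size y1]%N
      ++ iota (size x1).+1 (size x2) ++ iota 0 (size x1)
      ++ iota (size (x1 ++ a :: x2) + (size y1).+1)%N (size y2)
      ++ iota (size (x1 ++ a :: x2)) (size y1)) =
  (lp a && wpl x1) (+) (lp b && (wpl x1 (+) wpl x2 (+) wpl y1))
  (+) (wpl x1 && wpl x2) (+) (wpl y1 && wpl y2).
Proof.
move=> s; set p := nth _ _.
set n := size (x1 ++ a :: x2).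
have nE : n = (size x1 + (size x2).+1)%N by rewrite /n size_cat.
have pa : p (size x1) = lp a.
  rewrite /p (nth_map a) /s ?size_cat /=; last by lia.
  by rewrite -catA nth_cat ltnn subnn.
have pb : p (n + size y1)%N = lp b.
  rewrite /p (nth_map a) /s ?size_cat /= -/n; last by rewrite nE /=; lia.
  by rewrite nth_cat -/n ltnNge leq_addr /= addKn nth_cat ltnn subnn.
have cx1 : count p (iota 0 (size x1)) = count lp x1.
  rewrite /p count_nth_iota /s ?size_cat; last by lia.
  by rewrite drop0 -catA take_size_cat.
have cx2 : count p (iota (size x1).+1 (size x2)) = count lp x2.
  rewrite /p count_nth_iota /s ?size_cat /=; last by lia.
  rewrite -!catA /= -cat_rcons drop_size_cat ?size_rcons // take_size_cat //.
have cy1 : count p (iota n (size y1)) = count lp y1.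
  rewrite /p count_nth_iota /s ?size_cat -/n /=; last by lia.
  by rewrite drop_size_cat // take_size_cat.
have cy2 : count p (iota (n + (size y1).+1) (size y2)) = count lp y2.
  rewrite /p count_nth_iota /s ?size_cat -/n /=; last by lia.
  have -> : (n + (size y1).+1)%N = size ((x1 ++ a :: x2) ++ rcons y1 b).
    by rewrite size_cat size_rcons.
  by rewrite -(cat_rcons b) catA drop_size_cat // take_size.
rewrite /= pa pb -!/n !count_cat.
rewrite (@count_lt_iota p (size x1) 0) // !(@count_ge_iota p (size x1)); try lia.
rewrite (@count_ge_iota p (n + size y1) (n + (size y1).+1)); last by lia.
rewrite !(@count_lt_iota p (n + size y1)); try lia.
have -> : (n + size y1 < size x1)%N = false by lia.
rewrite cx1 cx2 cy1 /= !add0n !addn0.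
rewrite catA koszul_cat_le; last first.
  by move=> i j; rewrite !mem_cat !mem_iota; lia.
rewrite !koszul_cat_gt; try by move=> i j; rewrite !mem_iota; lia.
rewrite !koszul_iota cx1 cx2 cy1 cy2 !oddD /wpar.
by case: (lp a); case: (lp b); case: (odd _); case: (odd _); case: (odd _); case: (odd _).
Qed.

(** The sign of [brw_sign] agrees with that of [brF] for contracted letters of opposite parities;
    for equal parities [c] vanishes. *)
Lemma brwE (a b w : word) :
  brw lp c a b w = brF lp c a b (fun v => (w == v)%:R).
Proof.
case: a => [|x0 a']; first by rewrite /brw big_ord0 /brF big_nil.
set a := x0 :: a'.
pose F u x v u' y v' :=
  (-1) ^+ koszul (nth false (map lp ((u ++ x :: v) ++ u' ++ y :: v')))
    ([:: size u; size (u ++ x :: v) + size u']%N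
      ++ iota (size u).+1 (size v) ++ iota 0 (size u)
      ++ iota (size (u ++ x :: v) + (size u').+1)%N (size v')
      ++ iota (size (u ++ x :: v)) (size u')) * c x y *
    (w == v ++ u ++ v' ++ u')%:R : rat.
transitivity (\sum_(x <- splits a) \sum_(y <- splits b)
    F x.1.1 x.1.2 x.2 y.1.1 y.1.2 y.2).
  rewrite -(splits_ord (fun u x v => \sum_(y <- splits b)
    F u x v y.1.1 y.1.2 y.2) x0); apply: eq_bigr => i _.
  rewrite -(splits_ord (F (take i a) (nth x0 a i) (drop i.+1 a)) x0).
  apply: eq_bigr => j _; rewrite /F !(tnth_nth x0) -!drop_nth // !cat_take_drop.
  by rewrite !size_drop !size_takel // ltnW.
apply: eq_bigr => x _; apply: eq_bigr => y _.
rewrite /F; have [/c_odd ->|xy] := eqVneq (lp x.1.2) (lp y.1.2).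
  by rewrite !mulr0 !mul0r.
rewrite brw_sign; congr (_ * _ * _); move: xy.
by case: (lp x.1.2); case: (lp y.1.2) => //= _; case: (wpl _); case: (wpl _);
  case: (wpl _); case: (wpl _); rewrite /= ?expr0 ?expr1; ring.
Qed.

(** The exponent p includes |a_i| and |a_j| in its partial sums, which adds |a_i| + |a_i||a_j| +
    |a_j|. This is odd for letters of opposite parities and accounts for the minus sign against
    [coF]. *)
Lemma cobwE (a u v : word) : cobw lp c a u v =
  - 2^-1 * (coF lp c a (fun p q => ((u == p) && (v == q))%:R) +
    coF lp c a (fun p q => sg (wpl p && wpl q) * ((u == q) && (v == p))%:R)).
Proof.
case: a => [|x0 a']; first by rewrite /cobw big_ord0 mulr0 /coF !big_nil addr0 mulr0.
set a := x0 :: a'.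
pose F u1 x m y v1 :=
  let p := (lp x * count lp (rcons u1 x) + lp y * count lp (u1 ++ x :: m ++ [:: y])
      + count lp u1 * (count lp m + count lp v1))%N in
  (-1) ^+ p * c x y *
  (((u == m) && (v == v1 ++ u1))%:R
   + (-1) ^+ (wpl m && wpl (v1 ++ u1)) * ((u == v1 ++ u1) && (v == m))%:R) : rat.
transitivity (2^-1 * \sum_(x <- splits a) \sum_(y <- splits x.2)
    F x.1.1 x.1.2 y.1.1 y.1.2 y.2).
  congr (_ * _).
  rewrite -(splits_ord2 F x0); apply: eq_bigr => i _; apply: eq_bigr => j ij.
  rewrite /F /= !(tnth_nth x0) /=.
  have ja : (j < size a)%N := ltn_ord j.
  have dt : drop i.+1 (take j a) = take (j - i.+1) (drop i.+1 a).
    by rewrite take_drop subnK.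
  have tj : take j.+1 a = take i a ++ nth x0 a i :: take (j - i.+1) (drop i.+1 a)
      ++ [:: nth x0 a j].
    rewrite (take_nth x0) // -cats1 -cat_cons catA; congr (_ ++ _).
    rewrite -[LHS](cat_take_drop i) take_takel; last exact: ltnW.
    rewrite -dt (drop_nth x0) ?size_takel //; last exact: ltnW.
    by rewrite nth_take.
  by rewrite dt -tj -(take_nth x0).
rewrite mulNr -mulrN -big_split /=; congr (_ * _).
rewrite -sumrN; apply: eq_bigr => x _; rewrite -big_split -sumrN.
apply: eq_bigr => y _ /=.
rewrite /F; have [/c_odd ->|xy] := eqVneq (lp x.1.2) (lp y.1.2).
  by rewrite !mulr0 !mul0r addr0 oppr0.
rewrite -mulrDr -mulNr; congr (_ * _); rewrite -mulNr; congr (_ * _).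
rewrite -[(-1) ^+ (_ + _ * _)]signr_odd -cats1 !count_cat /= !count_cat /=.
rewrite !(oddD, oddM, oddb, addn0).
move: xy; rewrite /wpar.
by case: (lp x.1.2); case: (lp y.1.2) => //= _; case: (odd _); case: (odd _);
  case: (odd _); rewrite /= ?expr0 ?expr1; ring.
Qed.

Lemma wpar_count (ws : seq word) : odd (count wpl ws) = wpls lp ws.
Proof.
elim: ws => //= w ws IH; rewrite oddD oddb IH.
by rewrite wpls_cons.
Qed.

Lemma deltaF_linear ws : linear_fun (deltaF lp c ws).
Proof.
move=> a F G; rewrite /deltaF mulr_sumr -big_split /=; apply: eq_bigr => x _.
rewrite mulr_sumr -big_split /=; apply: eq_bigr => y _.
by rewrite brF_linear; ring.
Qed.

Lemma coF_linear2 w a F G : coF lp c w (fun p q => a * F p q + G p q) =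
  a * coF lp c w F + coF lp c w G.
Proof.
rewrite /coF mulr_sumr -big_split /=; apply: eq_bigr => x _.
by rewrite mulr_sumr -big_split /=; apply: eq_bigr => y _; ring.
Qed.

Lemma coFZ w a F : coF lp c w (fun p q => a * F p q) = a * coF lp c w F.
Proof.
rewrite /coF mulr_sumr; apply: eq_bigr => x _.
by rewrite mulr_sumr; apply: eq_bigr => y _; ring.
Qed.

Lemma DeltaF_linear ws : linear_fun (DeltaF lp c ws).
Proof.
move=> a F G; rewrite /DeltaF mulr_sumr -big_split /=; apply: eq_bigr => x _.
by rewrite coF_linear2; ring.
Qed.

Lemma delta_coefE (ws us : seq word) :
  delta_coef lp c ws us = deltaF lp c ws (fun vs => (us == vs)%:R).
Proof.
pose F A w M w' C := sg (wpl w && wpls lp A) * sg (wpl w' && (wpls lp A (+) wpls lp M)) *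
  brF lp c w w' (fun p => (us == p :: A ++ M ++ C)%:R).
transitivity (\sum_(x <- splits ws) \sum_(y <- splits x.2)
    F x.1.1 x.1.2 y.1.1 y.1.2 y.2); last by [].
rewrite -(splits_ord2 F [::]); apply: eq_bigr => i _; apply: eq_bigr => j ij.
have jn := ltn_ord j.
rewrite iota_split ?ij // /F.
set n := size ws; set p := nth false _.
have cA : count p (iota 0 i) = count wpl (take i ws).
  by rewrite /p count_nth_iota ?drop0 // add0n ltnW.
have cM : count p (iota i.+1 (j - i.+1)) = count wpl (take (j - i.+1) (drop i.+1 ws)).
  by rewrite /p count_nth_iota //; lia.
have ks : koszul p (iota 0 i ++ iota i.+1 (j - i.+1) ++ iota j.+1 (n - j.+1)) = false.
  by rewrite !koszul_cat_le ?koszul_iota // => y z; rewrite ?mem_cat !mem_iota; lia.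
rewrite /= ks !count_cat.
rewrite (@count_lt_iota p i 0) // (@count_ge_iota p i i.+1) //.
rewrite (@count_ge_iota p i j.+1); last exact: leq_trans (ltnW ij) (leqnSn j).
rewrite (@count_ge_iota p j j.+1) // (@count_lt_iota p j 0); last exact: ltnW.
rewrite (@count_lt_iota p j i.+1); last by rewrite subnKC.
have -> : (j < i)%N = false by apply/negbTE; rewrite -leqNgt ltnW.
rewrite cA cM /= !addn0 add0n addbF !oddD !wpar_count.
have pE k : (k < n)%N -> p k = wpl (nth [::] ws k).
  by move=> kn; rewrite /p (nth_map [::]).
rewrite !pE ?(ltn_ord i) // signr_addb; congr (_ * _).
rewrite !map_cat !(map_nth_iota [::]); try (rewrite /n; lia).
rewrite drop0 (take_oversize (n := n - j.+1)) ?size_drop //.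
clear F; case: us => [|u us].
  by rewrite /brF big1 // => x _; rewrite big1 // => y _; rewrite mulr0.
rewrite brwE mulrC -(linear_funZ (brF_linear _ _ _ _)); congr brF.
apply/funext => v; rewrite eqseq_cons.
by case: (u == v); case: (us == _); rewrite ?mulr0 ?mulr1.
Qed.

Lemma Delta_coefE (ws us : seq word) : Delta_coef lp c ws us =
  - 2^-1 * (DeltaF lp c ws (fun vs => (us == vs)%:R)
  + \sum_(x <- splits ws) sg (wpls lp x.1.1) * coF lp c x.1.2 (fun p q =>
      sg (wpl p && wpl q) * (us == x.1.1 ++ q :: p :: x.2)%:R)).
Proof.
rewrite -big_split /=.
pose F A w B := - 2^-1 * (sg (wpls lp A) *
  coF lp c w (fun p q => (us == A ++ p :: q :: B)%:R) + sg (wpls lp A) *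
  coF lp c w (fun p q => sg (wpl p && wpl q) * (us == A ++ q :: p :: B)%:R)).
rewrite mulr_sumr -(splits_ord F [::]); apply: eq_bigr => r _; rewrite /F.
rewrite cobwE -/(wpar lp _) -/(wpls lp _).
set u := nth _ us r; set v := nth _ us r.+1.
set A := take r ws; set w := nth _ ws r; set B := drop r.+1 ws.
set T := (size us == (size ws).+1) && (take r us == A) && (drop r.+2 us == B).
have TE p q : (T && ((u == p) && (v == q))) = (us == A ++ p :: q :: B).
  apply/idP/idP.
    case/andP => /andP[/andP[/eqP su /eqP tu] /eqP du] /andP[/eqP <- /eqP <-].
    have sr : (r.+1 < size us)%N by rewrite su ltnS.
    by rewrite -du -tu /u /v -!drop_nth ?cat_take_drop // ltnW.
  move=> /eqP usE.
  have sA : size A = r by rewrite /A size_takel // ltnW.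
  rewrite /T /u /v usE !nth_cat sA ltnn subnn ltnNge leqnSn subSnn /= !eqxx !andbT.
  rewrite take_size_cat // -sA.
  have -> : drop (size A).+2 (A ++ [:: p, q & B]) = B.
    by rewrite -cat_rcons -cat_rcons drop_size_cat // !size_rcons.
  rewrite !eqxx !andbT size_cat /= /B size_drop sA.
  by apply/eqP; have := ltn_ord r; lia.
have -> : coF lp c w (fun p q => (us == A ++ p :: q :: B)%:R) =
    T%:R * coF lp c w (fun p q => ((u == p) && (v == q))%:R).
  rewrite -coFZ; congr coF; apply/funext => p; apply/funext => q.
  by rewrite -TE -(mulnb T) natrM.
have -> : coF lp c w (fun p q => sg (wpl p && wpl q) * (us == A ++ q :: p :: B)%:R) =
    T%:R * coF lp c w (fun p q => sg (wpl p && wpl q) * ((u == q) && (v == p))%:R).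
  rewrite -coFZ; congr coF; apply/funext => p; apply/funext => q.
  by rewrite -TE -(mulnb T) natrM; ring.
ring.
Qed.

(** On a function with the Koszul symmetry under swaps the two halves of the symmetrized cobracket
    agree, which absorbs the factor 1/2 and leaves only the sign of [cobwE]. *)
Lemma DeltaFE (G : seq word -> rat) ws :
    (forall A p q B, G (A ++ q :: p :: B) = sg (wpl p && wpl q) * G (A ++ p :: q :: B)) ->
  - 2^-1 * (DeltaF lp c ws G
  + \sum_(x <- splits ws) sg (wpls lp x.1.1) * coF lp c x.1.2 (fun p q =>
      sg (wpl p && wpl q) * G (x.1.1 ++ q :: p :: x.2))) = - DeltaF lp c ws G.
Proof.
move=> GC.
have -> : \sum_(x <- splits ws) sg (wpls lp x.1.1) * coF lp c x.1.2 (fun p q =>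
      sg (wpl p && wpl q) * G (x.1.1 ++ q :: p :: x.2)) = DeltaF lp c ws G.
  apply: eq_bigr => x _; congr (_ * coF _ _ _ _); apply/funext => p; apply/funext => q.
  by rewrite GC mulrA -expr2 sqrr_sign mul1r.
by field.
Qed.

End Coefficients.

(** * Finite enumerations of lists of words and of monomials *)

Section Enumeration.

Variable I : finType.
Notation word := (seq I).

(** [sum_words] as a sum over a list without repetitions, so that supports can be compared by
    membership ([mem_words], [words_uniq]). *)
Definition words (k l : nat) : seq (seq word) :=
  [seq reshape (map val (tval x.1)) (tval x.2)
    | x : k.-tuple 'I_l.+1 * l.-tuple I <-
      [seq (s, t) | s <- [seq s : k.-tuple 'I_l.+1 <- enum {: k.-tuple 'I_l.+1}
                         | sumn (map val s) == l],
                    t <- enum {: l.-tuple I}]].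

Lemma mem_words k l ws : (ws \in words k l) =
  (size ws == k) && (size (flatten ws) == l).
Proof.
apply/mapP/andP => [[[s t]]|[/eqP sk /eqP fl]].
  case/allpairsP => -[s' t'] /= [].
  rewrite mem_filter => /andP[/eqP sl _] _ [-> ->] ->.
  by rewrite size_reshape size_map size_tuple reshapeKr ?sl ?size_tuple.
have sh (n : nat) : n \in shape ws -> (n < l.+1)%N.
  rewrite ltnS -fl size_flatten; elim: (shape ws) => //= m s IH.
  rewrite inE => /orP[/eqP ->|/IH]; first exact: leq_addr.
  by move=> /leq_trans; apply; apply: leq_addl.
have s1 : size (map (@inord l) (shape ws)) == k by rewrite !size_map sk.
have vE : map val (map (@inord l) (shape ws)) = shape ws.
  rewrite -map_comp -[RHS]map_id; apply/eq_in_map => n /sh nl /=.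
  by rewrite inordK.
have t1 : size (flatten ws) == l by apply/eqP.
exists (Tuple s1, Tuple t1) => /=; last by rewrite vE flattenK.
apply: allpairs_f; last by rewrite mem_enum.
by rewrite mem_filter mem_enum /= vE -size_flatten fl eqxx.
Qed.

Lemma words_uniq k l : uniq (words k l).
Proof.
rewrite map_inj_in_uniq; last first.
  move=> [s t] [s' t'] /allpairsP[[a b] /= [+ _ [-> ->]]].
  rewrite mem_filter => /andP[/eqP sl _] /allpairsP[[a' b'] /= [+ _ [-> ->]]].
  rewrite mem_filter => /andP[/eqP sl' _] e.
  have := congr1 flatten e; rewrite !reshapeKr ?sl ?sl' ?size_tuple // => /val_inj ->.
  have := congr1 shape e; rewrite !reshapeKl ?sl ?sl' ?size_tuple //.
  by move=> /(inj_map val_inj) /val_inj ->.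
apply: allpairs_uniq; [exact/filter_uniq/enum_uniq|exact: enum_uniq|].
by move=> [s t] [s' t'] _ _ [-> ->].
Qed.

Lemma sum_wordsE k l (F : seq word -> rat) :
  sum_words k l F = \sum_(ws <- words k l) F ws.
Proof.
rewrite /sum_words /words big_map big_allpairs big_filter big_enum_cond /=.
by apply: eq_big => // s _; rewrite big_enum.
Qed.

Definition word_box (B : nat) : seq (seq word) :=
  [seq ws | k <- iota 0 B, ws <- flatten [seq words k l | l <- iota 0 B]].

Definition mon_box (B : nat) : seq (mon I) :=
  [seq (g, ws) | g <- iota 0 B, ws <- word_box B].

Lemma mem_flatten_words k B ws :
  (ws \in flatten [seq words k l | l <- iota 0 B]) =
  (size ws == k) && (size (flatten ws) < B)%N.
Proof.
apply/flattenP/andP => [[s /mapP[l + ->]]|[/eqP sk fB]].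
  by rewrite mem_iota mem_words => lB /andP[-> /eqP ->].
exists (words k (size (flatten ws))); last by rewrite mem_words sk !eqxx.
by apply/mapP; exists (size (flatten ws)) => //; rewrite mem_iota.
Qed.

Lemma mem_word_box B ws :
  (ws \in word_box B) = (size ws < B)%N && (size (flatten ws) < B)%N.
Proof.
apply/allpairsPdep/andP => [[k [v []]]|[sB fB]].
  by rewrite mem_iota mem_flatten_words => kB /andP[/eqP vk fB] ->; rewrite vk fB.
exists (size ws), ws; rewrite mem_iota mem_flatten_words eqxx fB.
by [].
Qed.

Lemma mem_mon_box B m : (m \in mon_box B) =
  [&& (m.1 < B)%N, (size m.2 < B)%N & (size (flatten m.2) < B)%N].
Proof.
apply/allpairsP/and3P => [[[g ws] /= []]|[gB sB fB]].
  by rewrite mem_iota mem_word_box => gB /andP[sB fB] ->.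
by exists m; rewrite mem_iota mem_word_box gB sB fB; split=> //; case: m {gB sB fB}.
Qed.

Lemma uniq_flatten_words k s : uniq s -> uniq (flatten [seq words k l | l <- s]).
Proof.
elim: s => //= l s IH /andP[ls us]; rewrite cat_uniq words_uniq IH // andbT /=.
apply/hasPn => ws /flattenP[t /mapP[l' l's ->]]; rewrite !mem_words.
move=> /andP[_ /eqP fl]; apply/negP => /andP[_]; rewrite fl => /eqP l'l.
by move: ls; rewrite -l'l l's.
Qed.

Lemma word_box_uniq B : uniq (word_box B).
Proof.
apply: allpairs_uniq_dep; first exact: iota_uniq.
  by move=> k _; apply/uniq_flatten_words/iota_uniq.
move=> [k ws] [k' ws'] /allpairsPdep[x [v [_ + [-> ->]]]].
rewrite mem_flatten_words => /andP[/eqP <- _] /allpairsPdep[x' [v' [_ + [-> ->]]]].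
by rewrite mem_flatten_words => /andP[/eqP <- _] /= ->.
Qed.

Lemma mon_box_uniq B : uniq (mon_box B).
Proof.
apply: allpairs_uniq; [exact: iota_uniq|exact: word_box_uniq|].
by move=> [g ws] [g' ws'] _ _ [-> ->].
Qed.

End Enumeration.

Lemma flatten_cons (T : Type) (w : seq T) ws : flatten (w :: ws) = w ++ flatten ws.
Proof. by []. Qed.

Lemma size_cons (T : Type) (x : T) s : size (x :: s) = (size s).+1.
Proof. by []. Qed.

Lemma size_flatten_cat (T : Type) (A B : seq (seq T)) :
  size (flatten (A ++ B)) = (size (flatten A) + size (flatten B))%N.
Proof. by rewrite flatten_cat size_cat. Qed.

Lemma size_flatten_cons (T : Type) (w : seq T) ws :
  size (flatten (w :: ws)) = (size w + size (flatten ws))%N.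
Proof. by rewrite flatten_cons size_cat. Qed.

(** * The pairing of series with tests *)

Section Sizes.

Variables (E : Type) (ep : E -> bool) (g : E -> E -> rat).

Lemma eq_ins_size e (psi psi' : seq E -> rat) u :
  (forall m, (size m).+1 = size u -> psi m = psi' m) ->
  ins ep g e psi u = ins ep g e psi' u.
Proof.
elim: u psi psi' => [|y u IH] psi psi' //= H; congr (_ * _ + _ * _).
  exact: H.
by apply: IH => m mu; apply: H; rewrite /= mu.
Qed.

Lemma eq_lap_size (psi psi' : seq E -> rat) u :
  (forall m, (size m).+2 = size u -> psi m = psi' m) ->
  lap ep g psi u = lap ep g psi' u.
Proof.
elim: u psi psi' => [|y u IH] psi psi' //= H; congr (_ + _ * _).
  by apply: eq_ins_size => m mu; apply: H; rewrite mu.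
by apply: IH => m mu; apply: H; rewrite /= mu.
Qed.

Lemma eq_cross_size u (psi psi' : seq E -> rat) v :
  (forall m, (size m).+2 = (size u + size v)%N -> psi m = psi' m) ->
  cross ep g u psi v = cross ep g u psi' v.
Proof.
elim: u psi psi' => [|y u IH] psi psi' //= H; congr (_ * _ + _ * _).
  by apply: eq_ins_size => m mu; apply: H; rewrite size_cat; lia.
by apply: IH => m mu; apply: H => /=; lia.
Qed.

End Sizes.

Section Pairing.

Variables (I : finType) (lp : I -> bool) (c : I -> I -> rat).
Hypothesis c_sym : forall x y, c x y = c y x.
Hypothesis c_odd : forall x y, lp x = lp y -> c x y = 0.

Notation word := (seq I).
Notation mon := (mon I).
Notation series := (series I).
Local Notation wpl := (wpar lp).
Local Notation delT := (deltaF lp c).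
Local Notation DelT := (DeltaF lp c).
Implicit Types (f : series) (Phi : mon -> rat).

Definition mon_lt b (m : mon) :=
  [&& (m.1 < b)%N, (size m.2 < b)%N & (size (flatten m.2) < b)%N].

Definition bounded b Phi := forall m, ~~ mon_lt b m -> Phi m = 0.

(* With gamma acting as -1, the two terms of gamma delta + Delta add up to minus
   the full contraction operator of trace_lap. *)
Definition mpair B f Phi := \sum_(m <- mon_box I B) (-1) ^+ m.1 * f m * Phi m.

Definition madd (m m' : mon) : mon := ((m.1 + m'.1)%N, m.2 ++ m'.2).

Lemma mpair_linear B f : linear_fun (mpair B f).
Proof.
move=> a F G; rewrite /mpair mulr_sumr -big_split; apply: eq_bigr => m _ /=.
ring.
Qed.

Lemma mpairD B f f' Phi : mpair B (f + f') Phi = mpair B f Phi + mpair B f' Phi.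
Proof.
rewrite /mpair -big_split; apply: eq_bigr => m _ /=.
have -> : (f + f') m = f m + f' m by [].
ring.
Qed.

Lemma mpairZ B a f Phi : mpair B (a *: f) Phi = a * mpair B f Phi.
Proof.
rewrite /mpair mulr_sumr; apply: eq_bigr => m _ /=.
have -> : (a *: f) m = a * f m by [].
ring.
Qed.

Lemma mpairN B f Phi : mpair B (- f) Phi = - mpair B f Phi.
Proof. by rewrite -scaleN1r mpairZ mulN1r. Qed.

Lemma mpairB B f f' Phi : mpair B (f - f') Phi = mpair B f Phi - mpair B f' Phi.
Proof. by rewrite mpairD mpairN. Qed.

Lemma eq_mpair B f Phi Phi' : (forall m, Phi m = Phi' m) ->
  mpair B f Phi = mpair B f Phi'.
Proof. by move=> H; apply: eq_bigr => m _; rewrite H. Qed.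

Lemma mpair_sgamma b B f Phi : bounded b Phi -> (b <= B)%N ->
  mpair B (sgamma f) Phi = - mpair B f (fun m => Phi (m.1.+1, m.2)).
Proof.
move=> bd bB; rewrite /mpair !big_allpairs; case: B bB => [|B] bB.
  by rewrite !big_nil oppr0.
have io1 : iota 0 B.+1 = 0%N :: [seq (1 + g)%N | g <- iota 0 B] by rewrite -iotaDl.
have io2 : iota 0 B.+1 = iota 0 B ++ [:: B] by rewrite -addn1 iotaD.
(* On the left the exponent 0 contributes nothing by definition of [sgamma]; on the right the last
   exponent [B] is moved out of the support of [Phi]. *)
rewrite [in LHS]io1 [in RHS]io2 big_cons big_cat big_seq1 big_map /=.
rewrite big1 ?add0r; last by move=> ws _; rewrite mulr0 mul0r.
rewrite [X in - (_ + X)]big1 ?addr0; last first.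
  by move=> ws _; rewrite bd ?mulr0 // /mon_lt /=; lia.
rewrite -sumrN; apply: eq_bigr => g _.
rewrite -sumrN; apply: eq_bigr => ws _.
by rewrite add1n exprS /sgamma /=; ring.
Qed.

Lemma sum_kronecker (J : eqType) (L : seq J) (y : J) (F : J -> rat) : uniq L ->
  \sum_(x <- L) (x == y)%:R * F x = if y \in L then F y else 0.
Proof.
move=> uL; case: ifP => [yL|/negP yL].
  rewrite (bigD1_seq y) //= eqxx mul1r big1 ?addr0 // => x /negbTE ->.
  by rewrite mul0r.
rewrite big_seq big1 // => x xL; case: eqP => [xy|_]; last by rewrite mul0r.
by case: yL; rewrite -xy.
Qed.

Lemma sum_sub (J : eqType) (L L' : seq J) (F : J -> rat) : uniq L -> uniq L' ->
  {subset L <= L'} -> (forall x, x \notin L -> F x = 0) ->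
  \sum_(x <- L) F x = \sum_(x <- L') F x.
Proof.
move=> uL uL' LL' F0; rewrite (bigID (mem L) xpredT F (r := L')) /=.
rewrite [X in _ + X]big1 ?addr0; last by move=> x; apply: F0.
rewrite -[RHS]big_filter; apply: perm_big; apply: uniq_perm => //.
  exact: filter_uniq.
move=> x; rewrite mem_filter /=; apply/idP/andP => [xL|[]//].
by split=> //; apply: LL'.
Qed.

(** The factors of a monomial in the box lie in the box, so its splittings are exactly the pairs
    from the box whose product it is. *)
Lemma smul_sum B (h : mon -> mon -> rat) g ws : (g, ws) \in mon_box I B ->
  \sum_(i < g.+1) \sum_(k < (size ws).+1)
    h (nat_of_ord i, take k ws) ((g - i)%N, drop k ws) =
  \sum_(p <- [seq (m, m') | m <- mon_box I B, m' <- mon_box I B])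
    ((g, ws) == madd p.1 p.2)%:R * h p.1 p.2.
Proof.
rewrite mem_mon_box /= => /and3P[gB sB lB].
pose L2 := [seq ((i, take k ws), ((g - i)%N, drop k ws))
  | i <- iota 0 g.+1, k <- iota 0 (size ws).+1].
transitivity (\sum_(p <- L2) h p.1 p.2).
  rewrite /L2 big_allpairs_dep.
  rewrite -(big_mkord xpredT (fun i => \sum_(k < (size ws).+1)
    h (i, take k ws) ((g - i)%N, drop k ws))) /index_iota subn0.
  apply: eq_bigr => i _.
  by rewrite -(big_mkord xpredT (fun k => h (i, take k ws) ((g - i)%N, drop k ws)))
    /index_iota subn0.
transitivity (\sum_(p <- [seq (m, m') | m <- mon_box I B, m' <- mon_box I B]
    | (g, ws) == madd p.1 p.2) h p.1 p.2); last first.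
  rewrite big_mkcond; apply: eq_bigr => p _.
  by case: ifP => _; rewrite ?mul1r ?mul0r.
rewrite -[RHS]big_filter; apply: perm_big; apply: uniq_perm.
- apply: allpairs_uniq; rewrite ?iota_uniq // => -[i k] [i' k'].
  case/allpairsP => -[x y] [_ yk [-> ->]] /allpairsP[[x' y'] [_ yk' [-> ->]]].
  move: yk yk'; rewrite !mem_iota /= => yk yk' [-> e _ _].
  by have := congr1 size e; rewrite !size_takel; try lia; move=> ->.
- by apply/filter_uniq/allpairs_uniq; rewrite ?mon_box_uniq // => -[? ?] [? ?] _ _ [-> ->].
move=> p; rewrite mem_filter; apply/allpairsP/andP.
  case=> -[i k] []; rewrite !mem_iota /= => ig kw ->; rewrite /madd /= cat_take_drop.
  rewrite subnKC //; split; first by rewrite eqxx.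
  have lE : (size (flatten (take k ws)) + size (flatten (drop k ws)))%N =
      size (flatten ws) by rewrite -size_cat -flatten_cat cat_take_drop.
  apply: allpairs_f; rewrite mem_mon_box /= ?size_drop ?size_takel //.
    by rewrite (leq_ltn_trans _ gB) // (leq_ltn_trans _ sB) // (leq_ltn_trans _ lB)
      // -lE leq_addr.
  by rewrite (leq_ltn_trans (leq_subr _ _) gB) (leq_ltn_trans (leq_subr _ _) sB)
    (leq_ltn_trans _ lB) // -lE leq_addl.
case: p => -[i us] [i' us'] [/eqP[-> ->] _].
exists (i, size us); split.
- by rewrite mem_iota /= ltnS leq_addr.
- by rewrite mem_iota /= ltnS size_cat leq_addr.
by rewrite /= take_size_cat // drop_size_cat // addKn.
Qed.

Lemma mpair_smul b B f f' Phi : bounded b Phi -> (b <= B)%N ->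
  mpair B (smul f f') Phi =
  mpair B f (fun m => mpair B f' (fun m' => Phi (madd m m'))).
Proof.
move=> bd bB; rewrite /mpair.
have mP m m' (h : rat) : h * Phi (madd m m') =
    \sum_(k <- mon_box I B) (k == madd m m')%:R * (h * Phi k).
  rewrite sum_kronecker ?mon_box_uniq //; case: ifP => // /negP/negP mB.
  rewrite bd ?mulr0 //; apply: contra mB; rewrite mem_mon_box => /and3P[h1 h2 h3].
  by rewrite !(leq_trans _ bB).
transitivity (\sum_(m <- mon_box I B) \sum_(m' <- mon_box I B)
    \sum_(k <- mon_box I B) (k == madd m m')%:R *
    ((-1) ^+ m.1 * f m * ((-1) ^+ m'.1 * f' m') * Phi k)); last first.
  apply: eq_bigr => m _; rewrite mulr_sumr; apply: eq_bigr => m' _.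
  by rewrite -mP; ring.
pose L := [seq (m, m') | m <- mon_box I B, m' <- mon_box I B].
transitivity (\sum_(p <- L) \sum_(k <- mon_box I B) (k == madd p.1 p.2)%:R *
    ((-1) ^+ p.1.1 * f p.1 * ((-1) ^+ p.2.1 * f' p.2) * Phi k));
  last by rewrite big_allpairs.
rewrite exchange_big; apply: eq_big_seq => -[g ws] /= mB.
rewrite /smul (smul_sum (fun m m' => f m * f' m') mB) /= mulr_sumr mulr_suml.
rewrite -/L; apply: eq_bigr => -[m m'] _ /=.
case: eqP => [e|]; last by rewrite !mul0r mulr0 mul0r.
have -> : g = (m.1 + m'.1)%N by case: e.
by rewrite exprD; ring.
Qed.

Definition testmon N (Psi : nat -> seq (edge I) -> rat) : mon -> rat :=
  fun m => trace N (Psi (2 * m.1 + size m.2)%N) m.2.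

(** The transposition argument common to delta and Delta. [kf] gives the number of factors before
    the operator in terms of the number after it; a source has two more letters and at most one more
    word than its target, hence the margin in [b.+2]. *)
Lemma mpair_coef (kf : nat -> nat) (coef : seq word -> seq word -> rat) f s b B Phi :
    (forall m, s m = sum_words (kf (size m.2)) (size (flatten m.2)).+2
      (fun ws => f (m.1, ws) * coef ws m.2)) ->
    (forall ws us, coef ws us != 0 ->
      (size ws == kf (size us)) && (size (flatten ws) == (size (flatten us)).+2)) ->
    (forall k, (kf k <= k.+1)%N) ->
    bounded b Phi -> (b.+2 <= B)%N ->
  mpair B s Phi = mpair B f (fun m =>
    \sum_(us <- word_box I B) coef m.2 us * Phi (m.1, us)).
Proof.
move=> sE coef0 kfE bd bB; rewrite /mpair !big_allpairs; apply: eq_bigr => g _ /=.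
transitivity (\sum_(us <- word_box I B) \sum_(ws <- word_box I B)
    (-1) ^+ g * f (g, ws) * coef ws us * Phi (g, us)); last first.
  rewrite exchange_big; apply: eq_bigr => ws _ /=; rewrite mulr_sumr.
  by apply: eq_bigr => us _; rewrite mulrA.
apply: eq_bigr => us _; rewrite -mulr_suml sE /= sum_wordsE.
have [lt|/bd ->] := boolP (mon_lt b (g, us)); last by rewrite !mulr0.
congr (_ * _); rewrite mulr_sumr.
under [LHS]eq_bigr do rewrite mulrA.
apply: sum_sub; rewrite ?words_uniq ?word_box_uniq //.
  move=> ws; rewrite mem_words mem_word_box => /andP[/eqP -> /eqP ->].
  case/and3P: lt => /= _ kb lb; have := kfE (size us); lia.
move=> ws; rewrite mem_words; have [-> _|/coef0 -> //] := eqVneq (coef ws us) 0.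
by rewrite mulr0.
Qed.

Lemma deltaF_size ws (F G : seq word -> rat) :
    (forall us, (size us).+1 = size ws ->
      (size (flatten us)).+2 = size (flatten ws) -> F us = G us) ->
  delT ws F = delT ws G.
Proof.
move=> H; apply: eq_splits => A w C wsE; apply: eq_splits => A' w' C' /= CE.
congr (_ * _); apply: eq_splits => u a v /= wE; apply: eq_splits => u' a' v' /= w'E.
congr (_ * _); apply: H; rewrite wsE /= CE.
  by rewrite !(size_cat, size_cons); lia.
rewrite !(size_flatten_cat, size_flatten_cons) wE w'E.
by rewrite !(size_cat, size_cons); lia.
Qed.

Lemma coF_size w F G : (forall p q, (size p + size q).+2 = size w -> F p q = G p q) ->
  coF lp c w F = coF lp c w G.
Proof.
move=> H; apply: eq_splits => u a v /= wE; apply: eq_splits => u' a' v' /= vE.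
by congr (_ * _); apply: H; rewrite wE vE !(size_cat, size_cons); lia.
Qed.

(** Stated for functions of the four pieces because the swapped term in [Delta_coefE] is not a
    function of the concatenated list. *)
Lemma DeltaF_size2 ws (F G : seq word -> word -> word -> seq word -> rat) :
    (forall A p q C, (size (A ++ p :: q :: C)) = (size ws).+1 ->
      (size (flatten (A ++ p :: q :: C))).+2 = size (flatten ws) ->
      F A p q C = G A p q C) ->
  \sum_(x <- splits ws) sg (wpls lp x.1.1) *
    coF lp c x.1.2 (fun p q => F x.1.1 p q x.2) =
  \sum_(x <- splits ws) sg (wpls lp x.1.1) *
    coF lp c x.1.2 (fun p q => G x.1.1 p q x.2).
Proof.
move=> H; apply: eq_splits => A w C /= wsE; congr (_ * _).
apply: coF_size => p q wE; apply: H; rewrite wsE.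
  by rewrite !(size_cat, size_cons); lia.
by rewrite !(size_flatten_cat, size_flatten_cons); lia.
Qed.

Lemma DeltaF_size ws (F G : seq word -> rat) :
    (forall us, size us = (size ws).+1 ->
      (size (flatten us)).+2 = size (flatten ws) -> F us = G us) ->
  DelT ws F = DelT ws G.
Proof.
move=> H; apply: (@DeltaF_size2 ws (fun A p q C => F (A ++ p :: q :: C))
  (fun A p q C => G (A ++ p :: q :: C))) => A p q C; exact: H.
Qed.

Lemma sum_word_box b B g us Phi : bounded b Phi -> (b <= B)%N ->
  \sum_(vs <- word_box I B) (vs == us)%:R * Phi (g, vs) = Phi (g, us).
Proof.
move=> bd bB; rewrite (sum_kronecker us (fun vs => Phi (g, vs))) ?word_box_uniq //.
case: ifP => // /negP/negP; rewrite mem_word_box => usB; rewrite bd //.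
by apply: contra usB => /and3P[/= _ h1 h2]; rewrite !(leq_trans _ bB).
Qed.

Lemma mpair_sdelta b B f Phi : bounded b Phi -> (b.+2 <= B)%N ->
  mpair B (sdelta lp c f) Phi =
  mpair B f (fun m => delT m.2 (fun us => Phi (m.1, us))).
Proof.
move=> bd bB; rewrite (@mpair_coef S (delta_coef lp c) f _ b) //; last first.
  move=> ws us; apply: contraNT => H; rewrite delta_coefE //.
  rewrite (deltaF_size (G := fun=> 0)) ?linear_fun0 //; first exact: deltaF_linear.
  move=> vs s1 s2; case: eqP => // e; case/negP: H.
  by rewrite -s1 -s2 e !eqxx.
apply: eq_mpair => -[g ws] /=.
under eq_bigr do rewrite delta_coefE // mulrC.
under eq_bigr do rewrite -(linear_funZ (deltaF_linear _ _ _)).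
rewrite -(linear_fun_sum (deltaF_linear _ _ _)); congr deltaF.
apply/funext => us; rewrite -(sum_word_box g us bd (ltnW (ltnW bB))).
by apply: eq_bigr => vs _; rewrite mulrC.
Qed.

Lemma mpair_sDelta b B f Phi : bounded b Phi -> (b.+2 <= B)%N ->
    (forall g A p q C, Phi (g, A ++ q :: p :: C) =
       sg (wpl p && wpl q) * Phi (g, A ++ p :: q :: C)) ->
  mpair B (sDelta lp c f) Phi =
  - mpair B f (fun m => DelT m.2 (fun us => Phi (m.1, us))).
Proof.
move=> bd bB PhiC.
have supp ws us : Delta_coef lp c ws us != 0 ->
    (size ws == (size us).-1) && (size (flatten ws) == (size (flatten us)).+2).
  apply: contraNT => H; rewrite Delta_coefE //.
  have DF0 : \sum_(x <- splits ws) sg (wpls lp x.1.1) * coF lp c x.1.2 (fun=> fun=> 0) = 0.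
    rewrite big1 // => x _; rewrite /coF big1 ?mulr0 // => y _.
    by rewrite big1 // => z _; rewrite mulr0.
  have notin A p q C : size (A ++ p :: q :: C) = (size ws).+1 ->
      (size (flatten (A ++ p :: q :: C))).+2 = size (flatten ws) ->
      (us == A ++ p :: q :: C) = false.
    move=> s1 s2; apply: contraNF H => /eqP ->.
    by rewrite s1 -s2 !eqxx.
  rewrite /DeltaF (@DeltaF_size2 ws (fun A p q C => (us == A ++ p :: q :: C)%:R)
    (fun _ _ _ _ => 0)); last by move=> A p q C s1 s2; rewrite notin.
  rewrite (@DeltaF_size2 ws (fun A p q C => sg (wpl p && wpl q) *
    (us == A ++ q :: p :: C)%:R) (fun _ _ _ _ => 0)).
    by rewrite DF0 addr0 mulr0.
  move=> A p q C s1 s2; rewrite notin ?mulr0 //.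
    by rewrite -s1 !(size_cat, size_cons).
  by rewrite -s2 !(size_flatten_cat, size_flatten_cons) (addnCA (size q)).
rewrite (@mpair_coef predn (Delta_coef lp c) f _ b) //; last by move=> k; lia.
rewrite -(linear_funN (mpair_linear B f)).
apply: eq_mpair => -[g ws] /=.
rewrite -(DeltaFE _ _ (fun A p q C => PhiC g A p q C)) //.
transitivity (\sum_(us <- word_box I B) (- 2^-1 * (DelT ws (fun vs => (us == vs)%:R * Phi (g, us))
  + \sum_(x <- splits ws) sg (wpls lp x.1.1) * coF lp c x.1.2 (fun p q =>
      sg (wpl p && wpl q) * ((us == x.1.1 ++ q :: p :: x.2)%:R * Phi (g, us)))))).
  apply: eq_bigr => us _; rewrite Delta_coefE // -mulrA mulrDl; congr (_ * (_ + _)).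
    rewrite mulrC -(linear_funZ (DeltaF_linear _ _ _)); congr DeltaF.
    by apply/funext => vs; rewrite mulrC.
  rewrite mulr_suml; apply: eq_bigr => x _; rewrite -mulrA mulrC -[RHS]mulrC; congr (_ * _).
  rewrite mulrC -coFZ; congr coF; apply/funext => p; apply/funext => q; ring.
rewrite -mulr_sumr big_split /=; congr (_ * (_ + _)).
  rewrite -(linear_fun_sum (DeltaF_linear _ _ _)); congr DeltaF.
  by apply/funext => us; rewrite -(sum_word_box g us bd (ltnW (ltnW bB))).
rewrite exchange_big; apply: eq_bigr => x _ /=; rewrite -mulr_sumr; congr (_ * _).
rewrite /coF exchange_big; apply: eq_bigr => y _ /=.
rewrite exchange_big; apply: eq_bigr => z _ /=; rewrite -mulr_sumr; congr (_ * _).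
by rewrite -mulr_sumr (sum_word_box _ _ bd (ltnW (ltnW bB))).
Qed.

Local Notation edge := (edge I).
Local Notation epar := (@epar I lp).
Local Notation eform := (@eform I c).
Implicit Types (Psi : nat -> seq edge -> rat).

Definition bounded_test b Psi :=
  forall q u, ~~ ((q < b)%N && (size u < b)%N) -> Psi q u = 0.

Definition supersym_test Psi := forall q, supersym epar (Psi q).

Lemma testmon_bounded N b Psi : bounded_test b Psi -> bounded b (testmon N Psi).
Proof.
move=> bd m mb; rewrite /testmon /trace big_seq big1 // => u /traces_labels uE.
apply: bd; apply: contra mb => /andP[h1 h2].
rewrite /mon_lt -uE /labels size_map h2 andbT; lia.
Qed.

Definition tpair B N f Psi := mpair B f (testmon N Psi).

Lemma testmon_linear N m : linear_fun (fun Psi' : nat * seq edge -> rat =>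
  testmon N (fun q u => Psi' (q, u)) m).
Proof. by move=> a F G; rewrite /testmon /trace big_split mulr_sumr. Qed.

Lemma tpair_linear B N f : linear_fun (fun Psi' : nat * seq edge -> rat =>
  tpair B N f (fun q u => Psi' (q, u))).
Proof.
move=> a F G; rewrite /tpair -mpair_linear; apply: eq_mpair => m.
exact: testmon_linear.
Qed.

Lemma eq_tpair B N f Psi Psi' : (forall q u, Psi q u = Psi' q u) ->
  tpair B N f Psi = tpair B N f Psi'.
Proof.
by move=> H; apply: eq_mpair => m; apply: eq_bigr => u _; apply: H.
Qed.

Lemma tpair_sgamma b B N f Psi : bounded_test b Psi -> (b <= B)%N ->
  tpair B N (sgamma f) Psi = - tpair B N f (fun q => Psi q.+2).
Proof.
move=> bd bB; rewrite /tpair (mpair_sgamma _ (testmon_bounded N bd)) //; congr (- _).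
by apply: eq_mpair => -[g ws]; rewrite /testmon /= mulnS.
Qed.

Lemma tpair_sd b B N f Psi : bounded_test b Psi -> supersym_test Psi -> (b.+2 <= B)%N ->
  tpair B N (sd lp c f) Psi = - tpair B N f (fun q => lap epar eform (Psi q.+1)).
Proof.
move=> bd sp bB; have tb := testmon_bounded N bd.
rewrite /tpair /sd mpairD (mpair_sgamma _ tb); last by lia.
have bd' : bounded b (fun m => testmon N Psi (m.1.+1, m.2)).
  by move=> m mb; apply: tb; apply: contra mb; rewrite /mon_lt /=; lia.
rewrite (mpair_sdelta _ bd') // (mpair_sDelta _ tb) //; last first.
  move=> g A p q C; rewrite /testmon /= !size_cat /=.
  have := @trace_catC I lp N (Psi (2 * g + (size A + (size C).+2))%N) A [:: q] [:: p] C.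
  by rewrite /wpls /= !cats0 andbC; apply.
rewrite -opprD; congr (- _); rewrite /mpair -big_split /=.
apply: eq_bigr => -[g ws] _ /=; rewrite -mulrDr; congr (_ * _).
rewrite /testmon /= trace_lap // addrC; congr (_ + _).
  apply: DeltaF_size => us -> _; congr (trace _ (Psi _)).
  by rewrite addnS.
apply: deltaF_size => us <- _; congr (trace _ (Psi _)).
by rewrite mulnS !addnS.
Qed.

Lemma DeltaF_cat ws ws' F : DelT (ws ++ ws') F =
  DelT ws (fun us => F (us ++ ws'))
  + sg (wpls lp ws) * DelT ws' (fun us => F (ws ++ us)).
Proof.
rewrite /DeltaF (splits_catE (fun A w C => sg (wpls lp A) *
  coF lp c w (fun p q => F (A ++ p :: q :: C)))); congr (_ + _).
  apply: eq_bigr => x _; congr (_ * coF _ _ _ _).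
  by apply/funext => p; apply/funext => q; rewrite -catA.
rewrite mulr_sumr; apply: eq_bigr => x _; rewrite wpls_cat signr_addb mulrA.
congr (_ * coF _ _ _ _).
by apply/funext => p; apply/funext => q; rewrite -catA.
Qed.

(* DeltaF is a derivation, so both brackets measure how far deltaF + DeltaF and
   [lap] are from being derivations. *)
Lemma deltaF_cross N psi ws ws' : supersym epar psi ->
  delT (ws ++ ws') (trace N psi) - delT ws (fun us => trace N psi (us ++ ws'))
  - sg (wpls lp ws) * delT ws' (fun us => trace N psi (ws ++ us)) =
  \sum_(u <- traces N ws) \sum_(u' <- traces N ws') cross epar eform u psi u'.
Proof.
move=> sp; have dE vs chi : supersym epar chi ->
    delT vs (trace N chi) = trace N (lap epar eform chi) vs - DelT vs (trace N chi).
  by move=> sc; rewrite trace_lap // addrC addKr.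
have E1 : delT ws (fun us => trace N psi (us ++ ws')) =
    \sum_(u' <- traces N ws') (trace N (lap epar eform (fun m => psi (m ++ u'))) ws)
    - DelT ws (fun us => trace N psi (us ++ ws')).
  have catE : (fun us => trace N psi (us ++ ws')) =
      (fun us => \sum_(u' <- traces N ws') trace N (fun m => psi (m ++ u')) us).
    by apply/funext => us; rewrite trace_cat exchange_big.
  rewrite catE (linear_fun_sum (deltaF_linear lp c ws)).
  rewrite (linear_fun_sum (DeltaF_linear lp c ws)) -sumrB; apply: eq_bigr => u' _.
  by rewrite dE //; apply: supersym_catr.
have E2 : delT ws' (fun us => trace N psi (ws ++ us)) =
    \sum_(u <- traces N ws) (trace N (lap epar eform (fun m => psi (u ++ m))) ws')
    - DelT ws' (fun us => trace N psi (ws ++ us)).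
  have catE : (fun us => trace N psi (ws ++ us)) =
      (fun us => \sum_(u <- traces N ws) trace N (fun m => psi (u ++ m)) us).
    by apply/funext => us; rewrite trace_cat.
  rewrite catE (linear_fun_sum (deltaF_linear lp c ws')).
  rewrite (linear_fun_sum (DeltaF_linear lp c ws')) -sumrB; apply: eq_bigr => u _.
  by rewrite dE //; apply: supersym_catl.
rewrite E1 E2 dE // DeltaF_cat /trace exchange_big /= sum_traces_cat.
transitivity (\sum_(u <- traces N ws) \sum_(u' <- traces N ws')
   (lap epar eform psi (u ++ u') - lap epar eform (fun m => psi (m ++ u')) u
    - sg (wpls lp ws) * lap epar eform (fun m => psi (u ++ m)) u')); last first.
  apply: eq_big_seq => u /(traces_wp lp) uE; apply: eq_bigr => u' _.
  by rewrite crossE uE.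
under [RHS]eq_bigr do rewrite !big_split /= !sumrN -mulr_sumr.
rewrite !big_split /= !sumrN -mulr_sumr.
ring.
Qed.

Lemma cross_bounded b Psi q u : bounded_test b Psi ->
  bounded_test b.+2 (fun q' => cross epar eform u (Psi (q + q').+1)).
Proof.
move=> bd q' u' H; rewrite (@eq_cross_size _ _ _ _ _ (fun=> 0)).
  exact: (linear_fun0 (@cross_linear _ _ _ u u')).
by move=> m mE; apply: bd; apply: contra H; lia.
Qed.

(** Transposing delta in the three terms of [sbr] leaves, on each pair of monomials, the defect of
    [deltaF] from being a derivation, which [deltaF_cross] evaluates. With the factor gamma the
    indices [q] and [q'] contribute at [q + q' + 1]. *)
Lemma tpair_sbr b B N f f' Psi : bounded_test b Psi -> supersym_test Psi ->
    (b.+4 <= B)%N ->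
  tpair B N (sgamma (sbr lp c f f')) Psi =
  - tpair B N f (fun q u => tpair B N f' (fun q' u' => cross epar eform u (Psi (q + q').+1) u')).
Proof.
move=> bd sp bB; have bB1 : (b <= B)%N by lia.
have bB2 : (b.+2 <= B)%N by lia.
rewrite (tpair_sgamma _ _ bd) //; congr (- _).
pose Phi := testmon N (fun q => Psi q.+2).
have tb : bounded b Phi.
  by apply: testmon_bounded => q u H; apply: bd; apply: contra H; lia.
have tb' : bounded b.+2 (fun m => delT m.2 (fun us => Phi (m.1, us))).
  move=> m mb; rewrite (@deltaF_size _ _ (fun=> 0)).
    exact: (linear_fun0 (deltaF_linear lp c _)).
  by move=> us s1 s2; apply: tb; apply: contra mb; rewrite /mon_lt -s1 -s2 /=; lia.
have tbl h : bounded b (fun m => mpair B h (fun m' => Phi (madd m m'))).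
  move=> m mb; rewrite /mpair big1 // => m' _; rewrite tb ?mulr0 //.
  apply: contra mb; rewrite /mon_lt /= size_cat size_flatten_cat; lia.
have tbr m : bounded b (fun m' => Phi (madd m m')).
  move=> m' mb; rewrite tb //; apply: contra mb.
  by rewrite /mon_lt /= size_cat size_flatten_cat; lia.
rewrite /tpair -/Phi /sbr !mpairB (mpair_sdelta _ tb) // (mpair_smul _ _ tb') //.
rewrite !(mpair_smul _ _ tb) // (mpair_sdelta _ (tbl _)) //.
have -> : mpair B (ssign lp f) (fun m => mpair B (sdelta lp c f') (fun m' => Phi (madd m m')))
    = mpair B f (fun m => sg (wpls lp m.2) * mpair B f' (fun m' =>
        delT m'.2 (fun us => Phi (madd m (m'.1, us))))).
  by apply: eq_bigr => m _; rewrite (mpair_sdelta _ (@tbr m)) // /ssign; ring.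
rewrite -!(linear_funB (@mpair_linear B f)); apply: eq_mpair => -[g ws] /=.
have -> : delT ws (fun us => mpair B f' (fun m' => Phi (madd (g, us) m'))) =
    mpair B f' (fun m' => delT ws (fun us => Phi (madd (g, us) m'))).
  rewrite /mpair (linear_fun_sum (deltaF_linear lp c ws)).
  by apply: eq_bigr => m' _; rewrite (linear_funZ (deltaF_linear lp c ws)).
rewrite -(linear_funZ (@mpair_linear B f')) -!(linear_funB (@mpair_linear B f')).
rewrite /testmon /= /trace.
rewrite -(linear_fun_sum (mpair_linear B f')); apply: eq_mpair => -[g' ws'] /=.
set psi := Psi (2 * g + size ws + (2 * g' + size ws')).+1.
have sp' : supersym epar psi by apply: sp.
rewrite -(deltaF_cross N ws ws' sp'); congr (_ - _ - _ * _).
- apply: deltaF_size => us s1 _; rewrite /Phi /testmon /psi /madd /=.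
  by congr (trace _ (Psi _)); move: s1; rewrite size_cat => s1; lia.
- apply: deltaF_size => us s1 _; rewrite /Phi /testmon /psi /madd /=.
  by congr (trace _ (Psi _)); rewrite size_cat; lia.
- apply: deltaF_size => us s1 _; rewrite /Phi /testmon /psi /madd /=.
  by congr (trace _ (Psi _)); rewrite size_cat; lia.
Qed.

Lemma tpairZ B N f a F : tpair B N f (fun q u => a * F q u) = a * tpair B N f F.
Proof. exact: (linear_funZ (@tpair_linear B N f) a (fun p => F p.1 p.2)). Qed.

Lemma tpairD B N f F G : tpair B N f (fun q u => F q u + G q u) = tpair B N f F + tpair B N f G.
Proof.
exact: (linear_funD (@tpair_linear B N f) (fun p => F p.1 p.2) (fun p => G p.1 p.2)).
Qed.

Lemma tpair0 B N f : tpair B N f (fun _ _ => 0) = 0.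
Proof. exact: (linear_fun0 (@tpair_linear B N f)). Qed.

Lemma tpair_fubini B N f f' (F : nat -> seq edge -> nat -> seq edge -> rat) :
  tpair B N f (fun q u => tpair B N f' (F q u)) =
  tpair B N f' (fun q' u' => tpair B N f (fun q u => F q u q' u')).
Proof.
rewrite /tpair /mpair.
transitivity (\sum_(m <- mon_box I B) \sum_(m' <- mon_box I B)
  \sum_(u <- traces N m.2) \sum_(u' <- traces N m'.2)
  ((-1) ^+ m.1 * f m) * ((-1) ^+ m'.1 * f' m') *
  F (2 * m.1 + size m.2)%N u (2 * m'.1 + size m'.2)%N u').
  apply: eq_bigr => m _; rewrite /testmon /trace exchange_big mulr_sumr.
  apply: eq_bigr => m' _; rewrite mulr_sumr; apply: eq_bigr => u _ /=.
  by rewrite !mulr_sumr; apply: eq_bigr => u' _; rewrite mulrA.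
rewrite exchange_big; apply: eq_bigr => m' _.
rewrite /testmon /trace exchange_big mulr_sumr.
apply: eq_bigr => m _; rewrite exchange_big mulr_sumr; apply: eq_bigr => u' _ /=.
by rewrite !mulr_sumr; apply: eq_bigr => u _; ring.
Qed.

Definition even_series f := forall m, mpar lp m -> f m = 0.

Lemma eq_tpair_even B N f F G : even_series f ->
  (forall q u, ~~ wp epar u -> F q u = G q u) -> tpair B N f F = tpair B N f G.
Proof.
move=> ev FG; apply: eq_bigr => m _.
have [mo|me] := boolP (mpar lp m); first by rewrite ev // mulr0 !mul0r.
congr (_ * _); apply: eq_big_seq => u /(traces_wp lp) uE; apply: FG.
by rewrite uE.
Qed.

Lemma tpairD_series B N f f' F : tpair B N (f + f') F = tpair B N f F + tpair B N f' F.
Proof. exact: mpairD. Qed.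

Lemma tpairZ_series B N a f F : tpair B N (a *: f) F = a * tpair B N f F.
Proof. exact: mpairZ. Qed.

Lemma tpairN_series B N f F : tpair B N (- f) F = - tpair B N f F.
Proof. exact: mpairN. Qed.

Lemma sgammaD f f' : sgamma (f + f') = sgamma f + sgamma f'.
Proof. by apply/funext => -[[|g] ws]; rewrite /sgamma /= ?addr0. Qed.

Lemma sgammaZ a f : sgamma (a *: f) = a *: sgamma f.
Proof.
apply/funext => m; transitivity (a * sgamma f m); last by [].
by case: m => -[|g] ws; rewrite /sgamma /= ?mulr0.
Qed.

Lemma lap_supersym_test Psi k : supersym_test Psi ->
  supersym_test (fun q => lap epar eform (Psi (q + k)%N)).
Proof.
by move=> sp q; apply: (lap_supersym (eform_sym c_sym) (eform_odd c_odd)).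
Qed.

Lemma bounded_shift b k Psi : bounded_test b Psi ->
  bounded_test b (fun q => Psi (q + k)%N).
Proof. by move=> bd q u H; apply: bd; apply: contra H; lia. Qed.

Definition scurv f := sd lp c f + 2^-1 *: sbr lp c f f.

(** The shift to [Psi q.+2] stands for the factor gamma that [tpair_sbr] requires. *)
Lemma tpair_scurv b B N x Psi : bounded_test b Psi -> supersym_test Psi ->
    (b.+4 <= B)%N ->
  tpair B N (scurv x) (fun q => Psi q.+2) =
  - tpair B N x (fun q => lap epar eform (Psi (q + 3)%N))
  + 2^-1 * tpair B N x (fun q u => tpair B N x (fun q' => cross epar eform u (Psi (q + q').+1))).
Proof.
move=> bd sp bB; have bB1 : (b <= B)%N by lia.
apply: oppr_inj; rewrite -(tpair_sgamma _ _ bd) // /scurv sgammaD tpairD_series.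
rewrite sgammaZ tpairZ_series (tpair_sbr _ _ _ bd) // (tpair_sgamma _ _ bd) //.
have bd2 : bounded_test b (fun q => Psi q.+2).
  by move=> q u H; apply: bd; apply: contra H; lia.
have sp2 : supersym_test (fun q => Psi q.+2) by move=> q; apply: sp.
rewrite (tpair_sd _ _ bd2 sp2); last by lia.
rewrite opprD !opprK mulrN; congr (_ - _).
by apply: eq_tpair => q u; rewrite addn3.
Qed.

(** One factor gamma for each of two nested brackets. The terms cancel only after symmetrization
    over the copies of [x], which [tpair_fubini] provides; evenness of [x] restricts the arguments
    to the even words for which [cross_lap] and [cross_jacobi] hold. *)
Lemma tpair_bianchi b B N x Psi : even_series x ->
    bounded_test b Psi -> supersym_test Psi -> (b + 6 <= B)%N ->
  tpair B N (sgamma (sgamma (sd lp c (scurv x) + sbr lp c x (scurv x)))) Psi = 0.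
Proof.
move=> ev bd sp bB; have bB1 : (b <= B)%N by lia.
have bB4 : (b.+4 <= B)%N by lia.
have bB2 : (b.+2 <= B)%N by lia.
have bd2 : bounded_test b (fun q => Psi q.+2).
  by move=> q u H; apply: bd; apply: contra H; lia.
have bd4 : bounded_test b (fun q => Psi q.+4).
  by move=> q u H; apply: bd; apply: contra H; lia.
have sp2 : supersym_test (fun q => Psi q.+2) by move=> q; apply: sp.
have sp4 : supersym_test (fun q => Psi q.+4) by move=> q; apply: sp.
have bd3 : bounded_test b (fun q => Psi (q + 3)%N) by apply: bounded_shift.
have bd1 q : bounded_test b (fun q' => Psi (q + q').+1).
  by move=> q' u H; apply: bd; apply: contra H; lia.
rewrite sgammaD sgammaD tpairD_series !(tpair_sgamma _ _ bd) // !(tpair_sgamma _ _ bd2) //.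
rewrite opprK (tpair_sd _ _ bd4 sp4 bB2).
rewrite -(tpair_sgamma _ _ bd2) // (tpair_sbr _ _ _ bd2 sp2 bB4) opprK.
pose Xi1 q := lap epar eform (Psi (q + 3)%N).
have bX1 : bounded_test b.+2 Xi1.
  move=> q u H; rewrite /Xi1 (@eq_lap_size _ _ _ _ (fun=> 0)).
    exact: (linear_fun0 (@lap_linear _ _ _ u)).
  by move=> m mE; apply: bd; apply: contra H; lia.
have sX1 : supersym_test Xi1 by apply: lap_supersym_test.
have bB24 : (b.+2.+4 <= B)%N by lia.
have -> : tpair B N (scurv x) (fun q => lap epar eform (Psi q.+1.+4)) =
    2^-1 * tpair B N x (fun q u => tpair B N x (fun q' =>
      cross epar eform u (lap epar eform (Psi (q + q').+4)))).
  transitivity (tpair B N (scurv x) (fun q => Xi1 q.+2)).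
    by apply: eq_tpair => q u; rewrite /Xi1 addn3.
  rewrite (tpair_scurv _ _ bX1 sX1 bB24) (_ : tpair B N x _ = 0) ?oppr0 ?add0r.
    congr (_ * _); apply: eq_tpair => q u; apply: eq_tpair => q' u'.
    by rewrite /Xi1 addn3.
  rewrite -(tpair0 B N x); apply: eq_tpair => q u.
  exact: (lap_lap (eform_odd c_odd)).
pose Xi2 q u q' := cross epar eform u (Psi (q + q').+1).
have -> : tpair B N x (fun q u => tpair B N (scurv x) (fun q' u' =>
      cross epar eform u (Psi (q + q').+3) u')) =
    tpair B N x (fun q u =>
    - tpair B N x (fun q' => lap epar eform (cross epar eform u (Psi (q + q').+4)))
    + 2^-1 * tpair B N x (fun q' u' => tpair B N x (fun q'' =>
        cross epar eform u' (cross epar eform u (Psi (q + (q' + q'')).+2))))).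
  apply: eq_tpair => q u.
  have bX2 : bounded_test b.+2 (Xi2 q u) := cross_bounded q u bd.
  have sX2 : supersym_test (Xi2 q u).
    by move=> q'; apply: (cross_supersym (eform_odd c_odd)).
  transitivity (tpair B N (scurv x) (fun q' => Xi2 q u q'.+2)).
    by apply: eq_tpair => q' u'; rewrite /Xi2 !addnS.
  rewrite (tpair_scurv _ _ bX2 sX2 bB24); congr (- _ + _ * _).
    by apply: eq_tpair => q' u'; rewrite /Xi2 addn3 !addnS.
  by apply: eq_tpair => q' u'; apply: eq_tpair => q'' u''; rewrite /Xi2 !addnS.
rewrite tpairD (_ : tpair B N x (fun q u => - tpair B N x _) = - tpair B N x (fun q u => tpair B N x
    (fun q' => lap epar eform (cross epar eform u (Psi (q + q').+4))))); last first.
  by rewrite -mulN1r -tpairZ; apply: eq_tpair => q u; rewrite mulN1r.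
rewrite tpairZ.
set A := tpair B N x _; set C := tpair B N x _; set G := tpair B N x _.
(* [A] comes from d[x, x] and [C] from [x, d x]; exchanging the copies of [x] in one of the two [C]
   produces the third term of [cross_lap]. *)
have J1 : A + C + C = 0.
  rewrite {2}/C tpair_fubini -!tpairD.
  rewrite -(tpair0 B N x); apply: (eq_tpair_even _ _ ev) => q u u0.
  rewrite -!tpairD -(tpair0 B N x); apply: (eq_tpair_even _ _ ev) => q' u' u'0.
  rewrite [(q' + q)%N]addnC.
  exact: (cross_lap (eform_sym c_sym) (eform_odd c_odd) (sp _) u0 u'0).
have G2 : G = tpair B N x (fun q u => tpair B N x (fun q' u' => tpair B N x (fun q'' u'' =>
    cross epar eform u (cross epar eform u' (Psi (q' + (q + q'')).+2)) u''))).
  by rewrite /G tpair_fubini.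
have G3 : G = tpair B N x (fun q u => tpair B N x (fun q' u' => tpair B N x (fun q'' u'' =>
    cross epar eform u (cross epar eform u'' (Psi (q'' + (q + q')).+2)) u'))).
  by rewrite G2; apply: eq_tpair => q u; rewrite tpair_fubini.
(* [G] comes from [x, [x, x]]; its three forms [G], [G2] and [G3], with the copies of [x] permuted,
   give the terms of [cross_jacobi]. *)
have J2 : G + G + G = 0.
  rewrite {2}G2 {2}G3 /G -!tpairD -(tpair0 B N x); apply: (eq_tpair_even _ _ ev) => q u u0.
  rewrite -!tpairD -(tpair0 B N x); apply: (eq_tpair_even _ _ ev) => q' u' u'0.
  rewrite -!tpairD -(tpair0 B N x); apply: (eq_tpair_even _ _ ev) => q'' u'' u''0.
  have -> : (q' + (q + q''))%N = (q + (q' + q''))%N by rewrite addnCA.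
  have -> : (q'' + (q + q'))%N = (q + (q' + q''))%N by lia.
  exact: (cross_jacobi (eform_sym c_sym) (eform_odd c_odd) (sp _) u0 u'0 u''0).
lra.
Qed.

Lemma tpair_sbrC b B N f f' Psi : even_series f' ->
    bounded_test b Psi -> supersym_test Psi -> (b.+4 <= B)%N ->
  tpair B N (sgamma (sbr lp c f f')) Psi = tpair B N (sgamma (sbr lp c f' f)) Psi.
Proof.
move=> ev bd sp bB; rewrite !(tpair_sbr _ _ _ bd) //; congr (- _).
rewrite tpair_fubini; apply: (eq_tpair_even _ _ ev) => q u u0; apply: eq_tpair => q' u'.
rewrite [(q' + q)%N]addnC.
exact: (crossC (eform_sym c_sym) (eform_odd c_odd) _ (sp _) u0).
Qed.

End Pairing.

(** * Closed paths *)

Section Cycles.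

Variable I : finType.
Notation edge := (edge I).
Implicit Types (x y z e : edge) (u v w : seq edge) (ews : seq (seq edge)).

Definition src e : nat := e.1.2.
Definition tgt e : nat := e.2.
Definition closed_path u := cycle (fun x y => tgt x == src y) u.

Lemma src_inj es x y : uniq (map src es) -> x \in es -> y \in es ->
  src x = src y -> x = y.
Proof.
elim: es => //= z es IH /andP[zes ues]; rewrite !inE.
case/orP => [/eqP ->|xes]; case/orP => [/eqP ->|yes] // e.
- by case/negP: zes; rewrite e; apply: map_f.
- by case/negP: zes; rewrite -e; apply: map_f.
exact: IH.
Qed.

(** When sources are distinct, the target of an edge determines the next edge. Two closed paths from
    [x] therefore run in parallel, and neither can return to [x] before the other because [x] does
    not repeat. *)
Lemma closed_head es x p p' : uniq (map src es) ->
    {subset x :: p <= es} -> {subset x :: p' <= es} ->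
    uniq (x :: p) -> uniq (x :: p') -> closed_path (x :: p) -> closed_path (x :: p') ->
  p = p'.
Proof.
move=> ues ps p's /= /andP[xp _] /andP[xp' _]; rewrite /closed_path /=.
have det y z z' : z \in es -> z' \in es -> tgt y == src z -> tgt y == src z' -> z = z'.
  by move=> zs z's /eqP e1 /eqP e2; apply: src_inj ues zs z's _; rewrite -e1 -e2.
have xs : x \in es by apply: ps; rewrite mem_head.
have {}ps : {subset p <= es} by move=> y yp; apply: ps; rewrite inE yp orbT.
have {}p's : {subset p' <= es} by move=> y yp; apply: p's; rewrite inE yp orbT.
(* Only the running edge is generalized; both paths must still return to [x]. *)
move: {1 3}x => s.
elim: p p' s xp xp' ps p's => [|y p IH] [|y' p'] // s xp xp' ps p's /=.
- move=> /andP[sx _] /andP[sy' _].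
  have e : x = y' by apply: det sx sy'; rewrite // p's ?mem_head.
  by move: xp'; rewrite e mem_head.
- move=> /andP[sy _] /andP[sx _].
  have e : x = y by apply: det sx sy; rewrite // ps ?mem_head.
  by move: xp; rewrite e mem_head.
move=> /andP[sy yp] /andP[sy' yp'].
have e : y = y' by apply: det sy sy'; [apply: ps|apply: p's]; apply: mem_head.
rewrite -e in yp' *; congr (_ :: _); apply: IH yp yp'.
- by apply: contra xp => xp; rewrite inE xp orbT.
- by apply: contra xp' => xp'; rewrite inE xp' orbT.
- by move=> z zp; apply: ps; rewrite inE zp orbT.
- by move=> z zp; apply: p's; rewrite inE zp orbT.
Qed.

Lemma flatten_nil ews : flatten ews = [::] -> ews = nseq (count (@nilp _) ews) [::].
Proof.
elim: ews => // -[|a w] ews IH //= /IH e.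
by rewrite {1}e.
Qed.

(* [c] collects the edges of the closed paths already matched in the induction. *)
Lemma cycles_unique (c : seq edge) (Phi : seq (seq edge) -> rat) :
    (forall A u v B, uniq (map src (c ++ flatten (A ++ u :: v :: B))) ->
      Phi (A ++ u :: v :: B) = Phi (A ++ v :: u :: B)) ->
    (forall A u v B, uniq (map src (c ++ flatten (A ++ (u ++ v) :: B))) ->
      Phi (A ++ (u ++ v) :: B) = Phi (A ++ (v ++ u) :: B)) ->
  forall ews ews', all closed_path ews -> all closed_path ews' ->
    uniq (map src (c ++ flatten ews)) -> perm_eq (flatten ews) (flatten ews') ->
    count (@nilp _) ews = count (@nilp _) ews' -> Phi ews = Phi ews'.
Proof.
move=> Hs Hr ews; have [n] := ubnP (size ews).
elim: n => // n IH in c Phi Hs Hr ews * => sn ews' cl cl' ues pe ne.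
have [fn|] := eqVneq (flatten ews) [::].
  have fn' : flatten ews' = [::].
    by apply/nilP; rewrite /nilp -(perm_size pe) fn.
  by rewrite (flatten_nil fn) (flatten_nil fn') ne.
case fE : (flatten ews) => [//|x es] _.
(* Bring the path through [x] to the front and rotate it so that it starts at [x]. *)
have align k vs : all closed_path vs -> perm_eq (flatten ews) (flatten vs) -> (size vs < k)%N ->
    exists p R, [/\ Phi vs = Phi ((x :: p) :: R), closed_path (x :: p), all closed_path R,
      perm_eq (flatten vs) ((x :: p) ++ flatten R) &
      (size R < size vs)%N /\ count (@nilp _) R = count (@nilp _) vs].
  move=> clv pv _.
  have : x \in flatten vs by rewrite -(perm_mem pv) fE mem_head.
  case/flattenP => w + xw => /splitPr wvs; move: clv pv.
  case: wvs => A B clv pv.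
  have uv : uniq (map src (c ++ flatten (A ++ w :: B))).
    rewrite -(perm_uniq (s1 := map src (c ++ flatten ews))) //.
    by apply/perm_map; rewrite perm_cat2l.
  (* The path moves to the front by adjacent swaps, one for each path before it. *)
  have front A' C : perm_eq (flatten (A' ++ w :: C)) (flatten (A ++ w :: B)) ->
      Phi (A' ++ w :: C) = Phi (w :: A' ++ C).
    elim/last_ind: A' C => // A' z IHA C pAC.
    rewrite -cats1 -catA /= Hs; last first.
      rewrite (perm_uniq (s2 := map src (c ++ flatten (A ++ w :: B)))) //.
      apply/perm_map; rewrite perm_cat2l; apply: perm_trans pAC.
      by rewrite -cats1 -catA.
    rewrite IHA // -?catA //; apply: perm_trans pAC.
    by rewrite -cats1 -catA !(flatten_cat A') perm_cat2l /= perm_catCA.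
  case: (rot_to xw) => i p rp.
  exists p, (A ++ B); move: clv; rewrite all_cat /= => /and3P[clA clw clB].
  have pw : perm_eq (flatten (A ++ w :: B)) ((x :: p) ++ flatten (A ++ B)).
    rewrite !flatten_cat /= -cat_cons -rp perm_catCA perm_cat2r.
    by rewrite perm_sym perm_rot.
  split=> //.
  - rewrite front // -rp; have := Hr [::] (take i w) (drop i w) (A ++ B).
    rewrite /= cat_take_drop; apply.
    rewrite (perm_uniq (s2 := map src (c ++ flatten (A ++ w :: B)))) //.
    apply/perm_map; rewrite perm_cat2l perm_sym; apply: perm_trans pw _.
    by rewrite -rp /= perm_cat2r perm_rot.
  - by rewrite -[path _ _ _]/(closed_path (x :: p)) -rp /closed_path rot_cycle.
  - by rewrite all_cat clA.
  split; first by rewrite !size_cat /= addnS.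
  by rewrite !count_cat /=; case: (w) xw.
have [p [R [-> clp clR pR [sR cR]]]] := align _ _ cl (perm_refl _) (ltnSn _).
have [p' [R' [-> clp' clR' pR' [_ cR']]]] := align _ _ cl' pe (ltnSn _).
have ufl : uniq (map src (flatten ews)).
  by move: ues; rewrite map_cat cat_uniq => /and3P[].
have sub q T vs : perm_eq (flatten ews) (flatten vs) ->
    perm_eq (flatten vs) ((x :: q) ++ T) -> {subset x :: q <= flatten ews}.
  move=> pe1 pe2 y yq; rewrite (perm_mem pe1) (perm_mem pe2) mem_cat yq.
  by [].
have uq q T vs : perm_eq (flatten ews) (flatten vs) ->
    perm_eq (flatten vs) ((x :: q) ++ T) -> uniq (x :: q).
  move=> pe1 pe2; have := map_uniq ufl; rewrite (perm_uniq (perm_trans pe1 pe2)).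
  by rewrite cat_uniq => /and3P[].
have pp' : p = p'.
  apply: (closed_head ufl (sub _ _ _ (perm_refl _) pR) (sub _ _ _ pe pR')) => //.
    exact: uq (perm_refl _) pR.
  exact: uq pe pR'.
rewrite -pp' in pR' *.
(* The matched path joins the context [c], so the sources remain jointly distinct for the remaining
   paths. *)
apply: (IH (c ++ x :: p) (fun T => Phi ((x :: p) :: T))) => //.
- by move=> A u v B; rewrite -catA => H; apply: (Hs ((x :: p) :: A)).
- by move=> A u v B; rewrite -catA => H; apply: (Hr ((x :: p) :: A)).
- by apply: leq_trans sR _.
- rewrite -catA (perm_uniq (s2 := map src (c ++ flatten ews))) //.
  by apply/perm_map; rewrite perm_cat2l perm_sym.
- rewrite -(perm_cat2l (x :: p)); apply: perm_trans pR'.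
  by apply: perm_trans pe; rewrite perm_sym.
by rewrite cR cR'.
Qed.

End Cycles.

(** * Recovering cyclic words from edges with distinct sources *)

Section Decode.

Variables (I : finType) (lp : I -> bool).
Notation edge := (edge I).
Notation word := (seq I).
Local Notation wpl := (wpar lp).
Local Notation ep := (@epar I lp).
Local Notation wpe := (wp ep).
Implicit Types (x y z e : edge) (u v : seq edge) (w : word) (ews : seq (seq edge)).

(* The Koszul sign of sorting edges by their sources. *)
Fixpoint kosb u : bool :=
  if u is x :: u' then
    (ep x && odd (count (fun y => (src y < src x)%N && ep y) u')) (+) kosb u'
  else false.

(** On repeated sources sorting leaves a choice, and the sign would not be supersymmetric; hence the
    value 0. *)
Definition kappa u : rat := if uniq (map (@src I) u) then sg (kosb u) else 0.

Lemma kosb_swap u v x y : src x != src y ->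
  kosb (u ++ x :: y :: v) = (ep x && ep y) (+) kosb (u ++ y :: x :: v).
Proof.
move=> xy; elim: u => [|z u IH] /=.
  rewrite !oddD !oddb.
  case: (ltngtP (src x) (src y)) xy => // _ _;
  by case: (ep x); case: (ep y); case: (odd _); case: (odd _); case: (kosb v).
rewrite IH !count_cat /= [in LHS](addnCA (_ && ep x)).
by rewrite addbCA.
Qed.

Lemma kappa_supersym : supersym ep kappa.
Proof.
move=> u v x y; rewrite /kappa.
have -> : uniq (map (@src I) (u ++ x :: y :: v)) = uniq (map (@src I) (u ++ y :: x :: v)).
  apply/perm_uniq/perm_map; rewrite perm_cat2l.
  by rewrite -[x :: y :: v]/([:: x] ++ [:: y] ++ v) perm_catCA.
case: ifP => [us|]; last by rewrite mulr0.
rewrite kosb_swap ?signr_addb //; move: us; rewrite map_cat cat_uniq /= inE.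
by case/and3P=> _ _ /andP[]; rewrite negb_or eq_sym => /andP[].
Qed.

Lemma kappa_sqr u : uniq (map (@src I) u) -> kappa u * kappa u = 1.
Proof. by move=> us; rewrite /kappa us -expr2 sqrr_sign. Qed.

(** The functionals dual to the quotient: those that vanish on the relations of [lie_null]. *)
Definition cyclic_invariant (phi : seq word -> rat) :=
  (forall A p q B, phi (A ++ p :: q :: B) =
     sg (wpl p && wpl q) * phi (A ++ q :: p :: B)) /\
  (forall A a p B, phi (A ++ (a :: p) :: B) =
     sg (lp a && wpl p) * phi (A ++ (rcons p a) :: B)).

Lemma cyclic_invariant_rot phi A p q B : cyclic_invariant phi ->
  phi (A ++ (p ++ q) :: B) = sg (wpl p && wpl q) * phi (A ++ (q ++ p) :: B).
Proof.
case=> _ Hr; elim: p q => [|a p IH] q; first by rewrite cats0 mul1r.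
rewrite cat_cons Hr -cats1 -catA IH !wpl_cat cats1 cat_rcons.
rewrite mulrA -signr_addb; congr (_ ^+ nat_of_bool _ * _).
by rewrite !wpl_cons /=; case: (lp a); case: (wpl p); case: (wpl q).
Qed.

Definition small l es := all (fun e => (src e < l)%N && (tgt e < l)%N) es.
Local Notation nils := (count (@nilp _)).

Definition good l n es ews :=
  [&& all (@closed_path I) ews, perm_eq (flatten ews) es, uniq (map (@src I) es),
      small l es & nils ews == n].

(* By cycles_unique the choice of [ews] does not matter when [phi] is invariant:
   the number [n] of empty words is the only part of [ews] not visible in [es]. *)
Definition decode l n (phi : seq word -> rat) es : rat :=
  match pselect (exists ews, good l n es ews) with
  | left H => kappa es * (kappa (flatten (sval (cid H))) * phi (map (@labels I) (sval (cid H))))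
  | right _ => 0
  end.

Lemma size_labels u : size (labels u) = size u.
Proof. exact: size_map. Qed.

Lemma labels_cat u v : labels (u ++ v) = labels u ++ labels v.
Proof. exact: map_cat. Qed.

(** Swapping two paths or rotating one changes [kappa] and [phi] by the same sign, so their product
    is invariant and [cycles_unique] applies. *)
Lemma decodeE l n phi es ews : cyclic_invariant phi -> good l n es ews ->
  decode l n phi es = kappa es * (kappa (flatten ews) * phi (map (@labels I) ews)).
Proof.
move=> inv gE; rewrite /decode; case: pselect => [H|[]]; last by exists ews.
case: (cid H) => ews' /= /and5P[cl' pe' ue' _ /eqP n'].
case/and5P: gE => cl pe _ _ /eqP nE; congr (_ * _).
apply: (@cycles_unique I [::] (fun vs => kappa (flatten vs) * phi (map (@labels I) vs))) => //=.
- move=> A u v B _; rewrite !flatten_cat /= !map_cat /= inv.1.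
  rewrite (supersym_swap _ _ _ _ kappa_supersym) !wp_labels.
  by rewrite mulrACA -expr2 sqrr_sign mul1r.
- move=> A u v B _; rewrite !flatten_cat /= !map_cat /= !labels_cat.
  rewrite (cyclic_invariant_rot _ _ _ _ inv) -!catA.
  rewrite (supersym_swap _ _ _ _ kappa_supersym) !wp_labels.
  by rewrite mulrACA -expr2 sqrr_sign mul1r.
- by rewrite (perm_uniq (s2 := map (@src I) es)) //; apply: perm_map.
- by rewrite (perm_trans pe') // perm_sym.
by rewrite n' nE.
Qed.

Lemma decode0 l n phi es : ~ (exists ews, good l n es ews) -> decode l n phi es = 0.
Proof. by rewrite /decode; case: pselect. Qed.

Lemma perm_swap u v x y : perm_eq (u ++ x :: y :: v) (u ++ y :: x :: v).
Proof.
by rewrite perm_cat2l -[x :: y :: v]/([:: x] ++ [:: y] ++ v) perm_catCA.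
Qed.

Lemma good_perm l n es es' ews : perm_eq es es' -> good l n es ews -> good l n es' ews.
Proof.
move=> pe /and5P[cl pf us sm nE]; rewrite /good cl nE (perm_trans pf pe) /=.
rewrite -(perm_uniq (perm_map (@src I) pe)) us /small -(eq_all_r (perm_mem pe)).
by rewrite andbT.
Qed.

Lemma decode_supersym l n phi : cyclic_invariant phi -> supersym ep (decode l n phi).
Proof.
move=> inv u v x y.
have [[ews gE]|nE] := pselect (exists ews, good l n (u ++ x :: y :: v) ews).
  rewrite (decodeE inv gE) (decodeE inv (good_perm (perm_swap u v x y) gE)).
  by rewrite (kappa_supersym u v x y) -mulrA.
rewrite !decode0 ?mulr0 // => -[ews gE]; apply: nE; exists ews.
by apply: good_perm gE; apply: perm_swap.
Qed.

Lemma decode_small l n phi es : ~~ small l es -> decode l n phi es = 0.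
Proof. by move=> sm; apply: decode0 => -[ews /and5P[_ _ _]]; rewrite (negbTE sm). Qed.

Section Paths.

Variable N : nat.

Lemma paths_path w s t u : u \in paths N w s t ->
  if u is x :: u' then
    [&& src x == s, path (fun x y => tgt x == src y) x u' & tgt (last x u') == t]
  else s == t.
Proof.
elim: w s u => [|a w IH] s u /=; first by case: eqP => // _; rewrite inE => /eqP ->.
case/allpairsPdep => r [v [_ /IH + ->]]; rewrite /= eqxx /=.
by case: v => [|y v] //= /and3P[/eqP <- -> ->]; rewrite eqxx.
Qed.

Lemma loops_closed_path w u : u \in loops N w -> closed_path u.
Proof.
case/allpairsPdep => s [v [_ /paths_path + ->]].
case: v => [|x v] //= /and3P[/eqP sx pv /eqP tv].
by rewrite /closed_path /= rcons_path pv /= tv sx.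
Qed.

Lemma paths_small w s t u : (s < N)%N -> u \in paths N w s t -> (t < N)%N -> small N u.
Proof.
elim: w s u => [|a w IH] s u sN /=; first by case: eqP => // _; rewrite inE => /eqP ->.
case/allpairsPdep => r [v [+ vp ->]] tN; rewrite mem_iota /= => rN.
by rewrite /src /tgt /= sN rN /=; exact: (IH _ _ rN vp tN).
Qed.

Lemma loops_small w u : u \in loops N w -> small N u.
Proof.
case/allpairsPdep => s [v [+ vp ->]]; rewrite mem_iota /= => sN.
exact: (paths_small sN vp sN).
Qed.

Lemma traces_struct ws es : es \in traces N ws -> exists ews,
  [/\ flatten ews = es, all (@closed_path I) ews, map (@labels I) ews = ws & small N es].
Proof.
elim: ws es => [|w ws IH] es /=; first by rewrite inE => /eqP ->; exists [::].
case/allpairsP => -[u m] [/= ul /IH[ews [fE cl <- sm]] ->].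
exists (u :: ews); rewrite /= fE (loops_closed_path ul) cl (loops_labels ul).
by split=> //; rewrite /small all_cat -/(small N u) (loops_small ul).
Qed.

End Paths.

Definition chi l es : rat := (uniq (map (@src I) es) && small l es)%:R.

Lemma nils_labels ews : nils (map (@labels I) ews) = nils ews.
Proof. by rewrite count_map; apply: eq_count => -[]. Qed.

(** On a monomial of the trace with distinct sources and nodes below [l], the two factors [kappa]
    coincide and square to 1, leaving [phi ws]. What remains is the count of such monomials. *)
Lemma trace_decode N l n phi ws : cyclic_invariant phi -> nils ws = n ->
  trace N (decode l n phi) ws = phi ws * trace N (chi l) ws.
Proof.
move=> inv nE; rewrite /trace mulr_sumr; apply: eq_big_seq => es.
case/traces_struct => ews [fE cl lE _]; rewrite /chi.
case: (boolP (_ && _)) => [/andP[us sm]|nus]; last first.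
  rewrite mulr0 decode0 // => -[vs /and5P[_ _ us sm _]].
  by case/negP: nus; rewrite us.
have gE : good l n es ews by rewrite /good cl fE perm_refl us sm -nE -lE nils_labels eqxx.
by rewrite (decodeE inv gE) fE mulrA (kappa_sqr us) mul1r lE mulr1.
Qed.

Section NodeCount.

Variables (l N : nat).
Hypothesis lN : (l <= N)%N.

Lemma sum_nodes (F : nat -> rat) : (forall r, (l <= r)%N -> F r = 0) ->
  \sum_(r <- iota 0 N) F r = \sum_(r <- iota 0 l) F r.
Proof.
move=> F0; rewrite -(subnKC lN) iotaD big_cat /=.
have -> : \sum_(r <- iota (0 + l) (N - l)) F r = 0; last exact: addr0.
by rewrite big_seq big1 // => r; rewrite mem_iota => /andP[rl _]; apply: F0.
Qed.

Lemma sum_paths_small w s t (F : seq edge -> rat) :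
    (forall u, ~~ small l u -> F u = 0) ->
  \sum_(u <- paths N w s t) F u = \sum_(u <- paths l w s t) F u.
Proof.
elim: w s F => [|a w IH] s F F0 //; rewrite !sum_paths_cons.
rewrite sum_nodes => [|r rl].
  apply: eq_bigr => r _; apply: IH => u ul; apply: F0.
  by rewrite /small /= negb_and ul orbT.
rewrite big1 // => u _; apply: F0.
by rewrite /small /= /tgt /= [(r < l)%N]ltnNge rl andbF.
Qed.

Lemma sum_loops_small a w (F : seq edge -> rat) :
    (forall u, ~~ small l u -> F u = 0) ->
  \sum_(u <- loops N (a :: w)) F u = \sum_(u <- loops l (a :: w)) F u.
Proof.
move=> F0; rewrite !sum_loops sum_nodes => [|s sl].
  by apply: eq_bigr => s _; apply: sum_paths_small.
rewrite sum_paths_small // sum_paths_cons big1 // => r _; rewrite big1 // => u _.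
by apply: F0; rewrite /small /= /src /= ltnNge sl.
Qed.

(** A nonempty word only sees the nodes below [l], whereas each empty word contributes the full
    factor N instead of l. The powers are cross-multiplied to avoid a division. *)
Lemma trace_small ws psi : (forall u, ~~ small l u -> psi u = 0) ->
  l%:R ^+ nils ws * trace N psi ws = N%:R ^+ nils ws * trace l psi ws.
Proof.
elim: ws psi => [|w ws IH] psi psi0; first by rewrite /trace !big_seq1.
have psi0c u v : ~~ small l v -> psi (u ++ v) = 0.
  by move=> vl; apply: psi0; rewrite /small all_cat negb_and vl orbT.
case: w => [|a w]; last first.
  rewrite !trace_cons /= add0n mulr_sumr mulr_sumr.
  rewrite sum_loops_small; last first.
    move=> u ul; rewrite /trace big1 ?mulr0 // => v _.
    by rewrite psi0 // /small all_cat negb_and ul.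
  by apply: eq_bigr => u _; apply: IH; apply: psi0c.
have triv M : trace M psi ([::] :: ws) = M%:R * trace M psi ws.
  rewrite trace_cons sum_loops /=.
  transitivity (\sum_(s <- iota 0 M) trace M psi ws).
    by apply: eq_bigr => s _; rewrite eqxx big_seq1.
  by rewrite big_const_seq count_predT size_iota iter_addr_0 mulr_natl.
rewrite !triv /= add1n !exprS.
have H := IH psi psi0.
transitivity (l%:R * N%:R * (l%:R ^+ nils ws * trace N psi ws)); first by ring.
by rewrite H; ring.
Qed.

End NodeCount.

End Decode.

(** * Series on which all tests vanish *)

Section Separation.

(** Finite-dimensional duality: if [a] is not in the row span of [r], some column of the cokernel
    matrix annihilates the rows and detects [a]. *)
Lemma matrix_separation (J K : finType) (r : J -> K -> rat) (a : K -> rat) :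
  (exists D : J -> rat, forall k, a k = \sum_j D j * r j k) \/
  (exists2 phi : K -> rat, (forall j, \sum_k r j k * phi k = 0) &
     \sum_k a k * phi k != 0).
Proof.
pose U := \matrix_(i < #|J|, j < #|K|) r (enum_val i) (enum_val j).
pose v := \row_(j < #|K|) a (enum_val j).
have [/submxP[D vE]|] := boolP (v <= U)%MS.
  left; exists (fun j => D 0 (enum_rank j)) => k.
  have := congr1 (fun M : 'rV_#|K| => M 0 (enum_rank k)) vE.
  rewrite !mxE enum_rankK => ->; rewrite (reindex (@enum_val J J)) /=; last first.
    by exists enum_rank => j _; rewrite ?enum_valK ?enum_rankK.
  by apply: eq_bigr => j _; rewrite !mxE enum_valK enum_rankK.
rewrite submxE => /eqP /rowP ne; right.
have [k vk] : exists k, (v *m cokermx U) 0 k != 0.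
  by apply/existsP; rewrite -negb_forall; apply/negP => /forallP H;
     apply: ne => k; rewrite (eqP (H k)) mxE.
have sumK (F : K -> rat) : \sum_k F k = \sum_(i < #|K|) F (enum_val i).
  rewrite (reindex (@enum_val K K)) //.
  by exists enum_rank => j _; rewrite ?enum_valK ?enum_rankK.
exists (fun k' => cokermx U (enum_rank k') k) => [j|].
  have := congr1 (fun M : 'M_(_, _) => M (enum_rank j) k) (mulmx_coker U).
  rewrite !mxE sumK => H; rewrite -[RHS]H; apply: eq_bigr => i _.
  by rewrite !mxE enum_rankK enum_valK.
move: vk; rewrite mxE sumK; apply: contra => /eqP H; apply/eqP; rewrite -[RHS]H.
by apply: eq_bigr => i _; rewrite mxE enum_valK.
Qed.

Lemma poly_eq0_nat (p : {poly rat}) l :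
  (forall N, (l <= N)%N -> p.[N%:R] = 0) -> p = 0.
Proof.
move=> H; apply/eqP; apply: contraT => p0.
pose rs := [seq (l + i)%:R : rat | i <- iota 0 (size p)].
have := @max_poly_roots _ p rs p0; rewrite size_map size_iota ltnn => -> //.
  by apply/allP => x /mapP[i _ ->]; rewrite /root H // leq_addr.
rewrite map_inj_uniq ?iota_uniq // => i j /eqP.
by rewrite eqr_nat eqn_add2l => /eqP.
Qed.

(** The hypothesis gives infinitely many zeros of one polynomial in N, and the conclusion is the
    vanishing of its coefficient of degree n. *)
Lemma power_separation (J : Type) (L : seq J) (a : J -> rat) (e : J -> nat) l :
    (forall N, (l <= N)%N -> \sum_(j <- L) a j * N%:R ^+ e j = 0) ->
  forall n, \sum_(j <- L | e j == n) a j = 0.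
Proof.
move=> H n; pose p : {poly rat} := \sum_(j <- L) a j *: 'X^(e j).
have p0 : p = 0.
  apply: (@poly_eq0_nat _ l) => N lN; rewrite -[RHS](H N lN) horner_sum.
  by apply: eq_bigr => j _; rewrite hornerZ hornerXn.
have := congr1 (fun q : {poly rat} => q`_n) p0; rewrite coef0 coef_sum => H0.
rewrite -[RHS]H0 big_mkcond; apply: eq_bigr => j _; rewrite coefZ coefXn eq_sym.
by case: eqP => _; rewrite ?mulr1 ?mulr0.
Qed.

End Separation.

(** * Existence and number of closed paths with distinct sources *)

Section Positivity.

Variable I : finType.
Notation word := (seq I).

(** Number the nodes consecutively from [o] and let the last edge end at [t]. *)
Lemma exists_path N (a : I) (w : word) o t : (o + size (a :: w) <= N)%N -> (t < N)%N ->
  exists2 u, u \in paths N (a :: w) o t & map (@src I) u = iota o (size (a :: w)).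
Proof.
elim: w a o => [|b w IH] a o oN tN.
  exists [:: (a, o, t)] => //=; apply/allpairsPdep; exists t, [::].
  by rewrite mem_iota /= tN eqxx inE.
have [|u ul us] := IH b o.+1 _ tN; first by move: oN => /=; lia.
exists ((a, o, o.+1) :: u); last by rewrite /= us.
rewrite [paths _ _ _ _]/=; apply/allpairsPdep; exists o.+1, u; split=> //.
by rewrite mem_iota /=; move: oN => /=; lia.
Qed.

Lemma exists_trace N (ws : seq word) o : (0 < N)%N ->
    (o + size (flatten ws) <= N)%N ->
  exists2 u, u \in traces N ws & map (@src I) u = iota o (size (flatten ws)).
Proof.
move=> N0; elim: ws o => [|w ws IH] o oN; first by exists [::].
move: oN; rewrite size_flatten_cons => oN.
have [|m ml ms] := IH (o + size w)%N; first by lia.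
have [u ul us] : exists2 u, u \in loops N w & map (@src I) u = iota o (size w).
  case: w oN ms => [|a w] oN ms.
    exists [::] => //; apply/allpairsPdep; exists 0%N, [::].
    by rewrite mem_iota N0 /= inE.
  have [||u ul us] := @exists_path N a w o o; try by move: oN; rewrite /=; lia.
  exists u => //; apply/allpairsPdep; exists o, u; split=> //.
  by rewrite mem_iota; move: oN; rewrite /=; lia.
exists (u ++ m); last by rewrite map_cat us ms iotaD.
by apply/allpairsP; exists (u, m).
Qed.

(** With as many nodes as letters every edge can have a source of its own. Positivity permits
    division by this count in [pairing_invariant]. *)
Lemma trace_chi_gt0 l (ws : seq word) : (0 < l)%N -> size (flatten ws) = l ->
  0 < trace l (@chi I l) ws.
Proof.
move=> l0 lE; have [|u ul us] := @exists_trace l ws 0 l0; first by rewrite add0n lE.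
have chiu : chi l u = 1.
  rewrite /chi us iota_uniq; have [_ [_ _ _ ->]] := traces_struct ul.
  by [].
rewrite /trace (big_rem u) //= chiu; apply: ltr_wpDr; last exact: ltr01.
by apply: sumr_ge0 => v _; apply: ler0n.
Qed.

(** [chi] is symmetric without signs, so it is supersymmetric for the trivial parity; this lets the
    trace lemmas apply to it sign-free. *)
Lemma chi_sym l : supersym (@epar I (fun=> false)) (@chi I l).
Proof.
move=> u v x y; rewrite /= mul1r /chi; congr (_%:R); congr (nat_of_bool (_ && _)).
  by apply/perm_uniq/perm_map/perm_swap.
by apply/eq_all_r/perm_mem/perm_swap.
Qed.

Lemma trace_chi_swap l A p q B :
  trace l (@chi I l) (A ++ p :: q :: B) = trace l (@chi I l) (A ++ q :: p :: B).
Proof.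
have := @trace_catC I (fun=> false) l _ A [:: p] [:: q] B (@chi_sym l).
by rewrite /wpls /wpar !count_pred0 /= mul1r.
Qed.

Lemma trace_chi_rot l A p q B :
  trace l (@chi I l) (A ++ (p ++ q) :: B) = trace l (@chi I l) (A ++ (q ++ p) :: B).
Proof.
have := @trace_rot I (fun=> false) l _ A p q B (@chi_sym l).
by rewrite /wpar !count_pred0 /= mul1r.
Qed.

End Positivity.

(** * Invariant functionals are obtained from tests *)

Section Faithful.

Variables (I : finType) (lp : I -> bool).
Notation word := (seq I).
Notation mon := (mon I).
Notation series := (series I).
Local Notation wpl := (wpar lp).
Local Notation nils := (count (@nilp _)).

Variable f : series.
Hypothesis fT : forall b N Psi, bounded_test b Psi -> supersym_test lp Psi ->
  (forall q, Psi q [::] = 0) -> tpair b N f Psi = 0.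

Lemma pairing_invariant g0 k l phi : (0 < l)%N -> cyclic_invariant lp phi ->
    (forall ws, ws \notin words I k l -> phi ws = 0) ->
  \sum_(ws <- words I k l) f (g0, ws) * phi ws = 0.
Proof.
move=> l0 inv phi0.
(* Dividing by the count in [trace_decode] makes the decoded test return [phi]. There is one test
   for each number [n] of empty words, since edges do not show it. *)
pose phin n ws := if nils ws == n then phi ws / trace l (@chi I l) ws else 0.
have invn n : cyclic_invariant lp (phin n).
  split=> [A p q B|A a p B]; rewrite /phin !count_cat /=.
    rewrite [(nilp p + _)%N]addnCA trace_chi_swap inv.1.
    by case: eqP => _; rewrite ?mulr0 // mulrA.
  have -> : nilp (rcons p a) = false by case: (p).
  have := trace_chi_rot l A [:: a] p B; rewrite cats1 /= => ->; rewrite inv.2.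
  by case: eqP => _; rewrite ?mulr0 // mulrA.
pose Q := (2 * g0 + k)%N.
have step n : \sum_(ws <- words I k l | nils ws == n) f (g0, ws) * phi ws = 0.
  pose psi := decode lp l n (phin n).
  pose Psi q u := if (q == Q) && (size u == l) then psi u else 0.
  pose b := (Q + l).+1.
  have bd : bounded_test b Psi.
    move=> q u; rewrite /Psi; case: ifP => // /andP[/eqP -> /eqP ->].
    by rewrite /b; lia.
  have sp : supersym_test lp Psi.
    move=> q u v x y; rewrite /Psi !size_cat /=.
    case: ifP => _; last by rewrite mulr0.
    exact: (decode_supersym _ _ (invn n)).
  have Psi0 q : Psi q [::] = 0.
    by rewrite /Psi /=; case: ifP => // /andP[_ /eqP l0']; rewrite -l0' in l0.
  (* [H] is the part of the pairing independent of the matrix size; by [trace_small] the size enters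
     only through a power of N whose exponent is the number of empty words. *)
  pose H (m : mon) := (-1) ^+ m.1 * f m *
    ((2 * m.1 + size m.2 == Q) && (size (flatten m.2) == l))%N%:R *
    (l%:R ^- nils m.2 * trace l psi m.2).
  have TE N : (l <= N)%N ->
      \sum_(m <- mon_box I b) H m * N%:R ^+ nils m.2 = 0.
    move=> lN; rewrite -[RHS](fT N bd sp Psi0) /tpair /mpair; apply: eq_bigr => m _.
    rewrite -!mulrA; congr (_ * (_ * _)); rewrite /testmon.
    case: eqP => qE /=; last first.
      rewrite mul0r /trace big1 // => u _; rewrite /Psi; case: eqP => //=.
    have [lE|lE] := eqVneq (size (flatten m.2)) l; last first.
      rewrite mul0r /trace big_seq big1 // => u /traces_labels uE.
      by rewrite /Psi -size_labels uE (negbTE lE) andbF.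
    have l0r : (l%:R : rat) ^+ nils m.2 != 0.
      by rewrite expf_eq0 pnatr_eq0 (gtn_eqF l0) andbF.
    have -> : trace N (Psi (2 * m.1 + size m.2)%N) m.2 = trace N psi m.2.
      apply: eq_big_seq => u /traces_labels uE.
      by rewrite /Psi qE eqxx /= -size_labels uE lE eqxx.
    have := trace_small lN m.2 (@decode_small I lp l n (phin n)).
    rewrite -/psi => E; apply: (mulfI l0r); rewrite E mul1r.
    by rewrite mulVKf // mulrC.
  have := power_separation TE n.
  move=> S0.
  (* With [n] empty words [trace_decode] recovers [phi]; as [phi] lives on lists of [k] words, the
     index [Q] forces the exponent of gamma to be [g0]. *)
  have HE m : nils m.2 == n -> H m = (-1) ^+ g0 * l%:R ^- n *
      ((m.1 == g0)%:R * (m.2 \in words I k l)%:R * (f m * phi m.2)).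
    move=> /eqP nE; rewrite /H /psi trace_decode // /phin nE eqxx.
    have [mw|mw] := boolP (m.2 \in words I k l); last first.
      by rewrite phi0 // !(mul0r, mulr0).
    move: mw; rewrite mem_words => /andP[/eqP sk /eqP sl].
    rewrite sk sl eqxx andbT /Q eqn_add2r eqn_mul2l /=.
    have [->|] := eqVneq m.1 g0; last by rewrite !(mul0r, mulr0).
    have c0 : trace l (@chi I l) m.2 != 0 by apply/lt0r_neq0/trace_chi_gt0.
    by rewrite divfK //; ring.
  have: \sum_(m <- mon_box I b | nils m.2 == n)
      (m.1 == g0)%:R * (m.2 \in words I k l)%:R * (f m * phi m.2) = 0.
    apply: (mulfI (x := (-1) ^+ g0 * l%:R ^- n)).
      rewrite mulf_neq0 ?signr_eq0 // invr_eq0 expf_eq0 pnatr_eq0.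
      by rewrite (gtn_eqF l0) andbF.
    by rewrite mulr0 mulr_sumr -[RHS]S0; apply: eq_bigr => m nE; rewrite HE.
  move=> H0; rewrite -[RHS]H0 big_mkcond [RHS]big_mkcond.
  pose G (m : mon) := if nils m.2 == n then
      (m.1 == g0)%:R * (m.2 \in words I k l)%:R * (f m * phi m.2) else 0.
  transitivity (\sum_(m <- [seq (g0, ws) | ws <- words I k l]) G m).
    rewrite [RHS]big_map; apply: eq_big_seq => ws wsw.
    by rewrite /G /= eqxx wsw !mul1r.
  apply: sum_sub; rewrite ?mon_box_uniq //.
  - by rewrite map_inj_uniq ?words_uniq // => ? ? [].
  - move=> m /mapP[ws]; rewrite mem_words => /andP[/eqP sk /eqP sl] ->.
    by rewrite mem_mon_box /= sk sl /b /Q; lia.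
  move=> m mn; rewrite /G; case: ifP => // _.
  have [g0E|] := eqVneq m.1 g0; last by rewrite !mul0r.
  have [mw|] := boolP (m.2 \in words I k l); last by rewrite mulr0 mul0r.
  by case/mapP: mn; exists m.2 => //; rewrite -g0E; case: (m).
transitivity (\sum_(n < k.+1) \sum_(ws <- words I k l | nils ws == n) f (g0, ws) * phi ws).
  under [RHS]eq_bigr do rewrite big_mkcond.
  rewrite exchange_big; apply: eq_big_seq => ws; rewrite mem_words => /andP[/eqP sk _].
  have nk : (nils ws < k.+1)%N by rewrite ltnS -sk count_size.
  rewrite (bigD1 (Ordinal nk)) //= eqxx big1 ?addr0 // => i ne.
  by case: eqP => // e; case/negP: ne; apply/eqP/val_inj; rewrite /= e.
by rewrite big1.
Qed.

End Faithful.

(** * Swaps and rotations: null series are those on which all tests vanish *)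

Section Moves.

Variables (I : finType) (lp : I -> bool).
Notation word := (seq I).
Notation mon := (mon I).
Local Notation wpl := (wpar lp).

Lemma swap_wordsE (A : seq word) p q B :
  swap_words (size A) (A ++ p :: q :: B) = A ++ q :: p :: B.
Proof.
rewrite /swap_words take_size_cat // !nth_cat ltnn ltnNge leqnSn subnn subSnn /=.
have -> // : drop (size A).+2 (A ++ [:: p, q & B]) = B.
by rewrite -cat_rcons -cat_rcons drop_size_cat // !size_rcons.
Qed.

Lemma rot_wordE (A : seq word) p B :
  rot_word (size A) (A ++ p :: B) = A ++ rot 1 p :: B.
Proof.
rewrite /rot_word take_size_cat // nth_cat ltnn subnn /=.
have -> // : drop (size A).+1 (A ++ p :: B) = B.
by rewrite -cat_rcons drop_size_cat // size_rcons.
Qed.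

Lemma split_at2 p (ws : seq word) : (p.+1 < size ws)%N ->
  exists A x y B, size A = p /\ ws = A ++ x :: y :: B.
Proof.
move=> pw; exists (take p ws), (nth [::] ws p), (nth [::] ws p.+1), (drop p.+2 ws).
split; first by rewrite size_takel //; lia.
rewrite -{1}(cat_take_drop p ws) (drop_nth [::]) ?(drop_nth [::] pw) //.
exact: ltnW.
Qed.

Lemma split_at p (ws : seq word) : (p < size ws)%N ->
  exists A x B, size A = p /\ ws = A ++ x :: B.
Proof.
move=> pw; exists (take p ws), (nth [::] ws p), (drop p.+1 ws).
split; first by rewrite size_takel //; lia.
by rewrite -{1}(cat_take_drop p ws) (drop_nth [::] pw).
Qed.

Lemma rot_signE (w : word) : rot_sign lp w =
  if w is a :: p then sg (lp a && wpl p) else 1.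
Proof.
case: w => [|a p]; first by [].
rewrite /rot_sign.
have -> : rot 1 (iota 0 (size (a :: p))) = iota 1 (size p) ++ [:: 0%N].
  by rewrite /rot /= drop0 take0.
rewrite koszul_cat_gt; last by move=> x y; rewrite mem_iota inE => xp /eqP ->; lia.
rewrite koszul_iota count_nth_iota /=; last by [].
by rewrite drop0 take_size addn0 andbF andbC oddb.
Qed.

Lemma cyclic_invariant_rot_word phi p ws : cyclic_invariant lp phi -> (p < size ws)%N ->
  phi (rot_word p ws) = rot_sign lp (nth [::] ws p) * phi ws.
Proof.
move=> [_ inv] /split_at[A [w [B [<- ->]]]].
rewrite rot_wordE nth_cat ltnn subnn /= rot_signE.
case: w => [|a w]; first by rewrite mul1r.
by rewrite inv rot1_cons mulrA -expr2 sqrr_sign mul1r.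
Qed.

Lemma cyclic_invariant_swap phi p ws : cyclic_invariant lp phi -> (p.+1 < size ws)%N ->
  phi (swap_words p ws) =
  sg (wpl (nth [::] ws p) && wpl (nth [::] ws p.+1)) * phi ws.
Proof.
move=> [inv _] /split_at2[A [x [y [B [<- ->]]]]].
rewrite swap_wordsE !nth_cat ltnn ltnNge leqnSn subnn subSnn /= [in RHS]inv.
by rewrite mulrA -expr2 sqrr_sign mul1r.
Qed.

Lemma cyclic_invariantP phi :
    (forall p ws, (p.+1 < size ws)%N -> phi (swap_words p ws) =
       sg (wpl (nth [::] ws p) && wpl (nth [::] ws p.+1)) * phi ws) ->
    (forall p ws, (p < size ws)%N ->
       phi (rot_word p ws) = rot_sign lp (nth [::] ws p) * phi ws) ->
  cyclic_invariant lp phi.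
Proof.
move=> Hs Hr; split=> [A p q B|A a p B].
  rewrite -(swap_wordsE A q p B) Hs; last by rewrite size_cat /=; lia.
  by rewrite !nth_cat ltnn ltnNge leqnSn subnn subSnn /= andbC.
have := Hr (size A) (A ++ (a :: p) :: B).
rewrite rot_wordE rot1_cons nth_cat ltnn subnn /= rot_signE => ->.
  by rewrite mulrA -expr2 sqrr_sign mul1r.
by rewrite size_cat /=; lia.
Qed.

Lemma size_swap_words p (ws : seq word) : (p.+1 < size ws)%N ->
  size (swap_words p ws) = size ws.
Proof.
move=> /split_at2[A [x [y [B [<- ->]]]]].
by rewrite swap_wordsE !size_cat.
Qed.

Lemma size_rot_word p (ws : seq word) : (p < size ws)%N ->
  size (rot_word p ws) = size ws.
Proof.
by move=> /split_at[A [x [B [<- ->]]]]; rewrite rot_wordE !size_cat.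
Qed.

Lemma perm_swap_words p (ws : seq word) : (p.+1 < size ws)%N ->
  perm_eq (flatten (swap_words p ws)) (flatten ws).
Proof.
move=> /split_at2[A [x [y [B [<- ->]]]]].
by rewrite swap_wordsE !flatten_cat perm_cat2l /= perm_catCA.
Qed.

Lemma perm_rot_word p (ws : seq word) : (p < size ws)%N ->
  perm_eq (flatten (rot_word p ws)) (flatten ws).
Proof.
move=> /split_at[A [x [B [<- ->]]]].
by rewrite rot_wordE !flatten_cat perm_cat2l /= perm_cat2r perm_rot.
Qed.

Lemma swap_words_inj p (ws ws' : seq word) : (p.+1 < size ws)%N -> (p.+1 < size ws')%N ->
  swap_words p ws = swap_words p ws' -> ws = ws'.
Proof.
move=> /split_at2[A [x [y [B [Ap ->]]]]] /split_at2[A' [x' [y' [B' [A'p ->]]]]].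
rewrite -{1}Ap -A'p !swap_wordsE => /eqP; rewrite eqseq_cat ?Ap ?A'p //.
by case/andP => /eqP -> /eqP[-> -> ->].
Qed.

Lemma rot_word_inj p (ws ws' : seq word) : (p < size ws)%N -> (p < size ws')%N ->
  rot_word p ws = rot_word p ws' -> ws = ws'.
Proof.
move=> /split_at[A [x [B [Ap ->]]]] /split_at[A' [x' [B' [A'p ->]]]].
rewrite -{1}Ap -A'p !rot_wordE => /eqP; rewrite eqseq_cat ?Ap ?A'p //.
by case/andP => /eqP -> /eqP[/rot_inj -> ->].
Qed.

(** An injective map of a finite set to itself is a permutation. *)
Lemma sum_reindex (J : eqType) (L : seq J) (P : pred J) (h : J -> J) (G : J -> rat) :
    uniq L -> (forall x, x \in L -> P x -> (h x \in L) && P (h x)) ->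
    (forall x y, P x -> P y -> h x = h y -> x = y) ->
  \sum_(x <- L | P x) G (h x) = \sum_(x <- L | P x) G x.
Proof.
move=> uL hL hi; rewrite -!(big_filter L) -(big_map h xpredT G); apply: perm_big.
have uf : uniq (filter P L) by apply: filter_uniq.
have um : uniq (map h (filter P L)).
  rewrite map_inj_in_uniq // => x y; rewrite !mem_filter => /andP[Px _] /andP[Py _].
  exact: hi.
have sub : {subset map h (filter P L) <= filter P L}.
  move=> y /mapP[x]; rewrite !mem_filter => /andP[Px xL] ->.
  by have /andP[-> ->] := hL x xL Px.
by apply: uniq_perm => //; apply: (uniq_min_size um sub _).2; rewrite size_map.
Qed.

(** A test changes under a move by the sign occurring in the corresponding relation, so the two
    terms of a relation cancel after reindexing the monomials by that move. *)
Lemma test_lie_null B N f Psi : f \in lie_null lp -> supersym_test lp Psi ->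
  (forall q, Psi q [::] = 0) -> tpair B N f Psi = 0.
Proof.
move=> /asboolP[u [v fE]] sp Psi0.
pose Phi := testmon N Psi.
have inv g k : cyclic_invariant lp (fun ws => trace N (Psi (2 * g + k)%N) ws).
  split=> [A p q C|A a p C].
    have := @trace_catC I lp N _ A [:: p] [:: q] C (sp (2 * g + k)%N).
    by rewrite /wpls /= !cats0.
  have := @trace_rot I lp N _ A [:: a] p C (sp (2 * g + k)%N).
  by rewrite /= cats1 /wpar /= addn0 oddb.
have Phi_swap g p ws : (p.+1 < size ws)%N -> Phi (g, swap_words p ws) =
    sg (wpl (nth [::] ws p) && wpl (nth [::] ws p.+1)) * Phi (g, ws).
  move=> pw; rewrite /Phi /testmon /= size_swap_words //.
  exact: (cyclic_invariant_swap (inv g (size ws)) pw).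
have Phi_rot g p ws : (p < size ws)%N -> Phi (g, rot_word p ws) =
    rot_sign lp (nth [::] ws p) * Phi (g, ws).
  move=> pw; rewrite /Phi /testmon /= size_rot_word //.
  exact: (cyclic_invariant_rot_word (inv g (size ws)) pw).
have Phi0 m : flatten m.2 = [::] -> Phi m = 0.
  move=> fl0; rewrite /Phi /testmon /trace big_seq big1 //= => w.
  by move=> /traces_labels; rewrite fl0; case: w => // _; apply: Psi0.
rewrite /tpair -/Phi /mpair; clearbody Phi.
(* The position [p] is given a range independent of [m], so that the two sums can be exchanged. *)
transitivity (\sum_(m <- mon_box I B)
   (\sum_(p < B | (p < (size m.2).-1)%N) ((-1) ^+ m.1 * Phi m * u p m
      - (-1) ^+ m.1 * Phi (m.1, swap_words p m.2) * u p (m.1, swap_words p m.2))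
  + \sum_(p < B | (p < size m.2)%N) ((-1) ^+ m.1 * Phi m * v p m
      - (-1) ^+ m.1 * Phi (m.1, rot_word p m.2) * v p (m.1, rot_word p m.2)))).
  apply: eq_big_seq => m; rewrite mem_mon_box => /and3P[_ sB _].
  rewrite -(big_ord_widen B (fun p => (-1) ^+ m.1 * Phi m * u p m
      - (-1) ^+ m.1 * Phi (m.1, swap_words p m.2) * u p (m.1, swap_words p m.2)));
    last exact: leq_trans (leq_pred _) (ltnW sB).
  rewrite -(big_ord_widen B (fun p => (-1) ^+ m.1 * Phi m * v p m
      - (-1) ^+ m.1 * Phi (m.1, rot_word p m.2) * v p (m.1, rot_word p m.2)));
    last exact: ltnW.
  (* On monomials in gamma and nu alone [lie_null] imposes no condition on [f], but there the tests
     vanish. *)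
  have [hm|nhm] := boolP (has (fun w => w != [::]) m.2); last first.
    have fl : flatten m.2 = [::].
      by elim: (m.2) nhm => //= w ws IH; rewrite negb_or negbK => /andP[/eqP -> /IH].
    have P0 ws : perm_eq (flatten ws) (flatten m.2) -> Phi (m.1, ws) = 0.
      by rewrite fl => /perm_nilP /(Phi0 (m.1, ws)).
    have Pm : Phi m = 0 by rewrite -(P0 m.2) //; case: (m).
    rewrite Pm mulr0 !big1 ?addr0 // => p _.
      by rewrite P0 ?(mulr0, mul0r) ?subr0 //; apply: perm_rot_word.
    rewrite P0 ?(mulr0, mul0r) ?subr0 //; apply: perm_swap_words.
    by rewrite -ltn_predRL ltn_ord.
  rewrite fE // mulrDr mulrDl !mulr_sumr !mulr_suml; congr (_ + _).
    apply: eq_bigr => p _; rewrite Phi_swap; last by rewrite -ltn_predRL ltn_ord.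
    have -> : Phi (m.1, m.2) = Phi m by case: (m).
    ring.
  apply: eq_bigr => p _; rewrite Phi_rot //.
  have -> : Phi (m.1, m.2) = Phi m by case: (m).
  ring.
rewrite big_split /=.
rewrite (exchange_big_dep xpredT) //= [X in _ + X](exchange_big_dep xpredT) //=.
rewrite !big1 ?addr0 // => p _; rewrite big_split /= sumrN; apply/eqP; rewrite subr_eq0;
  apply/eqP/esym.
  apply: (@sum_reindex _ _ (fun m : mon => p < size m.2)%N
    (fun m => (m.1, rot_word p m.2)) (fun m => (-1) ^+ m.1 * Phi m * v p m)).
  - exact: mon_box_uniq.
  - move=> [g ws] /=; rewrite !mem_mon_box /= => mB pw.
    by rewrite size_rot_word // (perm_size (perm_rot_word pw)) mB.
  by move=> [g ws] [g' ws'] /= pw pw' [-> /(rot_word_inj pw pw') ->].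
apply: (@sum_reindex _ _ (fun m : mon => p < (size m.2).-1)%N
  (fun m => (m.1, swap_words p m.2)) (fun m => (-1) ^+ m.1 * Phi m * u p m)).
- exact: mon_box_uniq.
- move=> [g ws] /=; rewrite !mem_mon_box /= => mB pw.
  have pw' : (p.+1 < size ws)%N by rewrite -ltn_predRL.
  by rewrite size_swap_words // (perm_size (perm_swap_words pw')) mB.
move=> [g ws] [g' ws'] /= pw pw' [-> H]; congr (_, _).
by apply: swap_words_inj H; rewrite -ltn_predRL.
Qed.

Section NullFromTests.

Variable f : series I.
Hypothesis fT : forall b N Psi, bounded_test b Psi -> supersym_test lp Psi ->
  (forall q, Psi q [::] = 0) -> tpair b N f Psi = 0.

(** In a fixed degree the relations span a finite-dimensional space. If [f] were outside it,
    [matrix_separation] would give a functional that kills all relations, hence an invariant one,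
    yet does not kill [f]; this contradicts [pairing_invariant]. *)
Lemma null_words g k l : (0 < l)%N ->
  exists uv : (nat -> seq word -> rat) * (nat -> seq word -> rat),
    forall ws, ws \in words I k l -> f (g, ws) =
    \sum_(p < k.-1) (uv.1 p ws - sg (wpl (nth [::] ws p) && wpl (nth [::] ws p.+1))
      * uv.1 p (swap_words p ws))
    + \sum_(p < k) (uv.2 p ws - rot_sign lp (nth [::] ws p) * uv.2 p (rot_word p ws)).
Proof.
move=> l0; pose K := seq_sub (words I k l).
pose s p (ws : seq word) := sg (wpl (nth [::] ws p) && wpl (nth [::] ws p.+1)).
pose rs p (ws : seq word) := rot_sign lp (nth [::] ws p).
pose r (j : ('I_k.-1 + 'I_k) * K) (ws : K) : rat :=
  match j.1 with
  | inl p => (val ws == val j.2)%:R - s p (val ws) * (swap_words p (val ws) == val j.2)%:R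
  | inr p => (val ws == val j.2)%:R - rs p (val ws) * (rot_word p (val ws) == val j.2)%:R
  end.
have [[D fD]|[phi phi0 fphi]] := matrix_separation r (fun ws : K => f (g, val ws)).
  pose u (p : nat) (ws : seq word) := \sum_(j : 'I_k.-1 | j == p :> nat)
    \sum_(w : K) D (inl j, w) * (ws == val w)%:R.
  pose v (p : nat) (ws : seq word) := \sum_(j : 'I_k | j == p :> nat)
    \sum_(w : K) D (inr j, w) * (ws == val w)%:R.
  exists (u, v) => ws wsw.
  transitivity (\sum_(j : 'I_k.-1 + 'I_k) \sum_(w : K) D (j, w) * r (j, w) (SeqSub wsw)).
    by rewrite [LHS](fD (SeqSub wsw)) pair_bigA; apply: eq_bigr => -[].
  rewrite big_sumType /=; congr (_ + _); apply: eq_bigr => p _.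
    rewrite /u !(big_pred1 p) ?mulr_sumr -?sumrB; try by move=> j /=; rewrite val_eqE.
    by apply: eq_bigr => w _; rewrite /r /s /=; ring.
  rewrite /v !(big_pred1 p) ?mulr_sumr -?sumrB; try by move=> j /=; rewrite val_eqE.
  by apply: eq_bigr => w _; rewrite /r /rs /=; ring.
exfalso; pose phi' (ws : seq word) := \sum_(w : K) (ws == val w)%:R * phi w.
have phiK (w : K) : phi' (val w) = phi w.
  rewrite /phi' (bigD1 w) //= eqxx mul1r big1 ?addr0 // => w' ne.
  by rewrite eq_sym val_eqE (negbTE ne) mul0r.
have phi'0 ws : ws \notin words I k l -> phi' ws = 0.
  move=> wsn; rewrite /phi' big1 // => w _; case: eqP => [e|_]; last by rewrite mul0r.
  by case/negP: wsn; rewrite e; apply: ssvalP.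
(* Vanishing on the row of [h ws] is the invariance wanted: by injectivity [ws] is the only list
   that [h] takes to [h ws]. *)
have move_phi (h : seq word -> seq word) (t : seq word -> rat) :
    (forall ws, (h ws \in words I k l) = (ws \in words I k l)) ->
    {in words I k l &, injective h} ->
    (forall w : K, \sum_(ws : K) ((val ws == val w)%:R - t (val ws) *
       (h (val ws) == val w)%:R) * phi ws = 0) ->
    forall ws, phi' (h ws) = t ws * phi' ws.
  move=> hw hi H ws; have [wsw|wsn] := boolP (ws \in words I k l); last first.
    by rewrite !phi'0 ?hw // mulr0.
  have hwsw : h ws \in words I k l by rewrite hw.
  have := H (SeqSub hwsw).
  under eq_bigr do rewrite mulrBl.
  rewrite sumrB => /eqP; rewrite subr_eq0 => /eqP E.
  have -> : phi' (h ws) = \sum_(w : K) (val w == h ws)%:R * phi w.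
    by apply: eq_bigr => w _; rewrite eq_sym.
  rewrite E (bigD1 (SeqSub wsw)) //= eqxx mulr1 big1 ?addr0; last first.
    move=> w ne; rewrite (inj_in_eq hi) ?ssvalP //.
    by rewrite -[ws]/(val (SeqSub wsw)) val_eqE (negbTE ne) mulr0 mul0r.
  by rewrite -(phiK (SeqSub wsw)).
have inv : cyclic_invariant lp phi'.
  apply: cyclic_invariantP => p ws pw.
    have [sk|sk] := eqVneq (size ws) k; last first.
      rewrite !phi'0 ?mulr0 // mem_words ?size_swap_words // negb_and sk //.
    have pk : (p < k.-1)%N by rewrite ltn_predRL -sk.
    (* The move is extended by the identity to lists of other sizes, where [p] may be out of range;
       so [h] preserves membership in [words I k l] both ways. *)
    pose h (vs : seq word) := if size vs == k then swap_words p vs else vs.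
    have := @move_phi h (s p) _ _ _ ws; rewrite /h sk eqxx; apply.
    - move=> vs; case: eqP => // vk; have pv : (p.+1 < size vs)%N by rewrite vk -sk.
      by rewrite !mem_words size_swap_words // (perm_size (perm_swap_words pv)).
    - move=> vs vs'; rewrite !mem_words => /andP[vk _] /andP[v'k _]; rewrite vk v'k.
      by apply: swap_words_inj; rewrite ?(eqP vk) ?(eqP v'k) -ltn_predRL.
    move=> w; rewrite -[RHS](phi0 (inl (Ordinal pk), w)); apply: eq_bigr => vs _.
    by have := ssvalP vs; rewrite mem_words => /andP[-> _].
  have [sk|sk] := eqVneq (size ws) k; last first.
    rewrite !phi'0 ?mulr0 // mem_words ?size_rot_word // negb_and sk //.
  have pk : (p < k)%N by rewrite -sk.
  pose h (vs : seq word) := if size vs == k then rot_word p vs else vs.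
  have := @move_phi h (rs p) _ _ _ ws; rewrite /h sk eqxx; apply.
  - move=> vs; case: eqP => // vk; have pv : (p < size vs)%N by rewrite vk.
    by rewrite !mem_words size_rot_word // (perm_size (perm_rot_word pv)).
  - move=> vs vs'; rewrite !mem_words => /andP[vk _] /andP[v'k _]; rewrite vk v'k.
    by apply: rot_word_inj; rewrite ?(eqP vk) ?(eqP v'k).
  move=> w; rewrite -[RHS](phi0 (inr (Ordinal pk), w)); apply: eq_bigr => vs _.
  by have := ssvalP vs; rewrite mem_words => /andP[-> _].
case/negP: fphi; apply/eqP.
rewrite -[RHS](pairing_invariant fT g l0 inv phi'0).
transitivity (\sum_(ws <- words I k l) \sum_(w : K)
    (ws == val w)%:R * (f (g, ws) * phi w)).
  rewrite exchange_big; apply: eq_bigr => w _.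
  rewrite (sum_kronecker (val w) (fun ws => f (g, ws) * phi w)) ?words_uniq //.
  by rewrite ssvalP.
apply: eq_bigr => ws _; rewrite mulr_sumr; apply: eq_bigr => w _.
by rewrite mulrCA.
Qed.

Lemma lie_null_tests : f \in lie_null lp.
Proof.
have H (d : nat * nat * nat) : exists uv : (nat -> seq word -> rat) * (nat -> seq word -> rat),
    (0 < d.2)%N -> forall ws, ws \in words I d.1.2 d.2 -> f (d.1.1, ws) =
    \sum_(p < d.1.2.-1) (uv.1 p ws - sg (wpl (nth [::] ws p) && wpl (nth [::] ws p.+1))
      * uv.1 p (swap_words p ws))
    + \sum_(p < d.1.2) (uv.2 p ws - rot_sign lp (nth [::] ws p) * uv.2 p (rot_word p ws)).
  have [l0|l0] := posnP d.2; first by exists ((fun _ _ => 0), (fun _ _ => 0)); rewrite l0.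
  by have [uv uvE] := null_words d.1.1 d.1.2 l0; exists uv.
(* Moves preserve the exponent of gamma, the number of words and the total length, so the solutions
   chosen degree by degree glue to one pair of families. *)
have [F FE] := choice H.
apply/asboolP.
exists (fun p m => (F (m.1, size m.2, size (flatten m.2))).1 p m.2).
exists (fun p m => (F (m.1, size m.2, size (flatten m.2))).2 p m.2).
move=> [g ws] hm.
have l0 : (0 < size (flatten ws))%N.
  elim: ws hm => //= w ws IH; rewrite size_cat addn_gt0 => /orP[|/IH ->].
    by case: w.
  by rewrite orbT.
rewrite (FE (g, size ws, size (flatten ws)) l0) /=; last by rewrite mem_words !eqxx.
congr (_ + _); apply: eq_bigr => p _.
  have pw : (p.+1 < size ws)%N by rewrite -ltn_predRL.
  by rewrite size_swap_words // (perm_size (perm_swap_words pw)).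
by rewrite size_rot_word // (perm_size (perm_rot_word (ltn_ord p))).
Qed.

End NullFromTests.

End Moves.

Local Open Scope quotient_scope.

(** * The differential and the bracket *)

Section Lie.

Variables (I : finType) (lp : I -> bool) (c : I -> I -> rat).
Hypothesis c_sym : forall x y, c x y = c y x.
Hypothesis c_odd : forall x y, lp x = lp y -> c x y = 0.

Notation mon := (mon I).
Notation series := (series I).
Local Notation edge := (edge I).
Local Notation null := (lie_null lp).
Local Notation pi f := (\pi_(lie lp) f).
Local Notation lap := (lap (@epar I lp) (@eform I c)).
Local Notation cross := (cross (@epar I lp) (@eform I c)).
Implicit Types (f : series) (Psi : nat -> seq edge -> rat) (x y z : lie lp).

Definition test b Psi :=
  [/\ bounded_test b Psi, supersym_test lp Psi & forall q, Psi q [::] = 0].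

Lemma tpair_box b B N f Psi : bounded_test b Psi -> (b <= B)%N -> tpair B N f Psi = tpair b N f Psi.
Proof.
move=> bd bB; have tb := testmon_bounded N bd.
apply/esym/sum_sub; rewrite ?mon_box_uniq //.
  move=> m; rewrite !mem_mon_box => /and3P[h1 h2 h3].
  by rewrite !(leq_trans _ bB).
by move=> m; rewrite mem_mon_box => mb; rewrite tb ?mulr0.
Qed.

Lemma null_of_tests f :
    (forall b N Psi, test b Psi -> exists2 B, (b <= B)%N & tpair B N f Psi = 0) ->
  f \in null.
Proof.
move=> H; apply: lie_null_tests => b N Psi bd sp Psi0.
have [|B bB TB] := H b N Psi; first by split.
by rewrite -(tpair_box N f bd bB).
Qed.

(* tpair_sbr and tpair_bianchi compute gamma [f, f'] and gamma^2 times the Bianchi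
   expression; [unshift] compensates a factor of gamma, up to sign. *)
Definition unshift Psi q := if q is q'.+2 then Psi q' else fun=> 0.

Lemma unshift_test b Psi : test b Psi -> test b.+2 (unshift Psi).
Proof.
case=> bd sp Psi0; split=> [[|[|q]] u H|[|[|q]]|[|[|q]]] //=.
- by apply: bd; apply: contra H; lia.
- by move=> u v x y; rewrite mulr0.
- by move=> u v x y; rewrite mulr0.
Qed.

Lemma tpair_unshift b B N f Psi : test b Psi -> (b.+2 <= B)%N ->
  tpair B N f Psi = - tpair B N (sgamma f) (unshift Psi).
Proof.
by move=> tP bB; have [bd _ _] := unshift_test tP; rewrite (tpair_sgamma _ _ bd) // opprK.
Qed.

Lemma lap_test b Psi k : test b Psi -> test b.+2 (fun q => lap (Psi (q + k)%N)).
Proof.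
case=> bd sp Psi0; split=> [q u H|q|q] //=; last first.
  by apply: (lap_supersym (eform_sym c_sym) (eform_odd c_odd)).
rewrite (@eq_lap_size _ _ _ _ (fun=> 0)).
  exact: (linear_fun0 (@lap_linear _ _ _ u)).
by move=> m mE; apply: bd; apply: contra H; lia.
Qed.

Lemma cross_test b Psi u k : test b Psi -> test b.+2 (fun q => cross u (Psi (k + q).+1)).
Proof.
case=> bd sp Psi0; split=> [|q|q] //=.
- exact: cross_bounded.
- exact: (cross_supersym (eform_odd c_odd)).
exact: cross_nil.
Qed.

Lemma tpair_sbr_series b B N f f' Psi : test b Psi -> (b.+4.+2 <= B)%N ->
  tpair B N (sbr lp c f f') Psi =
  tpair B N f (fun q u => tpair B N f' (fun q' => cross u (unshift Psi (q + q').+1))).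
Proof.
move=> tP bB; rewrite (tpair_unshift _ _ tP); last by lia.
have [bd sp _] := unshift_test tP.
by rewrite (tpair_sbr c_odd _ _ _ bd sp) ?opprK.
Qed.

(** The margin 10 is what [bianchi] needs: two applications of [unshift] raise the bound by 4 and
    [tpair_bianchi] asks for 6 more. *)
Lemma pi_eq F F' :
    (forall b N Psi, test b Psi -> tpair (b + 10) N F Psi = tpair (b + 10) N F' Psi) ->
  pi F = pi F'.
Proof.
move=> H; apply/pi_lie_eq; apply: null_of_tests => b N Psi tP; exists (b + 10)%N; first by lia.
by rewrite tpairD_series tpairN_series H // subrr.
Qed.

Lemma tpair_repr B N f Psi : supersym_test lp Psi -> (forall q, Psi q [::] = 0) ->
  tpair B N (repr (pi f)) Psi = tpair B N f Psi.
Proof.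
move=> sp Psi0; apply/eqP; rewrite -subr_eq0 -tpairN_series -tpairD_series; apply/eqP.
apply: (test_lie_null _ _ _ sp Psi0).
by apply/pi_lie_eq; rewrite reprK.
Qed.

(** [sd] transposes to a contraction of the test, which is again a test; on tests the representative
    may be changed by [tpair_repr]. *)
Lemma lie_dE f : lie_d c (pi f) = pi (sd lp c f).
Proof.
apply: pi_eq => b N Psi tP; have [bd sp _] := tP.
rewrite !(tpair_sd c_odd _ _ bd sp); try by lia.
have [_ sp' Psi0] := lap_test 1 tP.
congr (- _); have E F : tpair (b + 10) N F (fun q => lap (Psi q.+1)) =
    tpair (b + 10) N F (fun q => lap (Psi (q + 1)%N)).
  by apply: eq_tpair => q u; rewrite addn1.
by rewrite !E tpair_repr.
Qed.

Lemma cross_supersym_left B N f b Psi : test b Psi ->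
  supersym_test lp (fun q u => tpair B N f (fun q' => cross u (Psi (q + q').+1))).
Proof.
move=> tP q u v x y; rewrite -tpairZ; apply: eq_tpair => q' u'.
have [_ sp _] := tP.
exact: (cross_supersyml (eform_sym c_sym) (eform_odd c_odd) u' (sp _)).
Qed.

(** The arguments are exchanged one at a time. With the other argument fixed, the contracted test is
    supersymmetric in either variable and vanishes on the empty list. *)
Lemma lie_brE f f' : lie_br c (pi f) (pi f') = pi (sbr lp c f f').
Proof.
apply: pi_eq => b N Psi tP; rewrite !(tpair_sbr_series _ _ _ tP); try by lia.
have tU := unshift_test tP.
rewrite tpair_repr; last by move=> q /=; rewrite tpair0.
  by apply: eq_tpair => q u; have [_ sp Psi0] := cross_test u q tU; rewrite tpair_repr.
exact: cross_supersym_left tU.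
Qed.

Lemma lie_dD x y : lie_d c (x + y) = lie_d c x + lie_d c y.
Proof.
have [f ->] := pi_lie_surj x; have [g ->] := pi_lie_surj y.
rewrite -pi_lieD !lie_dE -pi_lieD; apply: pi_eq => b N Psi [bd sp _].
by rewrite !(tpairD_series, tpair_sd c_odd _ _ bd sp) ?opprD; try lia.
Qed.

Lemma lie_brDl x y z : lie_br c (x + y) z = lie_br c x z + lie_br c y z.
Proof.
have [f ->] := pi_lie_surj x; have [g ->] := pi_lie_surj y; have [h ->] := pi_lie_surj z.
rewrite -pi_lieD !lie_brE -pi_lieD; apply: pi_eq => b N Psi tP.
by rewrite tpairD_series !(tpair_sbr_series _ _ _ tP) ?tpairD_series; try lia.
Qed.

Lemma lie_brDr x y z : lie_br c x (y + z) = lie_br c x y + lie_br c x z.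
Proof.
have [f ->] := pi_lie_surj x; have [g ->] := pi_lie_surj y; have [h ->] := pi_lie_surj z.
rewrite -pi_lieD !lie_brE -pi_lieD; apply: pi_eq => b N Psi tP.
rewrite tpairD_series !(tpair_sbr_series _ _ _ tP); try lia.
by rewrite -tpairD; apply: eq_tpair => q u; rewrite tpairD_series.
Qed.

Lemma lie_br0r x : lie_br c x 0 = 0.
Proof. by apply: (addrI (lie_br c x 0)); rewrite -lie_brDr !addr0. Qed.

Lemma lie_brNr x y : lie_br c x (- y) = - lie_br c x y.
Proof. by apply: (addrI (lie_br c x y)); rewrite -lie_brDr !subrr lie_br0r. Qed.

Definition restr (P : pred mon) f : series := fun m => if P m then f m else 0.

Lemma even_series_repr x : lie_even x -> exists2 f, x = pi f & even_series lp f.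
Proof. by case=> f -> fE; exists f => // m mo; apply: fE; rewrite mo. Qed.

Lemma lie_brC x y : lie_even y -> lie_br c x y = lie_br c y x.
Proof.
move=> /even_series_repr[g -> ev]; have [f ->] := pi_lie_surj x.
rewrite !lie_brE; apply: pi_eq => b N Psi tP; rewrite !(tpair_unshift _ _ tP); try lia.
have [bd sp _] := unshift_test tP.
by rewrite (tpair_sbrC c_sym c_odd _ _ ev bd sp); last by lia.
Qed.

Lemma pi_lieZ a f : pi (a *: f) = a *: (pi f : lie lp).
Proof. by rewrite -pi_lie_scale. Qed.

Lemma curvE f : curv c (pi f) = pi (scurv lp c f).
Proof. by rewrite /curv lie_dE lie_brE -pi_lieZ -pi_lieD. Qed.

Lemma bianchi x : lie_even x -> lie_d c (curv c x) + lie_br c x (curv c x) = 0.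
Proof.
move=> /even_series_repr[f -> ev]; rewrite curvE lie_dE lie_brE -pi_lieD.
have -> : (0 : lie lp) = pi 0 by rewrite (raddf0 \pi_(lie lp)).
apply: pi_eq => b N Psi tP.
have t2 := unshift_test tP; have [bd sp _] := unshift_test t2.
rewrite (tpair_unshift _ _ tP) ?(tpair_unshift _ _ t2); try lia.
rewrite (tpair_bianchi c_sym c_odd _ ev bd sp); last by lia.
rewrite !oppr0 /tpair /mpair big1 // => m _.
by rewrite mulr0 mul0r.
Qed.

(** * Gradings *)

(** The relations of [lie_null] connect monomials on which such a predicate agrees, so restriction
    to it descends to the quotient ([projE]). *)
Definition stable (P : pred mon) :=
  (forall g p ws, (p.+1 < size ws)%N -> P (g, swap_words p ws) = P (g, ws)) /\
  (forall g p ws, (p < size ws)%N -> P (g, rot_word p ws) = P (g, ws)).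

Lemma restr_null P f : stable P -> f \in null -> restr P f \in null.
Proof.
move=> [Ps Pr] /asboolP[u [v fE]]; apply/asboolP.
exists (fun p => restr P (u p)), (fun p => restr P (v p)) => -[g ws] hm.
rewrite /restr; case: ifP => Pm; last first.
  rewrite !big1 ?addr0 // => p _.
    by rewrite Pr ?Pm ?mulr0 ?subrr.
  by rewrite Ps -?ltn_predRL ?ltn_ord // Pm mulr0 subrr.
rewrite fE //; congr (_ + _); apply: eq_bigr => p _.
  by rewrite Ps -?ltn_predRL ?ltn_ord // Pm.
by rewrite Pr ?Pm.
Qed.

Definition proj P x : lie lp := pi (restr P (repr x)).

Lemma restrB P f g : restr P (f - g) = restr P f - restr P g.
Proof.
apply/funext => m; transitivity (restr P f m - restr P g m); last by [].
by rewrite /restr; case: ifP => // _; rewrite subrr.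
Qed.

Lemma restrD P f g : restr P (f + g) = restr P f + restr P g.
Proof.
apply/funext => m; transitivity (restr P f m + restr P g m); last by [].
by rewrite /restr; case: ifP => // _; rewrite addr0.
Qed.

Lemma projE P f : stable P -> proj P (pi f) = pi (restr P f).
Proof.
move=> sP; apply/pi_lie_eq; rewrite -restrB; apply: restr_null => //.
by apply/pi_lie_eq; rewrite reprK.
Qed.

Lemma projD P x y : stable P -> proj P (x + y) = proj P x + proj P y.
Proof.
move=> sP; have [f ->] := pi_lie_surj x; have [g ->] := pi_lie_surj y.
by rewrite -pi_lieD !projE // restrD pi_lieD.
Qed.

Lemma supported_proj P x : stable P -> supported P x -> proj P x = x.
Proof.
move=> sP [f -> fP]; rewrite projE //; congr (pi _); apply/funext => m.
by rewrite /restr; case: ifP => // /negbT /fP ->.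
Qed.

Lemma proj_supported P x : supported P (proj P x).
Proof.
by exists (restr P (repr x)) => // m mP; rewrite /restr (negbTE mP).
Qed.

Lemma supported_proj0 P Q x : stable P -> supported Q x -> (forall m, P m -> ~~ Q m) ->
  proj P x = 0.
Proof.
move=> sP [f -> fQ] PQ; rewrite projE // -(raddf0 \pi_(lie lp)); congr (pi _).
by apply/funext => m; rewrite /restr; case: ifP => // /PQ /fQ.
Qed.

Lemma proj_supp P Q x : stable P -> supported Q x -> supported Q (proj P x).
Proof.
move=> sP [f -> fQ]; rewrite projE //; exists (restr P f) => // m /fQ fm.
by rewrite /restr fm if_same.
Qed.

Lemma supportedD P x y : supported P x -> supported P y -> supported P (x + y).
Proof.
move=> [f -> fP] [g -> gP]; exists (f + g); first by rewrite pi_lieD.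
by move=> m mP; have -> : (f + g) m = f m + g m by []; rewrite fP // gP // addr0.
Qed.

Lemma supportedZ P a x : supported P x -> supported P (a *: x).
Proof.
move=> [f -> fP]; exists (a *: f); first by rewrite pi_lieZ.
by move=> m mP; have -> : (a *: f) m = a * f m by []; rewrite fP // mulr0.
Qed.

Lemma supportedN P x : supported P x -> supported P (- x).
Proof. by move=> /(supportedZ (-1)); rewrite scaleN1r. Qed.

Lemma supported0 P : supported P (0 : lie lp).
Proof. by exists 0 => //; rewrite (raddf0 \pi_(lie lp)). Qed.

Lemma supported_sub (P Q : pred mon) x : (forall m, P m -> Q m) -> supported P x -> supported Q x.
Proof.
by move=> PQ [f -> fP]; exists f => // m mQ; apply: fP; apply: contra mQ; apply: PQ.
Qed.

Lemma supported_sum P n (F : 'I_n -> lie lp) (Q : pred 'I_n) :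
  (forall i, Q i -> supported P (F i)) -> supported P (\sum_(i < n | Q i) F i).
Proof.
by move=> H; apply: (big_ind (supported P)); [apply: supported0|apply: supportedD|].
Qed.

(** Support asserts the existence of a good representative; this turns it into membership in [null],
    which tests decide. *)
Lemma supported_null P F : restr (predC P) F \in null -> supported P (pi F).
Proof.
move=> H; exists (restr P F); last by move=> m mP; rewrite /restr (negbTE mP).
apply/pi_lie_eq; have -> // : F - restr P F = restr (predC P) F.
apply/funext => m; transitivity (F m - restr P F m); first by [].
by rewrite /restr /=; case: (P m); rewrite ?subrr ?subr0.
Qed.

Definition order_pred (R : pred nat) : pred mon := fun m => R (mord m).

Lemma stable_ord R : stable (order_pred R).
Proof.
by split=> g p ws pw; rewrite /order_pred /mord /= ?size_swap_words ?size_rot_word.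
Qed.

Lemma mpar_perm g ws ws' : perm_eq (flatten ws) (flatten ws') ->
  mpar lp (g, ws) = mpar lp (g, ws').
Proof. by move=> pw; rewrite /mpar /=; congr odd; apply/permP. Qed.

Definition par_pred (a : bool) : pred mon := fun m => mpar lp m == a.

Lemma stable_par a : stable (par_pred a).
Proof.
split=> g p ws pw; rewrite /par_pred; congr (_ == _); apply: mpar_perm.
  exact: perm_swap_words.
exact: perm_rot_word.
Qed.

Lemma tpair_restr_ord B N R f Psi :
  tpair B N (restr (order_pred R) f) Psi =
  tpair B N f (fun q u => if R q.-1 then Psi q u else 0).
Proof.
apply: eq_bigr => m _; rewrite /restr /order_pred /testmon /mord.
case: (R _); first by [].
by rewrite mulr0 mul0r /trace big1 ?mulr0.
Qed.

Lemma tpair_restr_par B N a f Psi :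
  tpair B N (restr (par_pred a) f) Psi =
  tpair B N f (fun q u => if wp (@epar I lp) u == a then Psi q u else 0).
Proof.
apply: eq_bigr => m _; rewrite /restr /par_pred /testmon.
have E u : u \in traces N m.2 -> wp (@epar I lp) u = mpar lp m.
  by move=> /(traces_wp lp) ->.
case: ifP => mp.
  by congr (_ * _); apply: eq_big_seq => u /E ->; rewrite mp.
rewrite mulr0 mul0r [trace _ _ _]big_seq big1 ?mulr0 // => u /E ->.
by rewrite mp.
Qed.

(** [q.-1] is not the order at index 0. That index arises only from the monomial without gamma and
    words, whose trace is the empty list of edges; the premise on [u] lets callers discard it. *)
Lemma eq_tpair_ord B N R f F G : (forall m, ~~ order_pred R m -> f m = 0) ->
    (forall q u, (q = 0%N -> u = [::]) -> R q.-1 -> F q u = G q u) ->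
  tpair B N f F = tpair B N f G.
Proof.
move=> fR FG; apply: eq_bigr => m _.
have [Rm|/fR ->] := boolP (order_pred R m); last by rewrite mulr0 !mul0r.
congr (_ * _); apply: eq_big_seq => u um; apply: FG => // /eqP.
rewrite addn_eq0 => /andP[_ /eqP/size0nil m0].
by move: um; rewrite m0 inE => /eqP.
Qed.

Lemma eq_tpair_par B N a f F G : (forall m, ~~ par_pred a m -> f m = 0) ->
    (forall q u, wp (@epar I lp) u = a -> F q u = G q u) ->
  tpair B N f F = tpair B N f G.
Proof.
move=> fR FG; apply: eq_bigr => m _.
have [Rm|/fR ->] := boolP (par_pred a m); last by rewrite mulr0 !mul0r.
congr (_ * _); apply: eq_big_seq => u /(traces_wp lp) uE; apply: FG.
by rewrite uE; apply/eqP.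
Qed.

Lemma restr_test_ord R b Psi : test b Psi ->
  test b (fun q u => if R q.-1 then Psi q u else 0).
Proof.
case=> bd sp Psi0; split=> [q u H|q u v x y|q]; last by rewrite Psi0 if_same.
  by rewrite bd // if_same.
by case: ifP => _; rewrite ?mulr0 // sp.
Qed.

Lemma restr_test_par a b Psi : test b Psi ->
  test b (fun q u => if wp (@epar I lp) u == a then Psi q u else 0).
Proof.
case=> bd sp Psi0; split=> [q u H|q u v x y|q]; last by rewrite Psi0 if_same.
  by rewrite bd // if_same.
have -> : wp (@epar I lp) (u ++ x :: y :: v) = wp (@epar I lp) (u ++ y :: x :: v).
  by congr odd; apply/permP/perm_swap.
by case: ifP => _; rewrite ?mulr0 // sp.
Qed.

Lemma lie_d_ord (R R' : pred nat) x : (forall k, R k -> R' k.+1) ->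
  supported (order_pred R) x -> supported (order_pred R') (lie_d c x).
Proof.
move=> RR [f -> fR]; rewrite lie_dE; apply: supported_null.
apply: null_of_tests => b N Psi tP; exists b.+2; first by lia.
rewrite (tpair_restr_ord b.+2 N (predC R')).
have [bd sp _] := restr_test_ord (predC R') tP.
rewrite (tpair_sd c_odd _ _ bd sp) // -[RHS]oppr0; congr (- _); rewrite -[RHS](tpair0 b.+2 N f).
apply: (eq_tpair_ord _ _ fR) => -[|q] u u0 Rq /=; first by rewrite u0.
rewrite RR //=; exact: (linear_fun0 (@lap_linear _ _ _ u)).
Qed.

Lemma lie_br_ord (R R' R2 : pred nat) x y : (forall j k, R j -> R' k -> R2 (j + k)%N) ->
  supported (order_pred R) x -> supported (order_pred R') y ->
  supported (order_pred R2) (lie_br c x y).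
Proof.
move=> RR [f -> fR] [f' -> fR']; rewrite lie_brE; apply: supported_null.
apply: null_of_tests => b N Psi tP; exists b.+4.+2; first by lia.
rewrite (tpair_restr_ord b.+4.+2 N (predC R2)).
rewrite (tpair_sbr_series _ _ _ (restr_test_ord (predC R2) tP)) // -[RHS](tpair0 b.+4.+2 N f).
apply: (eq_tpair_ord _ _ fR) => q u u0 Rq; rewrite -[RHS](tpair0 b.+4.+2 N f').
apply: (eq_tpair_ord _ _ fR') => q' u' u'0 Rq'.
(* At index 0 the list of edges is empty and [cross] vanishes. For positive indices, (q - 1) + (q' -
   1) is the order seen by the unshifted test. *)
case: q u0 Rq => [u0 _|q _ /= Rq]; first by rewrite u0.
case: q' u'0 Rq' => [u'0 _|q' _ /= Rq']; first by rewrite u'0 // cross_nil.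
rewrite addnS /= RR //=; exact: (linear_fun0 (@cross_linear _ _ _ u u')).
Qed.

Lemma lie_d_par a x : supported (par_pred a) x -> supported (par_pred (~~ a)) (lie_d c x).
Proof.
move=> [f -> fa]; rewrite lie_dE; apply: supported_null.
apply: null_of_tests => b N Psi tP; exists b.+2; first by lia.
have -> : restr (predC (par_pred (~~ a))) (sd lp c f) = restr (par_pred a) (sd lp c f).
  apply/funext => m; rewrite /restr /par_pred /=; congr (if _ then _ else _).
  by case: (mpar lp m); case: (a).
rewrite tpair_restr_par; have [bd sp _] := restr_test_par a tP.
rewrite (tpair_sd c_odd _ _ bd sp) // -[RHS]oppr0; congr (- _); rewrite -[RHS](tpair0 b.+2 N f).
apply: (eq_tpair_par _ _ fa) => q u uE.
rewrite -[RHS](linear_fun0 (@lap_linear _ (@epar I lp) (@eform I c) u)).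
apply: (eq_lap_wp (eform_odd c_odd)) => m ->; rewrite uE.
by case: (a).
Qed.

Lemma lie_br_par a a' x y : supported (par_pred a) x -> supported (par_pred a') y ->
  supported (par_pred (~~ (a (+) a'))) (lie_br c x y).
Proof.
move=> [f -> fa] [f' -> fa']; rewrite lie_brE; apply: supported_null.
apply: null_of_tests => b N Psi tP; exists b.+4.+2; first by lia.
set P := predC _.
have -> : restr P (sbr lp c f f') = restr (par_pred (a (+) a')) (sbr lp c f f').
  apply/funext => m; rewrite /restr /P /par_pred /=; congr (if _ then _ else _).
  by case: (mpar lp m); case: (a (+) a').
rewrite tpair_restr_par (tpair_sbr_series _ _ _ (restr_test_par (a (+) a') tP)) //.
rewrite -[RHS](tpair0 b.+4.+2 N f); apply: (eq_tpair_par _ _ fa) => q u uE.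
rewrite -[RHS](tpair0 b.+4.+2 N f'); apply: (eq_tpair_par _ _ fa') => q' u' u'E.
rewrite -[RHS](linear_fun0 (@cross_linear _ (@epar I lp) (@eform I c) u u')).
apply: (eq_cross_wp (eform_odd c_odd)) => m mE.
rewrite /unshift; case: (q + q')%N => // k /=.
by rewrite mE uE u'E; case: (a (+) a').
Qed.

Lemma hom_eq0 p x : supported (order_pred (pred1 p)) x ->
  supported (order_pred (fun k => p < k)%N) x -> x = 0.
Proof.
move=> hx gx; rewrite -(supported_proj (stable_ord _) hx).
apply: supported_proj0 gx _; first exact: stable_ord.
by move=> m /eqP; rewrite /order_pred => ->; rewrite ltnn.
Qed.

(** The monomials excluded from Lambda, a single word of length 1 without gamma, have order 0. *)
Lemma Lam_ord p x : supported (order_pred (fun k => p < k)%N) x -> Lam x.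
Proof.
apply: supported_sub => -[g ws]; rewrite /order_pred /mord /=.
by apply: contraTN => /andP[/eqP -> /eqP ws1]; rewrite -(size_map size) ws1.
Qed.

End Lie.

(** * The obstruction *)

Section InverseForm.

Variables (r : nat) (par : 'I_r -> bool) (G : 'M[rat]_r).
Hypothesis G_skew : G^T = - G.
Hypothesis G_odd : forall i j, par i = par j -> G i j = 0.

Let S : 'M[rat]_r := diag_mx (\row_i (-1) ^+ par i).

Lemma invmx_skew : (invmx G)^T = - invmx G.
Proof.
rewrite trmx_inv G_skew; have [uG|nG] := boolP (G \in unitmx).
  by rewrite -scaleN1r invmxZ ?invrN1 ?scaleN1r // -scaleN1r unitmxZ ?unitrN1.
have nG' : - G \notin unitmx by rewrite -scaleN1r unitmxZ ?unitrN1.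
by rewrite /invmx (negbTE nG) (negbTE nG').
Qed.

(** Oddness of [G] means that it anticommutes with the sign matrix [S]; then so does its inverse,
    and its entries between equal parities equal their own negatives. *)
Lemma invmx_odd i j : par i = par j -> invmx G i j = 0.
Proof.
(* For a singular matrix [invmx] returns the matrix itself. *)
move=> pij; have [uG|nG] := boolP (G \in unitmx); last first.
  by rewrite /invmx (negbTE nG) G_odd.
have SS : S *m S = 1%:M.
  apply/matrixP => a b; rewrite mul_diag_mx !mxE.
  by case: eqP => [->|_]; rewrite ?mulr1n ?mulr0n ?mulr0 // -expr2 sqrr_sign.
have GS : G *m S = - (S *m G).
  apply/matrixP => a b; rewrite mul_mx_diag [RHS]mxE mul_diag_mx !mxE.
  case: (eqVneq (par a) (par b)) => [/G_odd ->|]; first by rewrite mul0r mulr0 oppr0.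
  by case: (par a); case: (par b) => //= _; rewrite ?expr0 ?expr1; ring.
have E : invmx G = - (S *m invmx G *m S).
  have H : G *m (- (S *m invmx G *m S)) = 1%:M.
    by rewrite mulmxN !mulmxA GS !mulNmx opprK -(mulmxA S) mulmxV // mulmx1 SS.
  by rewrite -[LHS]mulmx1 -H mulmxA mulVmx // mul1mx.
have := congr1 (fun M : 'M_r => M i j) E.
rewrite mxE mul_mx_diag mul_diag_mx !mxE pij => H.
have : invmx G i j = - invmx G i j.
  by rewrite {1}H -mulrA [_ * (-1) ^+ _]mulrC mulrA -expr2 sqrr_sign mul1r.
by move=> H'; lra.
Qed.

End InverseForm.

Section Obstruction.

Variables (I : finType) (lp : I -> bool) (c : I -> I -> rat).
Hypothesis c_sym : forall x y, c x y = c y x.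
Hypothesis c_odd : forall x y, lp x = lp y -> c x y = 0.

Local Notation hom p := (supported (order_pred (pred1 p))).
Local Notation ge p := (supported (order_pred (fun k => (p <= k)%N))).
Implicit Types (x y z o : lie lp).

Lemma lie_even_par x : lie_even x <-> supported (par_pred lp false) x.
Proof.
by split; apply: supported_sub => m; rewrite /par_pred; case: (mpar lp m).
Qed.

Lemma obstruction (h : cyc lp) n (hs : 'I_n.+1 -> lie lp) (o : lie lp) :
    (forall i : 'I_n.+1, Lam_hom i (hs i)) -> hs ord0 = emb h ->
    let x := \sum_(i < n.+1) hs i in
    MC_mod c n.+1 x -> Lam_hom n.+1 o -> Fil n.+2 (curv c x - o) ->
  cocycle c h o /\
  ((exists2 h' : lie lp, Lam_hom n.+1 h' & MC_mod c n.+2 (x + h')) <->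
   coh_class c h n.+1 o = coh_class c h n.+1 0).
Proof.
move=> hom_hs hs0 x [Lx [y [_ gy] ev_xy] [_ gcx]] [Lo ho] [_ go].
have hs_hom (i : 'I_n.+1) : hom (nat_of_ord i) (hs i) by have [_] := hom_hs i.
pose h0 := emb h; pose x' := x - h0.
have xE : x = h0 + x' by rewrite /x' addrC subrK.
have hh0 : hom 0%N h0 by rewrite /h0 -hs0; exact: (hs_hom ord0).
have gx' : ge 1%N x'.
  rewrite /x' /x big_ord_recl /= hs0 -/h0 addrC addKr.
  apply: supported_sum => i _; apply: supported_sub (hs_hom _) => m /eqP.
  by rewrite /order_pred => ->.
have lx : supported (order_pred (fun k => (k <= n)%N)) x.
  apply: supported_sum => i _; apply: supported_sub (hs_hom i) => m /eqP.
  by rewrite /order_pred => ->; rewrite -ltnS.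
(* [MC_mod] makes [x] even only up to some [y] of order above n; projecting to orders at most n
   removes [y] and keeps [x]. *)
have ex : lie_even x.
  rewrite -(supported_proj (stable_ord _ _) lx) -[x](subrK y).
  rewrite projD; last exact: stable_ord.
  rewrite [proj _ y](supported_proj0 (stable_ord _ _) gy) ?addr0.
    exact: proj_supp (stable_ord _ _) ev_xy.
  by move=> m; rewrite /order_pred -ltnNge ltnS.
(* The embedded structure is the order-zero component of the even element [x]. *)
have eh0 : lie_even h0.
  have -> : h0 = proj (order_pred (pred1 0%N)) x.
    rewrite xE projD; last exact: stable_ord.
    rewrite (supported_proj (stable_ord _ _) hh0).
    rewrite [proj _ x'](supported_proj0 (stable_ord _ _) gx') ?addr0 //.
    by move=> m /eqP; rewrite /order_pred => ->.
  exact: proj_supp (stable_ord _ _) ex.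
have ge_sub p q z : (q <= p)%N -> ge p z -> ge q z.
  by move=> qp; apply: supported_sub => m; apply: leq_trans.
have hom_ge p z : hom p z -> ge p z.
  by apply: supported_sub => m /eqP; rewrite /order_pred => ->.
have br_ge p q z z' : ge p z -> ge q z' -> ge (p + q)%N (lie_br c z z').
  by apply: lie_br_ord => // j k; apply: leq_add.
have br_hom p q z z' : hom p z -> hom q z' -> hom (p + q)%N (lie_br c z z').
  by apply: lie_br_ord => // j k /eqP -> /eqP ->; apply: eqxx.
have d_ge p z : ge p z -> ge p.+1 (lie_d c z) by apply: lie_d_ord.
have ge0 z : ge 0%N z.
  by have [f ->] := pi_lie_surj z; exists f.
have cocyc : cocycle c h o.
  (* It remains to see that this bracket also has order above n+1, as every other term of the
     Bianchi identity has. *)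
  apply: (@hom_eq0 _ _ n.+1); first exact: (br_hom 0%N n.+1).
  have := bianchi c_sym c_odd ex.
  set r := curv c x - o in go; have -> : curv c x = o + r by rewrite /r addrC subrK.
  rewrite lie_dD // [in X in _ + X]lie_brDr // {1}xE lie_brDl // -/h0.
  set t := lie_br c h0 o => /eqP H.
  have -> : t = - (lie_d c o + lie_d c r + (lie_br c x' o + lie_br c x r)).
    apply/eqP; rewrite -addr_eq0 -[X in _ == X](eqP H); apply/eqP.
    by rewrite addrCA -(addrA t).
  apply: supportedN; apply: supportedD.
    apply: supportedD; first exact/d_ge/hom_ge.
    by apply: ge_sub (d_ge _ _ go).
  apply: supportedD.
    by apply: (ge_sub (1 + n.+1)%N) => //; apply: br_ge => //; apply: hom_ge.
  by apply: (ge_sub (0 + n.+2)%N) => //; apply: br_ge.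
split=> //.
have brC z z' : lie_even z' -> lie_br c z z' = lie_br c z' z by apply: lie_brC.
have curvD h' : lie_even h' ->
    curv c (x + h') = curv c x + lie_d c h' + lie_br c x h' + 2^-1 *: lie_br c h' h'.
  move=> eh'; rewrite /curv lie_dD // !lie_brDl // !lie_brDr //.
  rewrite (brC h' x) //.
  move: (lie_d c x) (lie_d c h') (lie_br c x x) (lie_br c x h') (lie_br c h' h').
  move=> a b k m l; have hm : 2^-1 *: m + 2^-1 *: m = m.
    by rewrite -scalerDl (_ : 2^-1 + 2^-1 = 1 :> rat) ?scale1r //; lra.
  have E : 2^-1 *: k + 2^-1 *: m + (2^-1 *: m + 2^-1 *: l) = 2^-1 *: k + m + 2^-1 *: l.
    by rewrite addrA -(addrA (2^-1 *: k)) hm.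
  by rewrite !scalerDr E !addrA (addrAC a b).
have ox : forall h', hom n.+1 h' -> lie_even h' ->
    exists2 z, ge n.+2 z & curv c (x + h') = o + lie_br c h0 h' + z.
  move=> h' hh' eh'; exists (curv c x - o + (lie_d c h' + lie_br c x' h'
    + 2^-1 *: lie_br c h' h')).
    apply: supportedD => //; apply: supportedD; first apply: supportedD.
    - exact/d_ge/hom_ge.
    - by apply: (ge_sub (1 + n.+1)%N) => //; apply: br_ge => //; apply: hom_ge.
    apply: supportedZ; apply: (ge_sub (n.+1 + n.+1)%N); first by lia.
    by apply: br_ge; apply: hom_ge.
  rewrite curvD // {2}xE lie_brDl // -/h0.
  move: (curv c x) (lie_d c h') (lie_br c h0 h') (lie_br c x' h') (_ *: _) => k d b b' q.
  rewrite [RHS]addrACA [o + _]addrC subrK -!addrA; congr (_ + _).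
  by rewrite addrCA.
have homN p z : hom p z -> hom p (- z) by apply: supportedN.
have homD p z z' : hom p z -> hom p z' -> hom p (z + z') by apply: supportedD.
have hom_gt0 p z : hom p.+1 z -> Lam z.
  move=> hz; apply: (@Lam_ord _ _ p); apply: supported_sub hz => m /eqP.
  by rewrite /order_pred => ->.
split=> [[h' [_ hh'] [_ [y' [_ gy'] ev'] [_ gc']]]|E].
  (* Again evenness is given only up to a [y'] of order at least n+2; the projection to order n+1
     removes both [x] and [y']. *)
  have eh' : lie_even h'.
    have -> : h' = proj (order_pred (pred1 n.+1)) (x + h' - y').
      rewrite !projD; try exact: stable_ord.
      rewrite (supported_proj (stable_ord _ _) hh').
      rewrite (supported_proj0 (stable_ord _ _) lx); last first.
        by move=> m /eqP; rewrite /order_pred => ->; rewrite ltnn.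
      rewrite (supported_proj0 (stable_ord _ _) (supportedN gy')); last first.
        by move=> m /eqP; rewrite /order_pred => ->; rewrite ltnn.
      by rewrite add0r addr0.
    exact: proj_supp (stable_ord _ _) ev'.
  have [z gz cE] := ox h' hh' eh'.
  have oE : o + lie_br c h0 h' = 0.
    apply: (@hom_eq0 _ _ n.+1); first by apply: homD => //; apply: (br_hom 0%N n.+1).
    rewrite -[o + _](addrK z) -cE; apply: supportedD => //; exact: supportedN.
  (* Since o = - [h, h'], translating the element of order n+1 by [h'] identifies the two cosets. *)
  apply/seteqP; split=> z' [w [_ hw] ->].
    exists (w - h'); last first.
      rewrite lie_brDr // lie_brNr // -/h0 add0r addrC -[o in LHS](addrK (lie_br c h0 h')) oE.
      by rewrite sub0r.
    have hwh : hom n.+1 (w - h') by apply: homD => //; apply: homN.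
    by split=> //; apply: hom_gt0 hwh.
  exists (w + h'); last first.
    by rewrite lie_brDr // -/h0 add0r addrCA oE addr0.
  have hwh : hom n.+1 (w + h') by apply: homD.
  by split=> //; apply: hom_gt0 hwh.
have [w [_ hw] oE] : coh_class c h n.+1 0 o.
  rewrite -E; exists 0; last by rewrite lie_br0r // addr0.
  by split; apply: supported0.
rewrite add0r -/h0 in oE.
pose w0 := proj (par_pred lp false) w; pose w1 := proj (par_pred lp true) w.
have wE : w = w0 + w1.
  have [f fE] := pi_lie_surj w.
  rewrite /w0 /w1 fE !projE; try exact: stable_par.
  rewrite -pi_lieD; congr (\pi_(lie lp)%qT _); apply/funext => m.
  transitivity (restr (par_pred lp false) f m + restr (par_pred lp true) f m); last by [].
  by rewrite /restr /par_pred; case: (mpar lp m); rewrite ?add0r ?addr0.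
have px : supported (par_pred lp false) x by apply/lie_even_par.
have p0 : supported (par_pred lp false) h0 by apply/lie_even_par.
have pw0 : supported (par_pred lp false) w0 by apply: proj_supported.
(* [o] is the component of order n+1 of the curvature, which is odd because [x] is even and both d
   and the bracket are odd. *)
have oo : supported (par_pred lp true) o.
  have -> : o = proj (order_pred (pred1 n.+1)) (curv c x).
    rewrite -[curv c x](subrK o) projD; last exact: stable_ord.
    rewrite (supported_proj (stable_ord _ _) ho).
    rewrite (supported_proj0 (stable_ord _ _) go) ?add0r //.
    by move=> m /eqP; rewrite /order_pred => ->; rewrite ltnn.
  apply: proj_supp (stable_ord _ _) _; apply: supportedD.
    exact: (lie_d_par c_sym c_odd px).
  exact/supportedZ/(lie_br_par c_sym c_odd px px).
have oE0 : o = lie_br c h0 w0.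
  rewrite -(supported_proj (stable_par _ _) oo) oE wE lie_brDr // projD; last exact: stable_par.
  rewrite (supported_proj (stable_par _ _) (lie_br_par c_sym c_odd p0 pw0)).
  rewrite (supported_proj0 (stable_par _ _)
    (lie_br_par c_sym c_odd p0 (proj_supported _ w))) ?addr0 //.
  by move=> m /eqP; rewrite /par_pred => ->.
have hw0 : hom n.+1 (- w0) by apply: homN; apply: proj_supp (stable_par _ _) hw.
have ew0 : lie_even (- w0) by apply/lie_even_par/supportedN.
have Lw0 := hom_gt0 _ _ hw0.
exists (- w0) => //; split.
- exact: supportedD.
- exists 0; first by split; apply: supported0.
  by rewrite subr0; apply/lie_even_par/supportedD; apply/lie_even_par.
have [z gz cE] := ox _ hw0 ew0.
have gc : ge n.+2 (curv c (x - w0)).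
  by rewrite cE lie_brNr // -oE0 subrr add0r.
split=> //; apply: (@Lam_ord _ _ n.+1); apply: supported_sub gc => m.
by [].
Qed.

End Obstruction.

Theorem theorem5p1 (W : vectType rat) (Wg : bool -> {vspace W})
    (form : {biscalar W}) (r : nat) (e : r.-tuple W) (par : 'I_r -> bool) :
  odd_symmetric_space Wg form ->
  homogeneous_basis Wg e par ->
  let lp := Vpar par in
  let c := inv_form lp (Vgram form e par) in
  forall h : cyc lp, MC_cyc c h ->
  forall (n : nat) (hs : 'I_n.+1 -> lie lp),
    (forall i : 'I_n.+1, Lam_hom i (hs i)) ->
    hs ord0 = emb h ->
    let x := \sum_(i < n.+1) hs i in
    MC_mod c n.+1 x ->
  forall o : lie lp,
    Lam_hom n.+1 o ->
    Fil n.+2 (curv c x - o) ->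
    cocycle c h o /\
    ((exists2 h' : lie lp, Lam_hom n.+1 h' & MC_mod c n.+2 (x + h')) <->
     coh_class c h n.+1 o = coh_class c h n.+1 0).
Proof.
move=> [_ _ form_odd form_sym _] [_ e_par] lp c h _ n hs hom_hs hs0 x MCx o.
have G_odd i j : par i = par j -> Vgram form e par i j = 0.
  move=> pij; rewrite mxE (form_odd (par i)) ?mulr0 //.
  by rewrite pij.
(* Only entries between opposite parities survive. There the form is symmetric without sign, while
   the factor (-1)^|a| of the Gram matrix changes sign under transposition. *)
have G_skew : (Vgram form e par)^T = - Vgram form e par.
  apply/matrixP => i j; rewrite mxE [RHS]mxE.
  have [pij|pij] := eqVneq (par i) (par j); first by rewrite !G_odd ?oppr0.
  rewrite !mxE (form_sym _ _ _ _ (e_par j) (e_par i)).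
  by move: pij; case: (par i); case: (par j) => //= _; rewrite ?expr0 ?expr1; ring.
have c_odd i j : lp i = lp j -> c i j = 0.
  by move=> /negb_inj pij; rewrite /c /inv_form (invmx_odd G_odd) ?mulr0.
(* The inverse is skew, and for letters of opposite parities the sign in [inv_form] turns skew into
   symmetric. *)
have c_sym i j : c i j = c j i.
  have [lij|lij] := eqVneq (lp i) (lp j); first by rewrite !c_odd.
  have := congr1 (fun M : 'M_r => M i j) (invmx_skew G_skew).
  rewrite /c /inv_form !mxE => ->; move: lij.
  by case: (lp i); case: (lp j) => //= _; rewrite ?expr0 ?expr1; ring.
exact: obstruction MCx.
Qed.
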